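(* Let $F$ be a finite group. Let $\eta$ be the real root of $X^3+X^2+X-2$ and let $\alpha_0=\frac{\log 2}{\log 2-\log\eta}$. For any $\alpha\le\beta$ in $[\alpha_0,1]$ there exists a sequence $\omega(\alpha,\beta)\in\{0,1,2\}^{\mathbb N}$ such that the group $\Gamma_{\omega(\alpha,\beta)}=F\wr_X G_{\omega(\alpha,\beta)}$ has lower logarithmic growth exponent $\alpha$ and upper logarithmic growth exponent $\beta$, i.e. $$\liminf_{r\to\infty}\frac{\log\log b_{\Gamma_{\omega(\alpha,\beta)}}(r)}{\log r}=\alpha\quad\text{and}\quad\limsup_{r\to\infty}\frac{\log\log b_{\Gamma_{\omega(\alpha,\beta)}}(r)}{\log r}=\beta .$$
   Context: Let $T$ be the infinite rooted binary tree, with vertices the finite words over $\{0,1\}$ and boundary $\partial T=\{0,1\}^{\mathbb N}$. The group $Aut(T)$ acts on the right, and $g\in Aut(T)$ is written $g=(g_0,g_1)\tau$ with $g_0,g_1\in Aut(T)$, $\tau\in S_2$ (permutations of $\{0,1\}$), meaning $(ty)\cdot g=\tau(t)\,(y\cdot g_t)$ for $t\in\{0,1\}$; this identifies $Aut(T)$ with $(Aut(T)\times Aut(T))\rtimes S_2$. Let $\varepsilon$ be the nontrivial element of $S_2$. For $\omega=\omega_0\omega_1\omega_2\dots\in\{0,1,2\}^{\mathbb N}$ let $\sigma\omega=\omega_1\omega_2\dots$ be the shift. The group $G_\omega=\langle a,b_\omega,c_\omega,d_\omega\rangle\le Aut(T)$ is generated by $a=(1,1)\varepsilon$ and the recursively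 defined $b_\omega=(u^b(\omega_0),b_{\sigma\omega})$, $c_\omega=(u^c(\omega_0),c_{\sigma\omega})$, $d_\omega=(u^d(\omega_0),d_{\sigma\omega})$, where $u^b(0)=u^b(1)=a$, $u^b(2)=id$; $u^c(0)=u^c(2)=a$, $u^c(1)=id$; $u^d(1)=u^d(2)=a$, $u^d(0)=id$. Let $\rho=1^\infty\in\partial T$ (fixed by $b_\omega,c_\omega,d_\omega$) and $X=\rho G_\omega$ its orbit. For a finite group $F$, $\Gamma_\omega=F\wr_X G_\omega=(\Sigma_X F)\rtimes G_\omega$, where $\Sigma_X F$ is the group of finitely supported functions $\varphi:X\to F$, $G_\omega$ acts by $(g.\varphi)(x)=\varphi(xg)$, and elements $\varphi g$ multiply by $(\varphi_1g_1)(\varphi_2g_2)=(\varphi_1(g_1.\varphi_2))(g_1g_2)$. It is a finitely generated group. For a finitely generated group $\Gamma$ with finite generating set $S$, $b_\Gamma(r)$ denotes the number of elements of word length at most $r$; the liminf and limsup in the claim do not depend on $S$. *)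

(* Defs.v *)
From HB Require Import structures.
From mathcomp Require Import all_boot all_order all_algebra all_fingroup.
From mathcomp Require Import finmap.
From mathcomp Require Import all_classical all_reals all_analysis.
From mathcomp Require Import ring lra.

Set Implicit Arguments.
Unset Strict Implicit.
Unset Printing Implicit Defensive.

Import Order.TTheory GRing.Theory Num.Theory.

Local Open Scope classical_set_scope.
Local Open Scope group_scope.

Section Growth.
Variable G : groupType.

Definition is_subgroup (H : set G) : Prop :=
  [/\ H 1, forall x y, H x -> H y -> H (x * y) & forall x, H x -> H x^-1].

Definition generated (S : set G) : set G := smallest is_subgroup S.

Definition generates (S : {fset G}) : Prop := generated [set` S] = [set: G].

(* [S] is not assumed to be symmetric. *)
Definition word_ball (S : {fset G}) (r : nat) : set G :=
  [set x | exists s : seq G,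
     [/\ (size s <= r)%N, all (fun y => (y \in S) || (y^-1 \in S)) s
       & x = \prod_(y <- s) y]].

(* [fset_set] is meaningful here because of [finite_word_ball] below. *)
Definition growth (S : {fset G}) (r : nat) : nat :=
  #|` fset_set (word_ball S r)|.

Lemma generated_sub (S : set G) : S `<=` generated S.
Proof. by move=> x Sx H [_]; apply. Qed.

Lemma is_subgroup_generated (S : set G) : is_subgroup (generated S).
Proof.
split=> [H [[]] //|x y Hx Hy H HS|x Hx H HS].
  by case: (HS) => -[_ + _ _]; apply; [exact: Hx | exact: Hy].
by case: (HS) => -[_ _ + _]; apply; exact: Hx.
Qed.

Lemma generated_min (S H : set G) :
  is_subgroup H -> S `<=` H -> generated S `<=` H.
Proof. by move=> sgH SH x; apply. Qed.

Lemma finite_word_ball S r : finite_set (word_ball S r).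
Proof.
elim: r => [|r IHr].
  apply: (@sub_finite_set _ _ [set 1]) => // x [s [+ _ ->]].
  by rewrite leqn0 size_eq0 => /eqP ->; rewrite big_nil.
pose B := word_ball S r; pose L := [set` S] `|` [set x^-1 | x in [set` S]].
have finL : finite_set L.
  by rewrite finite_setU; split=> //; exact: finite_image.
apply: (@sub_finite_set _ _
  ([set 1] `|` (fun p : G * G => p.1 * p.2) @` (L `*` B))).
  move=> x [[|y s] [/= sr sS ->]]; first by left; rewrite big_nil.
  case/andP: sS => yS sS; right; exists (y, \prod_(z <- s) z) => /=.
    split=> /=; last by exists s.
    case/orP: yS => [|yS]; first by left.
    by right; exists y^-1 => //; rewrite invgK.
  by rewrite big_cons.
rewrite finite_setU; split=> //; apply: finite_image.
exact: finite_setX.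
Qed.

End Growth.

Section GeneratedGroup.
Variables (G : groupType) (S : set G).

Definition gen_group : Type := set_type (generated S).

HB.instance Definition _ := Choice.on gen_group.

Definition gen_one : gen_group.
Proof. by exists 1; apply: mem_set; case: (is_subgroup_generated S). Defined.

Definition gen_mul (x y : gen_group) : gen_group.
Proof.
exists (val x * val y); apply: mem_set.
by case: (is_subgroup_generated S) => _ + _; apply; apply: set_valP.
Defined.

Definition gen_inv (x : gen_group) : gen_group.
Proof.
exists (val x)^-1; apply: mem_set.
by case: (is_subgroup_generated S) => _ _; apply; apply: set_valP.
Defined.

Fact gen_mulA : associative gen_mul.
Proof. by move=> x y z; apply: val_inj; rewrite /= mulgA. Qed.
Fact gen_mul1g : left_id gen_one gen_mul.
Proof. by move=> x; apply: val_inj; rewrite /= mul1g. Qed.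
Fact gen_mulg1 : right_id gen_one gen_mul.
Proof. by move=> x; apply: val_inj; rewrite /= mulg1. Qed.
Fact gen_mulVg : left_inverse gen_one gen_inv gen_mul.
Proof. by move=> x; apply: val_inj; rewrite /= mulVg. Qed.
Fact gen_mulgV : right_inverse gen_one gen_inv gen_mul.
Proof. by move=> x; apply: val_inj; rewrite /= mulgV. Qed.

HB.instance Definition _ := isGroup.Build gen_group
  gen_mulA gen_mul1g gen_mulg1 gen_mulVg gen_mulgV.

Definition gval (x : gen_group) : G := \val x.

Lemma gval1 : gval 1 = 1. Proof. by []. Qed.
Lemma gvalM x y : gval (x * y) = gval x * gval y. Proof. by []. Qed.
Lemma gvalV x : gval x^-1 = (gval x)^-1. Proof. by []. Qed.
Lemma gvalP x : generated S (gval x). Proof. exact: set_valP. Qed.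
Lemma gval_inj : injective gval. Proof. exact: val_inj. Qed.

End GeneratedGroup.

Record raction (X : Type) (G : groupType) := RAction {
  ract :> X -> G -> X;
  ract1 : forall x, ract x 1 = x;
  ractM : forall x g h, ract x (g * h) = ract (ract x g) h }.

Section Lamps.
Variables (X : choiceType) (F : groupType).

Record lamps := Lamps {
  lamp :> X -> F;
  _ : `[< finite_set [set x | lamp x != 1] >] }.

HB.instance Definition _ := [isSub for lamp].
HB.instance Definition _ := [Choice of lamps by <:].

Lemma lampP (phi : lamps) : finite_set [set x | phi x != 1].
Proof. by case: phi => phi /= /asboolP. Qed.

Lemma lamps_ext (phi psi : lamps) : phi =1 psi -> phi = psi.
Proof. by move=> e; apply: val_inj; apply/funext. Qed.

Fact lamp_one_subproof :
  `[< finite_set [set x | (fun _ : X => 1 : F) x != 1] >].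
Proof.
by apply/asboolP; apply: (@sub_finite_set _ _ set0) => // x /=; rewrite eqxx.
Qed.
Definition lamp_one : lamps := Lamps lamp_one_subproof.

Fact lamp_mul_subproof (phi psi : lamps) :
  `[< finite_set [set x | (fun x => phi x * psi x) x != 1] >].
Proof.
apply/asboolP; apply: (@sub_finite_set _ _
  ([set x | phi x != 1] `|` [set x | psi x != 1])).
  move=> x /= pq; have [e|] := eqVneq (phi x) 1; last by left.
  by right; move: pq; rewrite e mul1g.
by rewrite finite_setU; split; exact: lampP.
Qed.
Definition lamp_mul (phi psi : lamps) : lamps := Lamps (lamp_mul_subproof phi psi).

Fact lamp_inv_subproof (phi : lamps) :
  `[< finite_set [set x | (fun x => (phi x)^-1) x != 1] >].
Proof.
apply/asboolP; apply: sub_finite_set (lampP phi) => x /=.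
by apply: contra => /eqP ->; rewrite invg1.
Qed.
Definition lamp_inv (phi : lamps) : lamps := Lamps (lamp_inv_subproof phi).

Fact lamp_delta_subproof (x0 : X) (f : F) :
  `[< finite_set [set x | (fun x => if x == x0 then f else 1) x != 1] >].
Proof.
apply/asboolP; apply: (@sub_finite_set _ _ [set x0]) => // x /=.
by case: (x =P x0); rewrite ?eqxx.
Qed.
Definition lamp_delta (x0 : X) (f : F) : lamps := Lamps (lamp_delta_subproof x0 f).

Variables (G : groupType) (act : raction X G).

Fact lamp_shift_subproof (g : G) (phi : lamps) :
  `[< finite_set [set x | (fun x => phi (act x g)) x != 1] >].
Proof.
apply/asboolP; apply: (@sub_finite_set _ _
  ((act^~ g^-1) @` [set x | phi x != 1])).
  by move=> x /= px; exists (act x g) => //; rewrite -ractM mulgV ract1.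
exact: finite_image (lampP phi).
Qed.
(* g.phi : x |-> phi (x g). *)
Definition lamp_shift (g : G) (phi : lamps) : lamps :=
  Lamps (lamp_shift_subproof g phi).

(* (phi, g) is the element written phi g. *)
Definition wreath (act : raction X G) : Type := (lamps * G)%type.

HB.instance Definition _ := Choice.on (wreath act).

Definition wreath_one : wreath act := (lamp_one, 1).
Definition wreath_mul (u v : wreath act) : wreath act :=
  (lamp_mul u.1 (lamp_shift u.2 v.1), u.2 * v.2).
Definition wreath_inv (u : wreath act) : wreath act :=
  (lamp_shift u.2^-1 (lamp_inv u.1), u.2^-1).

Fact wreath_mulA : associative wreath_mul.
Proof.
move=> [p g] [q h] [r k]; rewrite /wreath_mul /= mulgA.
by congr pair; apply: lamps_ext => x /=; rewrite mulgA ractM.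
Qed.
Fact wreath_mul1g : left_id wreath_one wreath_mul.
Proof.
move=> [p g]; rewrite /wreath_mul /= mul1g.
by congr pair; apply: lamps_ext => x /=; rewrite mul1g ract1.
Qed.
Fact wreath_mulg1 : right_id wreath_one wreath_mul.
Proof.
move=> [p g]; rewrite /wreath_mul /= mulg1.
by congr pair; apply: lamps_ext => x /=; rewrite mulg1.
Qed.
Fact wreath_mulVg : left_inverse wreath_one wreath_inv wreath_mul.
Proof.
move=> [p g]; rewrite /wreath_mul /wreath_inv /= mulVg.
by congr pair; apply: lamps_ext => x /=; rewrite mulVg.
Qed.
Fact wreath_mulgV : right_inverse wreath_one wreath_inv wreath_mul.
Proof.
move=> [p g]; rewrite /wreath_mul /wreath_inv /= mulgV.
by congr pair; apply: lamps_ext => x /=; rewrite -ractM mulgV ract1 mulgV.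
Qed.

HB.instance Definition _ := isGroup.Build (wreath act)
  wreath_mulA wreath_mul1g wreath_mulg1 wreath_mulVg wreath_mulgV.

Lemma wreathM (u v : wreath act) :
  u * v = (lamp_mul u.1 (lamp_shift u.2 v.1), u.2 * v.2) :> wreath act.
Proof. by []. Qed.

Lemma wreathV (u : wreath act) :
  u^-1 = (lamp_shift u.2^-1 (lamp_inv u.1), u.2^-1) :> wreath act.
Proof. by []. Qed.

End Lamps.

Definition word := seq bool.
Definition ray := nat -> bool.

Definition tree_morphism (f : word -> word) : Prop :=
  f [::] = [::] /\ forall w t, exists s, f (rcons w t) = rcons (f w) s.

(* An automorphism is stored together with its (unique) inverse bijection. *)
Definition is_autT (p : (word -> word) * (word -> word)) : Prop :=
  [/\ cancel p.1 p.2, cancel p.2 p.1 & tree_morphism p.1].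

Record autT := AutT {
  autT_val : (word -> word) * (word -> word);
  _ : `[< is_autT autT_val >] }.

HB.instance Definition _ := [isSub for autT_val].
HB.instance Definition _ := [Choice of autT by <:].

(* Right action on vertices: [wact g w] is w.g *)
Definition wact (g : autT) : word -> word := (autT_val g).1.
Definition wact_inv (g : autT) : word -> word := (autT_val g).2.

Lemma autTP (g : autT) :
  [/\ cancel (wact g) (wact_inv g), cancel (wact_inv g) (wact g)
    & tree_morphism (wact g)].
Proof. by apply/asboolP; exact: (valP g). Qed.

Lemma autT_ext (g h : autT) : wact g =1 wact h -> g = h.
Proof.
move=> e; apply: val_inj.
have [gK1 gK2 _] := autTP g; have [hK1 hK2 _] := autTP h.
have e1 : wact g = wact h by apply/funext.
have e2 : wact_inv g = wact_inv h.
  by apply/funext => w; rewrite -{1}(hK2 w) -e gK1.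
by rewrite /= (surjective_pairing (autT_val g)) -/(wact g) -/(wact_inv g) e1 e2
  -surjective_pairing.
Qed.

Lemma tree_morphism_size f w : tree_morphism f -> size (f w) = size w.
Proof.
move=> [f0 fr]; elim/last_ind: w => [|w t IHw]; first by rewrite f0.
by have [s ->] := fr w t; rewrite !size_rcons IHw.
Qed.

Lemma tree_morphism_inv f f' : cancel f f' -> cancel f' f ->
  tree_morphism f -> tree_morphism f'.
Proof.
move=> fK f'K tf; have [f0 fr] := tf.
split=> [|w t]; first by rewrite -f0 fK.
case: (lastP (f' (rcons w t))) (f'K (rcons w t)) => [|v s].
  by rewrite f0 => /(congr1 size); rewrite size_rcons.
have [s' ->] := fr v s => /rcons_inj [<- _].
by exists s; rewrite fK.
Qed.

Fact autT_one_subproof : `[< is_autT (id, id) >].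
Proof. by apply/asboolP; split=> //; split=> // w t; exists t. Qed.
Definition autT_one : autT := AutT autT_one_subproof.

Fact autT_mul_subproof (g h : autT) :
  `[< is_autT (wact h \o wact g, wact_inv g \o wact_inv h) >].
Proof.
have [gK1 gK2 [g0 gr]] := autTP g; have [hK1 hK2 [h0 hr]] := autTP h.
apply/asboolP; split=> [w|w|] /=; rewrite ?hK1 ?gK2 //.
split=> [|w t] /=; first by rewrite g0.
by have [s ->] := gr w t; have [s' ->] := hr (wact g w) s; exists s'.
Qed.
Definition autT_mul (g h : autT) : autT := AutT (autT_mul_subproof g h).

Fact autT_inv_subproof (g : autT) : `[< is_autT (wact_inv g, wact g) >].
Proof.
have [gK1 gK2 tg] := autTP g; apply/asboolP; split=> //=.
exact: tree_morphism_inv tg.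
Qed.
Definition autT_inv (g : autT) : autT := AutT (autT_inv_subproof g).

Fact autT_mulA : associative autT_mul.
Proof. by move=> g h k; apply: autT_ext. Qed.
Fact autT_mul1g : left_id autT_one autT_mul.
Proof. by move=> g; apply: autT_ext. Qed.
Fact autT_mulg1 : right_id autT_one autT_mul.
Proof. by move=> g; apply: autT_ext. Qed.
Fact autT_mulVg : left_inverse autT_one autT_inv autT_mul.
Proof. by move=> g; apply: autT_ext => w; have [_ K _] := autTP g; exact: K. Qed.
Fact autT_mulgV : right_inverse autT_one autT_inv autT_mul.
Proof. by move=> g; apply: autT_ext => w; have [K _ _] := autTP g; exact: K. Qed.

HB.instance Definition _ := isGroup.Build autT
  autT_mulA autT_mul1g autT_mulg1 autT_mulVg autT_mulgV.

Lemma wact1 w : wact 1 w = w. Proof. by []. Qed.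
Lemma wactM g h w : wact (g * h) w = wact h (wact g w). Proof. by []. Qed.

(* Right action on the boundary: the n-th letter of x.g is the last letter *)
(* of the image of the prefix of length n+1 of x. *)
Definition bact (x : ray) (g : autT) : ray :=
  fun n => nth false (wact g (mkseq x n.+1)) n.

Lemma mkseq_bact x g n : mkseq (bact x g) n = wact g (mkseq x n).
Proof.
have [_ _ tg] := autTP g; have [g0 gr] := tg.
elim: n => [|n IHn]; first by rewrite /mkseq /= g0.
rewrite mkseqS IHn /bact mkseqS.
have [s ->] := gr (mkseq x n) (x n).
by rewrite nth_rcons (tree_morphism_size _ tg) size_mkseq ltnn eqxx.
Qed.

Lemma bact1 x : bact x 1 = x.
Proof. by apply/funext => n; rewrite /bact wact1 nth_mkseq. Qed.

Lemma bactM x g h : bact x (g * h) = bact (bact x g) h.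
Proof. by apply/funext => n; rewrite /bact wactM -mkseq_bact. Qed.

(* (g0, g1) tau, that is (t y).g = tau(t) (y.g_t); the letters 0 and 1 are *)
(* [false] and [true]. *)
Section Node.
Variables (g0 g1 : autT) (tau : {perm bool}).

Definition node_fun (w : word) : word :=
  if w is t :: y then tau t :: wact (if t then g1 else g0) y else [::].

Definition node_inv (w : word) : word :=
  if w is t :: y then
    let s := (tau^-1)%g t in s :: wact_inv (if s then g1 else g0) y
  else [::].

Fact node_subproof : `[< is_autT (node_fun, node_inv) >].
Proof.
have [K00 K01 t0] := autTP g0; have [K10 K11 t1] := autTP g1.
apply/asboolP; split=> [[|t y]|[|t y]|] //=.
- by rewrite permK; case: t; rewrite ?K00 ?K10.
- by rewrite permKV; case: (tau^-1 t); rewrite ?K01 ?K11.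
split=> // -[|t y] s /=.
  by exists (tau s); case: s; [case: t1 | case: t0] => -> _.
by case: t; [have [_ /(_ y s)[s' ->]] := t1 | have [_ /(_ y s)[s' ->]] := t0];
  exists s'.
Qed.

Definition node : autT := AutT node_subproof.

End Node.

(* [spine u] is the automorphism g_0 defined by the recursion *)
(* g_n = (u_n, g_{n+1}), see [spineE]. *)
Fixpoint spine_fun (u : nat -> autT) (w : word) : word :=
  match w with
  | [::] => [::]
  | false :: y => false :: wact (u 0%N) y
  | true :: y => true :: spine_fun (fun n => u n.+1) y
  end.

Lemma spine_funK (u v : nat -> autT) :
  (forall n, cancel (wact (u n)) (wact (v n))) ->
  cancel (spine_fun u) (spine_fun v).
Proof.
move=> uK w; elim: w u v uK => [|[] y IHy] u v uK //=; last by rewrite uK.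
by rewrite IHy.
Qed.

Fact spine_subproof (u : nat -> autT) :
  `[< is_autT (spine_fun u, spine_fun (fun n => (u n)^-1)) >].
Proof.
apply/asboolP; split=> /=.
- by apply: spine_funK => n; have [K _ _] := autTP (u n); exact: K.
- by apply: spine_funK => n; have [_ K _] := autTP (u n); exact: K.
split=> // w t; elim: w u => [|[] y IHy] u /=.
- by case: t; [exists true | exists false; case: (autTP (u 0%N)) => _ _ [-> _]].
- by have [s ->] := IHy (fun n => u n.+1); exists s.
- by have [_ _ [_ /(_ y t)[s ->]]] := autTP (u 0%N); exists s.
Qed.

Definition spine (u : nat -> autT) : autT := AutT (spine_subproof u).

Lemma spineE (u : nat -> autT) :
  spine u = node (u 0%N) (spine (fun n => u n.+1)) 1.
Proof. by apply: autT_ext => -[|[] y] //=; rewrite /wact /= perm1. Qed.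

Definition shift_letters (omega : nat -> 'I_3) : nat -> 'I_3 := fun n => omega n.+1.

Definition gen_a : autT := node 1 1 (tperm false true).

Definition ub (i : 'I_3) : autT := if i == 2 :> nat then 1 else gen_a.
Definition uc (i : 'I_3) : autT := if i == 1%N :> nat then 1 else gen_a.
Definition ud (i : 'I_3) : autT := if i == 0%N :> nat then 1 else gen_a.

Definition gen_b (omega : nat -> 'I_3) : autT := spine (fun n => ub (omega n)).
Definition gen_c (omega : nat -> 'I_3) : autT := spine (fun n => uc (omega n)).
Definition gen_d (omega : nat -> 'I_3) : autT := spine (fun n => ud (omega n)).

Lemma gen_bE omega : gen_b omega = node (ub (omega 0%N)) (gen_b (shift_letters omega)) 1.
Proof. exact: spineE. Qed.
Lemma gen_cE omega : gen_c omega = node (uc (omega 0%N)) (gen_c (shift_letters omega)) 1.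
Proof. exact: spineE. Qed.
Lemma gen_dE omega : gen_d omega = node (ud (omega 0%N)) (gen_d (shift_letters omega)) 1.
Proof. exact: spineE. Qed.

Definition Ggens (omega : nat -> 'I_3) : set autT :=
  [set gen_a; gen_b omega; gen_c omega; gen_d omega].

Definition Ggroup (omega : nat -> 'I_3) : groupType := gen_group (Ggens omega).

Definition rho : ray := fun=> true.

Definition orbit_rho (omega : nat -> 'I_3) : set ray :=
  [set bact rho (gval g) | g in [set: Ggroup omega]].

Definition Xtype (omega : nat -> 'I_3) : choiceType := set_type (orbit_rho omega).

Section OrbitAction.
Variable omega : nat -> 'I_3.

Fact Xact_subproof (x : Xtype omega) (g : Ggroup omega) :
  bact (\val x) (gval g) \in orbit_rho omega.
Proof.
case: x => x /= /set_mem[h _ <-]; apply/mem_set.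
by exists (h * g) => //; rewrite -bactM.
Qed.

Definition Xact_fun (x : Xtype omega) (g : Ggroup omega) : Xtype omega :=
  exist (fun y : ray => y \in orbit_rho omega) _ (Xact_subproof x g).

Fact Xact1 x : Xact_fun x 1 = x.
Proof. by apply: val_inj; exact: bact1. Qed.

Fact XactM x g h : Xact_fun x (g * h) = Xact_fun (Xact_fun x g) h.
Proof. by apply: val_inj; exact: bactM. Qed.

Definition Xact : raction (Xtype omega) (Ggroup omega) := RAction Xact1 XactM.

End OrbitAction.

Definition Gamma (F : finGroupType) (omega : nat -> 'I_3) : groupType :=
  wreath F (Xact omega).

Fact rho_orbit omega : rho \in orbit_rho omega.
Proof. by apply/mem_set; exists 1 => //; exact: bact1. Qed.

Lemma Gamma_finitely_generated (F : finGroupType) (omega : nat -> 'I_3) :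
  exists S : {fset Gamma F omega}, generates S.
Proof.
pose X := Xtype omega; pose G := Ggroup omega.
pose x0 : X := exist (fun y : ray => y \in orbit_rho omega) _ (rho_orbit omega).
pose iota (g : G) : Gamma F omega := (lamp_one X F, g).
pose lam (phi : lamps X F) : Gamma F omega := (phi, 1).
pose A : set (Gamma F omega) :=
  (iota @` [set g | Ggens omega (gval g)]) `|`
  ((fun f => lam (lamp_delta x0 f)) @` [set: F]).
have finA : finite_set A.
  rewrite finite_setU; split; apply: finite_image; last exact: finite_finset.
  apply: (@finite_preimage _ _ (Ggens omega) (@gval _ _)).
    by move=> x y _ _; exact: gval_inj.
  by rewrite /Ggens !finite_setU.
exists (fset_set A); rewrite /generates fset_setK //.
apply/seteqP; split=> // u _ H [sgH AH]; have [H1 HM HV] := sgH.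
have iotaM g h : iota (g * h) = iota g * iota h.
  congr pair; apply: lamps_ext => x; exact/esym/mulg1.
have iotaV g : iota g^-1 = (iota g)^-1.
  congr pair; apply: lamps_ext => x; exact/esym/invg1.
have Hiota (g : G) : H (iota g).
  suff: generated (Ggens omega) `<=`
      [set t | exists2 g : G, gval g = t & H (iota g)].
    by move=> /(_ _ (gvalP g)) [h /gval_inj -> ].
  apply: generated_min.
    split=> [|x y [g1 <- Hg1] [g2 <- Hg2]|x [g1 <- Hg1]].
    - by exists 1.
    - by exists (g1 * g2) => //; rewrite iotaM; exact: HM.
    - by exists g1^-1 => //; rewrite iotaV; exact: HV.
  move=> t tS; pose h : G := exist (fun y => y \in generated (Ggens omega)) t
    (mem_set (generated_sub tS)).
  by exists h => //; apply: (AH); left; exists h.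
have Hdelta x f : H (lam (lamp_delta x f)).
  have [g gx] : exists g : G, Xact omega x0 g = x.
    case: (x) => y yX; have [g _ gy] := set_mem yX.
    by exists g; apply: val_inj.
  have -> : lam (lamp_delta x f) =
      iota g^-1 * (lam (lamp_delta x0 f) * iota g) :> Gamma F omega.
    have e : (1 : G) = g^-1 * (1 * g) by rewrite mul1g mulVg.
    rewrite /lam {1}e; congr pair; apply: lamps_ext => y.
    rewrite [RHS]mul1g [RHS]mulg1.
    change ((if y == x then f else 1) =
            (if Xact omega y g^-1 == x0 then f else 1)).
    congr (if _ then _ else _); rewrite -gx; apply/eqP/eqP => [->|<-].
      by rewrite -ractM mulgV ract1.
    by rewrite -ractM mulVg ract1.
  apply: (HM); first exact: Hiota.
  by apply: (HM); [apply: (AH); right; exists f | exact: Hiota].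
have lamM p q : lam (lamp_mul p q) = lam p * lam q.
  have e : (1 : G) = 1 * 1 by rewrite mul1g.
  rewrite /lam {1}e; congr pair; apply: lamps_ext => y.
  by rewrite [RHS]/= Xact1.
have Hlam phi : H (lam phi).
  have [s sP] : exists s : seq X, forall x, phi x != 1 -> x \in s.
    have /finite_seqP[s sE] := lampP phi; exists s => x px.
    by have : [set x | phi x != 1] x by []; rewrite sE.
  elim: s phi sP => [|x s IHs] phi sP.
    suff -> : lam phi = 1 by [].
    congr pair; apply: lamps_ext => x /=; apply/eqP/negPn/negP => /sP.
    by rewrite in_nil.
  have -> : phi = lamp_mul (lamp_delta x (phi x))
                   (lamp_mul (lamp_delta x (phi x)^-1) phi).
    apply: lamps_ext => y /=; case: eqP => [->|_]; last by rewrite !mul1g.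
    by rewrite mulVg mulg1.
  rewrite lamM; apply: (HM); first exact: Hdelta.
  apply: IHs => y /=; have [->|yx] := eqVneq y x; first by rewrite mulVg eqxx.
  by rewrite mul1g => /sP; rewrite in_cons (negPf yx).
case: u => phi g; have -> : (phi, g) = lam phi * iota g :> Gamma F omega.
  rewrite wreathM /= mul1g; congr pair.
  by apply: lamps_ext => x /=; rewrite mulg1.
by apply: (HM).
Qed.

Local Open Scope ring_scope.

Section Exponents.
Variables (R : realType) (G : groupType) (S : {fset G}).

(* Real-valued, hence harmless junk for the finitely many r where one of the *)
(* logarithms or the quotient is not defined. *)
Definition loglog_ratio (r : nat) : \bar R :=
  (ln (ln (growth S r)%:R) / ln r%:R)%:E.

Definition lower_exponent : \bar R := limn_einf loglog_ratio.
Definition upper_exponent : \bar R := limn_esup loglog_ratio.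

End Exponents.

Lemma eta_exists_unique (R : realType) :
  exists! eta : R, root ('X^3 + 'X^2 + 'X - 2%:P) eta.
Proof.
pose p : {poly R} := 'X^3 + 'X^2 + 'X - 2%:P.
have E (x : R) : p.[x] = (x * x * x + x * x + x - 2).
  by rewrite /p !hornerE /= !exprS expr0 mulr1; lra.
have [||eta _ eta0] := @poly_ivt R p 0 1 _ _.
- by rewrite ler01.
- by rewrite !E !mulr0 !mulr1; apply/andP; split; lra.
exists eta; split=> // y /rootP y0; move/rootP: eta0; rewrite E => eta0.
move: y0; rewrite E => y0.
have /eqP : ((eta - y) * (eta * eta + eta * y + y * y + eta + y + 1) = 0).
  rewrite [LHS](_ : _ = (eta * eta * eta + eta * eta + eta - 2) -
    (y * y * y + y * y + y - 2)); last by ring.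
  by rewrite eta0 y0 subr0.
rewrite mulf_eq0 subr_eq0 => /orP[/eqP //|/eqP e]; exfalso.
have := sqr_ge0 (eta + y + 1); have := sqr_ge0 eta; have := sqr_ge0 y.
have := sqr_ge0 (eta + y); rewrite !expr2; nra.
Qed.

(* Main.v *)
(* The sequence omega is a concatenation of blocks, the [b]-th one consisting of [3 b] levels and
   being either fast (012012...) or slow (0..01..12..2).  If [n] of the first [k] levels are fast,
   the scale length is [2 ^ k / eta ^ n], and the claim is that the logarithm of the growth function
   at this radius is [2 ^ k], up to factors [exp (o k)].

   Upper bound: there is a norm on words whose total over the two sections is at most [eta] times
   the norm of the word on fast levels and at most that norm on slow levels, with a bounded loss at
   the [o k] places where the pattern changes.  Iterating [k] times encodes an element of the ball
   by about [2 ^ k] symbols.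

   Lower bound: since [F] may be trivial, it is elements of [G_omega] that are counted.  A
   substitution lifts words one level up and multiplies lengths by [2 / eta] on fast and [2] on slow
   levels.  It provides elements (movers) that flip the [j]-th letter of a ray and have trivial germ
   away from one of many possible points.  A product of lamps (powers of one letter with nontrivial
   germ at [rho]) and of random movers usually has at [rho] the germ of its first lamp; a suitable
   schedule of movers keeps the number of undecodable lamps small, so that the number of products is
   exponential in the number [2 ^ (k - o k)] of lamps.

   Thus [log log b r / log r] is governed by the density of fast levels, and a greedy choice of
   modes, with a target density alternating in doubly exponential phases, makes it oscillate exactly
   between [alpha] and [beta]. *)
Require Import Defs.
From HB Require Import structures.
From mathcomp Require Import all_boot all_order all_algebra all_fingroup.
From mathcomp Require Import finmap.
From mathcomp Require Import all_classical all_reals all_analysis.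
From mathcomp Require Import ring lra zify.

Import Order.TTheory GRing.Theory Num.Theory.

Set Implicit Arguments.
Unset Strict Implicit.
Unset Printing Implicit Defensive.

(** * Words in the generators and the substitution zeta *)

(** Both bounds meet because one Perron vector, [(eta^2, eta, 1)], governs them: the equation of
    [eta] makes it an eigenvector of the substitution for [2 / eta], and in the contracting norm a
    letter together with an [a] weighs exactly as much. If a proportion [p] of the levels is fast,
    [ln (scale_length k)] is about [k (ln 2 - p ln eta)], so the exponent is
    [ln 2 / (ln 2 - p ln eta)], running from [alpha_0] at [p = 1] to [1] at [p = 0].

    The obstacle in the lower bound is that movers have nontrivial germs of their own. A mover draws
    its singular path at random among many, but words for paths of length [W] may be longer by a
    factor [4 ^ W]; so [W] has to be a small fraction of [k], and the resulting probability of a hit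
    is too large for the steps that are repeated most often. Those rely instead on equidistribution:
    by then the ray is spread over many more letters than the level of the mover.

    Blocks of [3 b] levels contain each label [b] times in either mode. Hence every label is
    frequent in every long window, as the paths require, while only about [sqrt k] pattern changes
    occur before level [k]. *)

Section Words.
Local Open Scope group_scope.

(* The Klein four-group [{1, b, c, d}], with [b = (1,1)], [c = (1,0)] and [d = (0,1)];
   [chi i k] tells whether the letter [k] acts as [a] under a vertex whose label is [i]. *)
Definition klein := (bool * bool)%type.

Definition chi (i : 'I_3) (k : klein) : bool :=
  match val i with 0%N => k.1 | 1%N => k.2 | _ => k.1 (+) k.2 end.

Definition klein_add (k l : klein) : klein := (k.1 (+) l.1, k.2 (+) l.2).

Definition k0 : klein := (false, false).

Lemma chiD i k l : chi i (klein_add k l) = chi i k (+) chi i l.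
Proof. by case: i k l => [[|[|[|]]] ?] [[] []] [[] []]. Qed.

Lemma chi0 i : chi i k0 = false.
Proof. by case: i => [[|[|[|]]] ?]. Qed.

Definition killed (i : 'I_3) : klein :=
  match val i with 0%N => (false, true) | 1%N => (true, false) | _ => (true, true) end.

Definition inext (i : 'I_3) : 'I_3 := Ordinal (ltn_pmod (val i).+1 (isT : 0 < 3)%N).

Lemma chi_killed i j : chi i (killed j) = (i != j).
Proof. by case: i => [[|[|[|]]] ?] //; case: j => [[|[|[|]]] ?]. Qed.

Definition aexp (c : bool) : autT := if c then gen_a else 1.

Definition Bg (omega : nat -> 'I_3) (k : klein) : autT :=
  spine (fun n => aexp (chi (omega n) k)).

Lemma wact_node g0 g1 s t y :
  wact (node g0 g1 s) (t :: y) = s t :: wact (if t then g1 else g0) y.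
Proof. by []. Qed.

Lemma wact_nil g : wact g [::] = [::].
Proof. by case: (autTP g) => _ _ []. Qed.

Lemma nodeM g0 g1 s h0 h1 t :
  node g0 g1 s * node h0 h1 t =
  node (g0 * (if s false then h1 else h0)) (g1 * (if s true then h1 else h0)) (s * t)%g.
Proof.
by apply: autT_ext => -[|t' y] //; rewrite wactM !wact_node permM; case: t'; case: ifP => //.
Qed.

Lemma node1 : node 1 1 1 = 1.
Proof. by apply: autT_ext => -[|t y] //; rewrite wact_node perm1; case: t. Qed.

Lemma mulaa : gen_a * gen_a = 1.
Proof. by rewrite /gen_a nodeM !tpermL !tpermR !mulg1 tperm2 node1. Qed.

Lemma aexpM c c' : aexp c * aexp c' = aexp (c (+) c').
Proof. by case: c c' => [] []; rewrite /aexp /= ?mulaa ?mulg1 ?mul1g. Qed.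

Lemma aexp2 c : aexp c * aexp c = 1.
Proof. by rewrite aexpM addbb. Qed.

Lemma spineM u v : spine u * spine v = spine (fun n => u n * v n).
Proof.
apply: autT_ext => w; rewrite wactM /wact /=.
by elim: w u v => [|[] y IHy] u v //=; rewrite IHy.
Qed.

Lemma BgE omega k :
  Bg omega k = node (aexp (chi (omega 0%N) k)) (Bg (shift_letters omega) k) 1.
Proof. exact: spineE. Qed.

Lemma BgM omega k l : Bg omega k * Bg omega l = Bg omega (klein_add k l).
Proof. by rewrite /Bg spineM; congr spine; apply/funext => n; rewrite aexpM chiD. Qed.

Lemma klein_addkk k : klein_add k k = k0.
Proof. by case: k => [[] []]. Qed.

Lemma Bg0 omega : Bg omega k0 = 1.
Proof.
apply: (@mulgI _ (Bg omega k0)); rewrite BgM mulg1; congr Bg.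
Qed.

Lemma Bg2 omega k : Bg omega k * Bg omega k = 1.
Proof. by rewrite BgM klein_addkk Bg0. Qed.

Lemma inv_involution (G : groupType) (x : G) : x * x = 1 -> x^-1 = x.
Proof. by move=> xx; apply: (@mulgI _ x); rewrite mulgV xx. Qed.

Lemma gen_bg omega : gen_b omega = Bg omega (true, true).
Proof.
rewrite /gen_b /Bg; congr spine; apply/funext => n; rewrite /ub /chi.
by case: (omega n) => [[|[|[|]]] ?].
Qed.
Lemma gen_cg omega : gen_c omega = Bg omega (true, false).
Proof.
rewrite /gen_c /Bg; congr spine; apply/funext => n; rewrite /uc /chi.
by case: (omega n) => [[|[|[|]]] ?].
Qed.
Lemma gen_dg omega : gen_d omega = Bg omega (false, true).
Proof.
rewrite /gen_d /Bg; congr spine; apply/funext => n; rewrite /ud /chi.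
by case: (omega n) => [[|[|[|]]] ?].
Qed.

Definition ev omega (w : seq (option klein)) : autT :=
  \prod_(x <- w) (if x is Some k then Bg omega k else gen_a).

Lemma ev_nil omega : ev omega [::] = 1. Proof. by rewrite /ev big_nil. Qed.
Lemma ev_cons omega x w :
  ev omega (x :: w) = (if x is Some k then Bg omega k else gen_a) * ev omega w.
Proof. by rewrite /ev big_cons. Qed.
Lemma ev_cat omega w w' : ev omega (w ++ w') = ev omega w * ev omega w'.
Proof. by rewrite /ev big_cat. Qed.
Lemma ev_rev omega w : ev omega (rev w) = (ev omega w)^-1.
Proof.
elim: w => [|x w IHw]; first by rewrite ev_nil invg1.
rewrite rev_cons -cats1 ev_cat IHw !ev_cons ev_nil mulg1 invgM; congr (_ * _).
by apply/esym/inv_involution; case: x => [k|]; rewrite ?Bg2 ?mulaa.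
Qed.

(* [evk omega [:: k1; ...; kn] = a k1 a k2 ... a kn]. *)
Definition evk omega (w : seq klein) : autT := \prod_(k <- w) (gen_a * Bg omega k).

Lemma evk_nil omega : evk omega [::] = 1. Proof. by rewrite /evk big_nil. Qed.
Lemma evk_cons omega k w : evk omega (k :: w) = gen_a * Bg omega k * evk omega w.
Proof. by rewrite /evk big_cons. Qed.
Lemma evk_cat omega w w' : evk omega (w ++ w') = evk omega w * evk omega w'.
Proof. by rewrite /evk big_cat. Qed.

Definition killcount i (w : seq klein) : bool := odd (count (fun k => ~~ chi i k) w).

(** A letter stands for the syllable [a k], and its image has to show [a k] in both sections, up to
    conjugation by [a]. A letter surviving at [i] is doubled. A killed one needs all three letters:
    on one side the outer two multiply to it, on the other their two [a] surround it. *)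
Definition zeta1 (i : 'I_3) (k : klein) : seq klein :=
  if k == k0 then [:: k0] else if chi i k then [:: k; k]
  else [:: killed (inext i); killed i; killed (inext (inext i))].

Definition zeta i (w : seq klein) : seq klein := flatten [seq zeta1 i k | k <- w].

Lemma zeta_cons i k w : zeta i (k :: w) = zeta1 i k ++ zeta i w.
Proof. by []. Qed.

(** Doubled letters do not affect the parity, and a three-letter image contains exactly one letter
    killed at [j], whatever [j] is. The parity deciding between [dbl] and [dblf] thus passes through
    all further substitutions, so [evk_zetas] only has to test the innermost label. *)
Lemma killcount_zeta i j w : killcount j (zeta i w) = killcount i w.
Proof.
rewrite /killcount; elim: w => [//|k w IHw].
rewrite zeta_cons count_cat /= !oddD IHw; congr (_ (+) _).
rewrite /zeta1; case: (k =P k0) => [-> /=|kN]; first by rewrite !chi0.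
case: ifP => [ck|ck] /=; first by case: (chi j k).
rewrite !chi_killed; by case: i {ck IHw} => [[|[|[|]]] ?] //; case: j => [[|[|[|]]] ?].
Qed.

(** * Elements whose two sections agree up to conjugation by [a] *)

Definition flip : {perm bool} := tperm false true.

Lemma flipT : flip true = false. Proof. exact: tpermR. Qed.
Lemma flipF : flip false = true. Proof. exact: tpermL. Qed.
Lemma flipE t : flip t = ~~ t. Proof. by case: t; rewrite ?flipT ?flipF. Qed.
Lemma flip2 : (flip * flip = 1)%g. Proof. exact: tperm2. Qed.

(* The conjugate of [(g, g)] by [(a, 1)]: up to conjugation by [a], both sections are [g]. *)
Definition dbl (g : autT) : autT := node (gen_a * g * gen_a) g 1.

Definition dblf (g : autT) : autT := node (gen_a * g) (g * gen_a) flip.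

Lemma dbl1 : dbl 1 = 1.
Proof. by rewrite /dbl mulg1 mulaa node1. Qed.

Lemma mulKaa (x : autT) : gen_a * (gen_a * x) = x.
Proof. by rewrite mulgA mulaa mul1g. Qed.

Lemma mulaaK (x : autT) : x * gen_a * gen_a = x.
Proof. by rewrite -mulgA mulaa mulg1. Qed.

Lemma dblMdbl g h : dbl g * dbl h = dbl (g * h).
Proof. by rewrite /dbl nodeM !perm1 mulg1 !mulgA mulaaK. Qed.
Lemma dblMdblf g h : dbl g * dblf h = dblf (g * h).
Proof. by rewrite /dbl /dblf nodeM !perm1 mul1g !mulgA mulaaK. Qed.
Lemma dblfMdbl g h : dblf g * dbl h = dblf (g * h).
Proof. by rewrite /dbl /dblf nodeM flipT flipF mulg1 !mulgA mulaaK. Qed.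
Lemma dblfMdblf g h : dblf g * dblf h = dbl (g * h).
Proof. by rewrite /dbl /dblf nodeM flipT flipF flip2 !mulgA mulaaK. Qed.

Lemma evk1 omega k : evk omega [:: k] = gen_a * Bg omega k.
Proof. by rewrite /evk big_seq1. Qed.

Lemma kill_add i : klein_add (killed (inext i)) (killed (inext (inext i))) = killed i.
Proof.
by case: i => [[|[|[|]]] ?].
Qed.

Lemma chi_false i k : k != k0 -> chi i k = false -> k = killed i.
Proof. by case: i k => [[|[|[|]]] ?] [[] []]. Qed.

Lemma inext_neq i : (i == inext i) = false.
Proof. by case: i => [[|[|[|]]] ?]. Qed.
Lemma inext2_neq i : (i == inext (inext i)) = false.
Proof. by case: i => [[|[|[|]]] ?]. Qed.

Lemma gen_a_node g0 g1 : gen_a * node g0 g1 1 = node g1 g0 flip.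
Proof. by rewrite /gen_a nodeM flipT flipF !mul1g mulg1. Qed.

Lemma node_flipM g0 g1 h0 h1 s :
  node g0 g1 flip * node h0 h1 s = node (g0 * h1) (g1 * h0) (flip * s)%g.
Proof. by rewrite nodeM flipT flipF. Qed.

Lemma node_flip_gen_a g0 g1 : node g0 g1 flip * gen_a = node g0 g1 1.
Proof. by rewrite /gen_a node_flipM !mulg1 flip2. Qed.

Lemma node_idM g0 g1 h0 h1 s :
  node g0 g1 1 * node h0 h1 s = node (g0 * h0) (g1 * h1) s.
Proof. by rewrite nodeM !perm1 mul1g. Qed.

Lemma evk_zeta1 omega k :
  evk omega (zeta1 (omega 0%N) k) =
  (if chi (omega 0%N) k then dbl else dblf) (gen_a * Bg (shift_letters omega) k).
Proof.
rewrite /zeta1; case: eqVneq => [->|kN].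
  by rewrite chi0 evk1 !Bg0 mulg1 /dblf mulaa.
case: ifP => ck.
  rewrite !evk_cons evk_nil mulg1 BgE ck /= gen_a_node node_flipM flip2.
  by rewrite /dbl !mulgA mulaa mul1g.
rewrite (chi_false kN ck) !evk_cons evk_nil mulg1 !(BgE omega) !chi_killed eqxx.
rewrite inext_neq inext2_neq /= !gen_a_node !node_flipM flip2 mulg1.
by rewrite mul1g BgM kill_add /dblf !mulgA mulaa mul1g.
Qed.

Lemma evk_zeta omega w :
  evk omega (zeta (omega 0%N) w) =
  (if killcount (omega 0%N) w then dblf else dbl) (evk (shift_letters omega) w).
Proof.
elim: w => [|k w IHw]; first by rewrite /killcount /= !evk_nil dbl1.
rewrite zeta_cons evk_cat IHw evk_zeta1 evk_cons /killcount /= oddD.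
by case: chi => /=; case: (odd _); rewrite ?dblMdbl ?dblMdblf ?dblfMdbl ?dblfMdblf.
Qed.

End Words.

(** * Automorphisms with a displaced spine *)

Section SpineWords.
Local Open Scope group_scope.

(** The coordinate of a lifted word on the side away from the spine, at a vertex labelled [i], when
    the substitute for [a] acts there as [s]. *)
Definition offspine (s : autT) (i : 'I_3) (w : seq (option klein)) : autT :=
  \prod_(x <- w) (if x is Some k then aexp (chi i k) else s).

Lemma offspine_cons s i x w : offspine s i (x :: w) =
  (if x is Some k then aexp (chi i k) else s) * offspine s i w.
Proof. by rewrite /offspine big_cons. Qed.

(** When [t] survives, [a t a] acts as [a] on the spine side of the tree; the price is a copy of [t]
    on the other side. *)
Definition lift1 (t : klein) (x : option klein) : seq (option klein) :=
  if x is Some k then [:: Some k] else [:: None; Some t; None].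

Definition lift t (w : seq (option klein)) := flatten [seq lift1 t x | x <- w].

Lemma size_lift t w : (size (lift t w) <= 3 * size w)%N.
Proof.
elim: w => //= x w IHw; rewrite size_cat mulnS leq_add //.
by case: x.
Qed.

Lemma ev_lift omega t w : chi (omega 0%N) t ->
  ev omega (lift t w) =
  node (offspine (Bg (shift_letters omega) t) (omega 0%N) w) (ev (shift_letters omega) w) 1.
Proof.
move=> ct; elim: w => [|x w IHw]; first by rewrite !ev_nil /offspine big_nil node1.
rewrite [lift t _]/(lift1 t x ++ lift t w) ev_cat IHw offspine_cons ev_cons.
case: x => [k|] /=; rewrite !ev_cons ev_nil mulg1 (BgE omega); first by rewrite node_idM.
by rewrite ct mulgA gen_a_node node_flip_gen_a node_idM.
Qed.

Lemma offspine_lift s i t w : offspine s i (lift t w) =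
  offspine (s * aexp (chi i t) * s) i w.
Proof.
elim: w => [|x w IHw]; first by rewrite /offspine !big_nil.
rewrite [lift t _]/(lift1 t x ++ lift t w) /offspine big_cat -!/(offspine _ _ _) IHw.
rewrite offspine_cons; congr (_ * _).
by case: x => [k|]; rewrite /= !offspine_cons /offspine big_nil mulg1 ?mulgA.
Qed.

(* Whatever involution replaces [a], the off-spine coordinate of [w] under label [i]
   is a power of [a], hence commutes with [a]. *)
Definition tame i (w : seq (option klein)) : Prop :=
  forall s : autT, s * s = 1 -> exists c, offspine s i w = aexp c.

Lemma offspine1 i w : exists c, offspine 1 i w = aexp c.
Proof.
elim: w => [|x w [c IHw]]; first by exists false; rewrite /offspine big_nil.
rewrite offspine_cons IHw; case: x => [k|]; last by exists c; rewrite mul1g.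
by exists (chi i k (+) c); rewrite aexpM.
Qed.

Lemma tame_lift_killed i t w : chi i t = false -> tame i (lift t w).
Proof.
move=> ct s ss; rewrite offspine_lift ct /= mulg1 ss; exact: offspine1.
Qed.

(** The conjugate [s * aexp c * s] is again an involution; this stability is why [tame] quantifies
    over all involutions. *)
Lemma tame_lift i t w : tame i w -> tame i (lift t w).
Proof.
move=> tw s ss; rewrite offspine_lift; apply: tw.
by rewrite !mulgA -(mulgA (s * _) s s) ss mulg1 -(mulgA s) aexp2 mulg1.
Qed.

(* The automorphism obtained from [Bg omega k] by moving its spine from [111...] to [v111...]. *)
Fixpoint spl (omega : nat -> 'I_3) (k : klein) (v : seq bool) : autT :=
  match v with
  | [::] => Bg omega k
  | true :: v' => node (aexp (chi (omega 0%N) k)) (spl (shift_letters omega) k v') 1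
  | false :: v' => node (spl (shift_letters omega) k v') (aexp (chi (omega 0%N) k)) 1
  end.

(** Here [i] labels the level just above the first letter of [v]. Turning the spine to the left is
    done by conjugating with [a], which spoils tameness one level up; this is harmless when [k] is
    killed there, since the conjugated off-spine coordinate is then trivial. *)
Fixpoint splice_ok (i : 'I_3) (omega : nat -> 'I_3) (k : klein) (v : seq bool) : bool :=
  match v with
  | [::] => true
  | t :: v' => (t || ~~ chi i k) && splice_ok (omega 0%N) (shift_letters omega) k v'
  end.

Lemma nodeV g0 g1 : (node g0 g1 1)^-1 = node g0^-1 g1^-1 1.
Proof.
by apply: (@mulgI _ (node g0 g1 1)); rewrite mulgV node_idM !mulgV node1.
Qed.

Lemma aexp_conj c c' : (aexp c)^-1 * aexp c' * aexp c = aexp c'.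
Proof. by rewrite inv_involution ?aexp2 // !aexpM addbC addbA addbb. Qed.

(** The conjugator [f] is built from the end of [v] upwards, by lifting and by appending an [a] at
    each left turn. Off the spine [k] is conjugated by a coordinate of [f]: either [k] is trivial
    there, or tameness makes that coordinate a power of [a], which commutes with [a]. *)
Lemma spl_word i omega k v : splice_ok i omega k v ->
  exists2 f : seq (option klein), (size f < 4 ^ size v)%N &
    ev omega (rev f ++ Some k :: f) = spl omega k v /\ (chi i k -> tame i f).
Proof.
elim: v i omega => [|t v IHv] i omega /=.
  move=> _; exists [::] => //; split; first by rewrite /= ev_cons ev_nil mulg1.
  by move=> _ s _; exists false; rewrite /offspine big_nil.
case/andP=> tP /IHv[f fs [fE ftame]].
(* The letter [l] must survive at [omega 0] for [ev_lift]. If [i] is another label, [l] can also be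
   killed at [i], which yields tameness for free; if [i] is the same label, tameness is inherited
   from the inner word. *)
pose l := if i == omega 0%N then killed (inext i) else killed i.
have cl : chi (omega 0%N) l.
  rewrite /l; case: eqVneq => [<-|ne]; rewrite chi_killed ?inext_neq //.
  by rewrite eq_sym.
have F1 : ev omega (rev (lift l f) ++ Some k :: lift l f) =
    node (aexp (chi (omega 0%N) k)) (spl (shift_letters omega) k v) 1.
  rewrite -fE ev_cat ev_rev ev_cons !ev_cat ev_rev ev_cons ev_lift // nodeV (BgE omega).
  rewrite !node_idM; congr node; case ck: (chi (omega 0%N) k); last first.
    by rewrite mul1g mulVg.
  have [|c ->] := ftame ck (Bg (shift_letters omega) l); first exact: Bg2.
  by rewrite mulgA aexp_conj.
have S1 : (size (lift l f) + 1 < 4 ^ (size v).+1)%N.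
  by have := size_lift l f; rewrite expnS; lia.
case: t tP => /= [_|ck].
  exists (lift l f); first by lia.
  split=> // cik; rewrite /l; case: eqVneq => [e|ne]; last first.
    by apply: tame_lift_killed; rewrite chi_killed eqxx.
  by apply: tame_lift; rewrite e; apply: ftame; rewrite -e.
exists (rcons (lift l f) None); first by rewrite size_rcons; lia.
split=> [|cik]; last by rewrite cik in ck.
have -> : rev (rcons (lift l f) None) ++ Some k :: rcons (lift l f) None =
    None :: (rev (lift l f) ++ Some k :: lift l f) ++ [:: None].
  by rewrite rev_rcons -cats1 /= -catA.
by rewrite ev_cons ev_cat F1 ev_cons ev_nil mulg1 mulgA gen_a_node node_flip_gen_a.
Qed.

End SpineWords.

(** * Germs and movers *)

Section Movers.
Local Open Scope group_scope.

Definition shiftn (omega : nat -> 'I_3) (j : nat) : nat -> 'I_3 := fun n => omega (j + n)%N.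

Lemma shiftnS omega j : shiftn (shift_letters omega) j = shiftn omega j.+1.
Proof. by apply/funext => n. Qed.
Lemma shift_shiftn omega j : shift_letters (shiftn omega j) = shiftn omega j.+1.
Proof. by apply/funext => n; rewrite /shift_letters /shiftn addnS. Qed.

Fixpoint zetas (omega : nat -> 'I_3) (j : nat) (u : seq klein) : seq klein :=
  if j is j'.+1 then zeta (omega 0%N) (zetas (shift_letters omega) j' u) else u.

Lemma evk_zetas omega j u :
  (forall j', j = j'.+1 -> killcount (omega j') u = false) ->
  evk omega (zetas omega j u) = iter j dbl (evk (shiftn omega j) u).
Proof.
elim: j omega => [//|j IHj] omega kj /=.
have Hk : killcount (omega 0%N) (zetas (shift_letters omega) j u) = false.
  have := kj j erefl; case: j {IHj kj} => [//|j] kj /=.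
  rewrite /= killcount_zeta -kj; elim: j omega {kj} => [//|j IHj] omega /=.
  by rewrite killcount_zeta (IHj (shift_letters omega)).
rewrite evk_zeta Hk IHj ?shiftnS // => j' jj'; apply: (kj j'.+1).
by rewrite jj'.
Qed.

Definition tokens (w : seq (option klein)) : seq klein :=
  flatten [seq (if x is Some k then [:: k0; k] else [:: k0]) | x <- w].

Lemma size_tokens w : (size (tokens w) <= 2 * size w)%N.
Proof. by elim: w => //= x w IHw; rewrite size_cat mulnS leq_add //; case: x. Qed.

Lemma tokens_cat w w' : tokens (w ++ w') = tokens w ++ tokens w'.
Proof. by rewrite /tokens map_cat flatten_cat. Qed.

Lemma evk_tokens omega w : evk omega (tokens w) = ev omega w.
Proof.
elim: w => [|x w IHw]; first by rewrite ev_nil evk_nil.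
rewrite [tokens _](_ : _ = tokens [:: x] ++ tokens w); last by rewrite -tokens_cat.
rewrite evk_cat IHw ev_cons; congr (_ * _); rewrite /tokens /=.
case: x => [k|] /=; rewrite !evk_cons evk_nil Bg0 !mulg1 //.
by rewrite mulKaa.
Qed.

Lemma killcount_cat i u u' : killcount i (u ++ u') = killcount i u (+) killcount i u'.
Proof. by rewrite /killcount count_cat oddD. Qed.

Lemma killcount_tokens_rev i w : killcount i (tokens (rev w)) = killcount i (tokens w).
Proof.
elim: w => [//|x w IHw]; rewrite rev_cons -cats1 -[in RHS]cat1s !tokens_cat.
by rewrite !killcount_cat IHw addbC.
Qed.

(** Modulo 2 the two copies of [f] cancel. What remains is [k0], [k0], [k], and only the two [k0]
    count because [k] survives. *)
Lemma killcount_mover i k f : chi i k ->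
  killcount i (tokens (None :: rev f ++ Some k :: f)) = false.
Proof.
move=> ck; rewrite -cat1s -[Some k :: f]cat1s !tokens_cat !killcount_cat.
by rewrite killcount_tokens_rev [X in _ (+) X]addbCA addbb /killcount /= ck chi0.
Qed.

(** Doubling [j] times puts the same element, up to conjugation by [a], under every vertex of level
    [j], so letter [j] is flipped everywhere. Which value of that letter leads to the singular point
    varies with the vertex; hence [v] describes only the letters after it. *)
Definition mover omega j k v : autT :=
  iter j dbl (gen_a * spl (shiftn omega j) k (true :: v)).

Lemma mover_word omega j k v :
  (forall j', j = j'.+1 -> chi (omega j') k) ->
  splice_ok (omega j) (shiftn omega j.+1) k v ->
  exists u : seq klein, (size u <= 4 ^ (size v + 3))%N /\
    mover omega j k v = evk omega (zetas omega j u).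
Proof.
move=> kj vok.
(* The label [ord0] is arbitrary: it constrains only the head of the path, which is [true]. *)
have [|f fs [fE _]] := @spl_word ord0 (shiftn omega j) k (true :: v).
  by rewrite /= shift_shiftn /shiftn addn0.
exists (tokens (None :: rev f ++ Some k :: f)); split.
  apply: leq_trans (size_tokens _) _; rewrite /= size_cat size_rev /=.
  by move: fs; rewrite /= !expnS expnD; set q := (4 ^ size v)%N; lia.
rewrite evk_zetas; first by rewrite evk_tokens ev_cons fE.
by move=> j' jj'; apply: killcount_mover; apply: kj.
Qed.

Lemma wact_gen_a t y : wact gen_a (t :: y) = ~~ t :: y.
Proof. by rewrite /gen_a wact_node flipE; case: t. Qed.

Lemma wact_aexp c t y : wact (aexp c) (t :: y) = t (+) c :: y.
Proof. by case: c; rewrite ?addbT ?addbF //= /aexp wact_gen_a. Qed.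

Lemma dbl_section j g v : size v = j -> exists c, forall y,
  wact (iter j dbl g) (v ++ y) = v ++ wact (aexp c * g * aexp c) y.
Proof.
elim: j g v => [|j IHj] g v; first by move=> /size0nil ->; exists false; rewrite /= mul1g mulg1.
case/lastP: v => [//|v t]; rewrite size_rcons => -[sv].
have [c cE] := IHj (dbl g) v sv.
exists (c (+) ~~ t) => y; rewrite iterSr cat_rcons cE cat_rcons; congr (_ ++ _).
rewrite !wactM wact_aexp /dbl wact_node perm1 wact_aexp addbK; congr (_ :: _).
by case: t c {cE} => [] [] //=; rewrite ?mul1g ?mulg1.
Qed.

Definition trivial_section (g : autT) (p : seq bool) : Prop :=
  forall y, wact g (p ++ y) = wact g p ++ y.

Definition trivial_germ (g : autT) (x : ray) : Prop :=
  exists n, trivial_section g (mkseq x n).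

Lemma trivial_section_cat g p q : trivial_section g p -> trivial_section g (p ++ q).
Proof. by move=> gp y; rewrite -catA !gp catA. Qed.

Lemma mkseqD T (x : nat -> T) m n :
  mkseq x (m + n) = mkseq x m ++ mkseq (fun i => x (m + i)%N) n.
Proof.
rewrite /mkseq iotaD map_cat add0n; congr (_ ++ _).
by rewrite -[in LHS](addn0 m) iotaDl -map_comp.
Qed.

Lemma trivial_germ_le g x n : trivial_section g (mkseq x n) ->
  forall m, (n <= m)%N -> trivial_section g (mkseq x m).
Proof. by move=> gx m nm; rewrite -(subnKC nm) mkseqD; exact: trivial_section_cat. Qed.

Lemma trivial_germM g h x : trivial_germ g x -> trivial_germ h (bact x g) ->
  trivial_germ (g * h) x.
Proof.
move=> [n gn] [m hm]; exists (maxn n m) => y; rewrite !wactM.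
rewrite (trivial_germ_le gn (leq_maxl n m)) -mkseq_bact.
by rewrite (trivial_germ_le hm (leq_maxr n m)).
Qed.

Lemma trivial_germ1 x : trivial_germ 1 x. Proof. by exists 0%N. Qed.

Lemma wactK g w : wact g^-1 (wact g w) = w.
Proof. by rewrite -wactM mulgV. Qed.

Lemma trivial_germV g x : trivial_germ g x -> trivial_germ g^-1 (bact x g).
Proof.
move=> [n gn]; exists n => y; rewrite mkseq_bact -gn !wactK.
by [].
Qed.

Lemma trivial_germ_aexp c x : trivial_germ (aexp c) x.
Proof. by exists 1%N => y; rewrite /= !wact_aexp. Qed.

Lemma mkseqSl T (x : nat -> T) n : mkseq x n.+1 = x 0%N :: mkseq (fun i => x i.+1) n.
Proof. by rewrite -add1n mkseqD. Qed.

Lemma trivial_germ_node g0 g1 s x :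
  trivial_germ (if x 0%N then g1 else g0) (fun i => x i.+1) ->
  trivial_germ (node g0 g1 s) x.
Proof.
move=> [n gn]; exists n.+1 => y.
by rewrite mkseqSl cat_cons !wact_node gn.
Qed.

Lemma spl_step omega k v : spl omega k v =
  (if head true v then
     node (aexp (chi (omega 0%N) k)) (spl (shift_letters omega) k (behead v)) 1
   else node (spl (shift_letters omega) k (behead v)) (aexp (chi (omega 0%N) k)) 1).
Proof. by case: v => [|[] v] //=; rewrite BgE. Qed.

Lemma spl_trivial_germ omega k v (x : ray) m :
  x m != nth true v m -> trivial_germ (spl omega k v) x.
Proof.
elim: m omega v x => [|m IHm] omega v x xm; rewrite spl_step.
  have : x 0%N = ~~ head true v by move: xm; rewrite nth0; case: (x 0%N); case: head.
  case: (head true v) => x0; refine (@trivial_germ_node _ _ _ _ _); rewrite x0;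
    exact: trivial_germ_aexp.
have H : trivial_germ (spl (shift_letters omega) k (behead v)) (fun i => x i.+1).
  by apply: IHm; case: v xm => [|t v] //=; rewrite nth_nil.
by case: ifP => _; refine (@trivial_germ_node _ _ _ _ _); case: (x 0%N) => //; exact: trivial_germ_aexp.
Qed.

Lemma bact_aexp c x m : bact x (aexp c) m.+1 = x m.+1.
Proof.
rewrite /bact mkseqSl wact_aexp /=.
by rewrite nth_mkseq.
Qed.

Lemma mover_trivial_germ omega j k v (x : ray) m :
  x (j + m.+1)%N != nth true v m -> trivial_germ (mover omega j k v) x.
Proof.
move=> xm.
have [c cE] := @dbl_section j (gen_a * spl (shiftn omega j) k (true :: v)) _ (size_mkseq x j).
have [n gn] : trivial_germ (aexp c * (gen_a * spl (shiftn omega j) k (true :: v)) * aexp c)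
   (fun i => x (j + i)%N).
  apply: trivial_germM; last exact: trivial_germ_aexp.
  apply: trivial_germM; first exact: trivial_germ_aexp.
  apply: trivial_germM; first exact: (trivial_germ_aexp true).
  apply: (@spl_trivial_germ _ _ _ _ m.+1) => /=.
  by rewrite (bact_aexp true) bact_aexp.
exists (j + n)%N => y; rewrite mkseqD -catA /mover !cE gn catA.
by [].
Qed.

Lemma mover_act omega j k v (x : ray) :
  mkseq (bact x (mover omega j k v)) j.+1 = rcons (mkseq x j) (~~ x j).
Proof.
have [c cE] := @dbl_section j (gen_a * spl (shiftn omega j) k (true :: v)) _ (size_mkseq x j).
rewrite mkseq_bact mkseqS -cats1 /mover cE -cats1; congr (_ ++ _).
rewrite !wactM wact_aexp wact_gen_a /= wact_node perm1 /=.
by rewrite wact_nil wact_aexp; case: c {cE}; case: (x j).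
Qed.

End Movers.

(** * Counting the products of a random walk *)

Section RandomWalk.
Local Open Scope ring_scope.

Variant item := Lamp | Mv of nat.

Section Walk.
Variables (R : realFieldType) (omega : nat -> 'I_3) (lampletter : klein).
Variables (moverletter : nat -> klein) (paths : nat -> seq (seq bool)).

(* A step of the walk is a choice [(i, k)], with [k < nopt i]. *)
Definition nopt (i : item) : nat := if i is Mv j then (2 * size (paths j))%N else 2%N.

Definition path_of (j k : nat) : seq bool := nth [::] (paths j) k./2.

(** The parity of [k] is a fair coin, independent of the path [k./2]: a step is idle or active with
    equal probability. This is what equidistributes letter [j]. *)
Definition el (o : item * nat) : autT :=
  match o with
  | (Lamp, k) => if odd k then Bg omega lampletter else 1%g
  | (Mv j, k) => if odd k then mover omega j (moverletter j) (path_of j k) else 1%g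
  end.

(** The points where the germ of the step may be nontrivial. Idle steps are included, so that the
    condition depends on the path alone. *)
Definition bad (o : item * nat) (x : ray) : bool :=
  match o with
  | (Lamp, k) => `[< x = rho >]
  | (Mv j, k) => `[< forall m, x (j + m.+1)%N = nth true (path_of j k) m >]
  end.

Fixpoint fatal (c : seq (item * nat)) (x : ray) : bool :=
  if c is o :: c' then bad o x || fatal c' (bact x (el o)) else false.

Definition prodc (c : seq (item * nat)) : autT := (\prod_(o <- c) el o)%g.

Lemma prodc_cons o c : prodc (o :: c) = (el o * prodc c)%g.
Proof. by rewrite /prodc big_cons. Qed.

Lemma not_bad_trivial_germ o x : ~~ bad o x -> trivial_germ (el o) x.
Proof.
case: o => -[|j] k /= /asboolPn nb; case: (odd k); try exact: trivial_germ1.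
  have [m xm] : exists m, x m != true.
    apply: contrapT => /forallNP x1; apply: nb; apply/funext => m.
    by have := x1 m; rewrite /rho => /negP/negPn/eqP.
  by apply: (@spl_trivial_germ _ _ [::] _ m); rewrite nth_nil.
have [m xm] : exists m, x (j + m.+1)%N != nth true (path_of j k) m.
  apply: contrapT => /forallNP x1; apply: nb => m.
  by have := x1 m => /negP/negPn/eqP.
by apply: (@mover_trivial_germ omega j (moverletter j) (path_of j k) x m).
Qed.

Lemma not_fatal_trivial_germ c x : ~~ fatal c x -> trivial_germ (prodc c) x.
Proof.
elim: c x => [|o c IHc] x /=; first by move=> _; rewrite /prodc big_nil; exact: trivial_germ1.
rewrite negb_or => /andP[/not_bad_trivial_germ ob /IHc oc].
by rewrite prodc_cons; exact: trivial_germM.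
Qed.

Fixpoint sumC (L : seq item) (F : seq (item * nat) -> R) : R :=
  if L is i :: L' then \sum_(k < nopt i) sumC L' (fun c => F ((i, val k) :: c)) else F [::].

(** After each lamp the walk is restarted at [rho], because the germ at [rho] of the remaining
    product decides whether that lamp can be read. *)
Fixpoint nfatal (c : seq (item * nat)) : nat :=
  if c is o :: c' then ((if o.1 is Lamp then fatal c' rho else false) + nfatal c')%N else 0%N.

Lemma sumC_le_in L F G : (forall c, map fst c = L -> F c <= G c) -> sumC L F <= sumC L G.
Proof.
elim: L F G => [|i L IHL] F G FG /=; first exact: FG.
by apply: ler_sum => k _; apply: IHL => c cL; apply: FG => /=; rewrite cL.
Qed.

Lemma sumC_le L F G : (forall c, F c <= G c) -> sumC L F <= sumC L G.
Proof. by move=> FG; apply: sumC_le_in => c _. Qed.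

Lemma eq_sumC L F G : F =1 G -> sumC L F = sumC L G.
Proof. by move=> FG; congr sumC; apply/funext. Qed.

Lemma sumCD L F G : sumC L (fun c => F c + G c) = sumC L F + sumC L G.
Proof.
elim: L F G => //= i L IHL F G; rewrite -big_split /=.
by apply: eq_bigr => k _; rewrite IHL.
Qed.

Lemma sumCZ L a F : sumC L (fun c => a * F c) = a * sumC L F.
Proof.
elim: L F => //= i L IHL F; rewrite mulr_sumr.
by apply: eq_bigr => k _; rewrite IHL.
Qed.

Lemma sumC0 L : sumC L (fun=> 0) = 0.
Proof. by elim: L => //= i L IHL; rewrite big1. Qed.

Lemma sumC_sum L (I : Type) (r : seq I) (F : I -> seq (item * nat) -> R) :
  sumC L (fun c => \sum_(x <- r) F x c) = \sum_(x <- r) sumC L (F x).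
Proof.
elim: r => [|x r IHr].
  by rewrite big_nil -[RHS](sumC0 L); apply: eq_sumC => c; rewrite big_nil.
rewrite big_cons -IHr -sumCD; apply: eq_sumC => c; by rewrite big_cons.
Qed.

Definition total (L : seq item) : R := sumC L (fun=> 1).

Lemma total_cons i L : total (i :: L) = (nopt i)%:R * total L.
Proof. by rewrite /total /= sumr_const card_ord mulr_natl. Qed.

Lemma total_ge0 L : 0 <= total L.
Proof. by rewrite -(sumC0 L); apply: sumC_le. Qed.

Lemma sumC_const L a : sumC L (fun=> a) = a * total L.
Proof. by rewrite -sumCZ; apply: eq_sumC => c; rewrite mulr1. Qed.

Hypothesis lampletter_often : forall n, exists m, (n <= m)%N /\ chi (omega m) lampletter.

Lemma Bg_fix_rho w k n : wact (Bg w k) (nseq n true) = nseq n true.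
Proof. by elim: n w => [//|n IHn] w /=; rewrite BgE wact_node perm1 IHn. Qed.

Lemma bact_rho w k : bact rho (Bg w k) = rho.
Proof.
apply/funext => n; rewrite /bact (_ : mkseq rho n.+1 = nseq n.+1 true); last first.
  by elim: n => // n IHn; rewrite mkseqSl IHn.
by rewrite Bg_fix_rho nth_nseq ltnSn.
Qed.

Lemma mkseq_rho n : mkseq rho n = nseq n true.
Proof. by elim: n => // n IHn; rewrite mkseqSl IHn. Qed.

(** At a level [m] where the letter survives it acts as [a] below [1^m 0], so the word [1^m 0 0] is
    moved although [1^m] is fixed; such levels occur arbitrarily deep. *)
Lemma lamp_nontrivial_germ : ~ trivial_germ (Bg omega lampletter) rho.
Proof.
move=> [n gn]; have [m [nm cm]] := lampletter_often n.
have := trivial_germ_le gn nm; rewrite mkseq_rho => /(_ [:: false; false]).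
rewrite Bg_fix_rho; elim: m omega cm {nm gn n} => [|m IHm] w cm /=.
  by rewrite BgE wact_node perm1 cm wact_gen_a.
rewrite BgE wact_node => -[_]; exact: IHm.
Qed.

Fixpoint decode_bound (y : R) (L : seq item) : R :=
  if L is i :: L' then
    (if i is Mv j then (nopt i)%:R else 1 + 2 * y) * decode_bound y L' else 1.

Lemma decode_bound_ge0 y L : 0 <= y -> 0 <= decode_bound y L.
Proof.
move=> y0; elim: L => [|[|j] L IHL] //=; rewrite mulr_ge0 //.
by rewrite addr_ge0 // mulr_ge0.
Qed.

(* When the walk after a lamp never meets a bad point, the germ of the product at [rho]
   is that of the lamp, so the lamp can be read off the product. *)
Lemma decode (y : R) L g : 0 <= y -> y <= 1 ->
  sumC L (fun c => y ^+ nfatal c * (prodc c == g)%:R) <= decode_bound y L.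
Proof.
move=> y0 y1; elim: L g => [|i L IHL] g /=.
  by rewrite expr0 mul1r; case: (_ == _).
have prodcE o c : (prodc (o :: c) == g) = (prodc c == ((el o)^-1 * g)%g).
  by rewrite prodc_cons -(inj_eq (@mulgI _ (el o)^-1%g)) mulKg.
case: i => [|j] /=; last first.
  have -> : (2 * size (paths j))%:R * decode_bound y L =
      \sum_(k < 2 * size (paths j)) decode_bound y L.
    by rewrite sumr_const card_ord mulr_natl.
  apply: ler_sum => k _.
  apply: le_trans (IHL ((el (Mv j, val k))^-1 * g)%g).
  by apply: sumC_le => c; rewrite /= add0n prodcE.
rewrite big_ord_recl big_ord_recl big_ord0 addr0 /=.
pose S (h : autT) := sumC L (fun c => y ^+ nfatal c * (prodc c == h)%:R).
pose N (h : autT) :=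
  sumC L (fun c => (~~ fatal c rho)%:R * (y ^+ nfatal c * (prodc c == h)%:R)).
have S0 h : S h <= decode_bound y L by exact: IHL.
have D0 := decode_bound_ge0 L y0.
have NS h : N h <= S h.
  apply: sumC_le => c; rewrite ler_piMl ?lern1 ?leq_b1 //.
  by rewrite mulr_ge0 ?exprn_ge0.
have step k h : ((el (Lamp, k))^-1 * g)%g = h ->
    sumC L (fun c => y ^+ (fatal c rho + nfatal c) * (prodc ((Lamp, k) :: c) == g)%:R)
    <= y * S h + N h.
  move=> hE; rewrite -sumCZ -sumCD; apply: sumC_le => c; rewrite prodcE hE exprD.
  case: (fatal c rho) => /=; rewrite ?expr1 ?expr0 ?mul0r ?addr0 ?mul1r -?mulrA //.
  by rewrite lerDr !mulr_ge0 ?exprn_ge0.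
have [g1 g2] : S g <= decode_bound y L /\ S (Bg omega lampletter * g)%g <= decode_bound y L.
  by split.
(* If non-fatal tails produced both [g] and the lamp times [g], both would have trivial germ at
   [rho], and so would the lamp. Non-fatal tails therefore count for one state of the lamp only,
   fatal ones for both with weight [y]: this is the factor [1 + 2 y]. *)
have N0 : N g = 0 \/ N (Bg omega lampletter * g)%g = 0.
  have [[c [fc cg]]|nc] := pselect (exists c, ~~ fatal c rho /\ prodc c = g); last first.
    left; rewrite /N -[RHS](sumC0 L); apply: eq_sumC => c.
    case fc: (fatal c rho) => /=; first by rewrite mul0r.
    case: eqP => cg /=; last by rewrite !mulr0.
    by case: nc; exists c; rewrite fc.
  right; rewrite /N -[RHS](sumC0 L); apply: eq_sumC => c'.
  case fc': (fatal c' rho) => /=; first by rewrite mul0r.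
  case: eqP => cg' /=; last by rewrite !mulr0.
  case: lamp_nontrivial_germ.
  have t1 := not_fatal_trivial_germ (negbT fc'); rewrite cg' in t1.
  have t2 := not_fatal_trivial_germ fc; rewrite cg in t2.
  have -> : Bg omega lampletter = (Bg omega lampletter * g * g^-1)%g by rewrite mulgK.
  apply: trivial_germM => //.
  rewrite bactM bact_rho; exact: trivial_germV.
have -> : (1 + 2 * y) * decode_bound y L =
   (y * decode_bound y L + decode_bound y L) + y * decode_bound y L by ring.
have s0 : ((el (Lamp, 0%N))^-1 * g)%g = g by rewrite /= invg1 mul1g.
have s1 : ((el (Lamp, 1%N))^-1 * g)%g = (Bg omega lampletter * g)%g.
  by rewrite /= inv_involution ?Bg2.
have := step 0%N _ s0; have := step 1%N _ s1.
have yS h : y * S h <= y * decode_bound y L by rewrite ler_wpM2l.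
have := yS g; have := yS (Bg omega lampletter * g)%g.
have := NS g; have := NS (Bg omega lampletter * g)%g.
by case: N0 => ->; lra.
Qed.

(** The list [mu] is an empirical measure with multiplicities: no cylinder of depth [h] has mass
    above [2^-h], written without division. *)
Definition evenly (h : nat) (mu : seq ray) : Prop :=
  forall v, size v = h -> (count (fun x => mkseq x h == v) mu * 2 ^ h <= size mu)%N.

Definition push (mu : seq ray) (i : item) : seq ray :=
  [seq bact x (el (i, k)) | k <- iota 0 (nopt i), x <- mu].

Lemma size_push mu i : size (push mu i) = (nopt i * size mu)%N.
Proof. by rewrite /push size_allpairs size_iota. Qed.

Lemma count_push (P : pred ray) mu i :
  count P (push mu i) = (\sum_(k < nopt i) count (fun x => P (bact x (el (i, val k)))) mu)%N.
Proof.
rewrite /push count_flatten sumnE !big_map -(big_mkord xpredT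
  (fun k => count (fun x => P (bact x (el (i, k)))) mu)) /index_iota subn0.
by apply: eq_bigr => k _; rewrite count_map.
Qed.

Lemma evenly_push h mu i : evenly h mu -> evenly h (push mu i).
Proof.
move=> hmu v sv; rewrite count_push size_push big_distrl /=.
rewrite -[in leqRHS](card_ord (nopt i)) -sum_nat_const leq_sum // => k _.
have /hmu : size (wact (el (i, val k))^-1%g v) = h.
  by rewrite (tree_morphism_size _ _) //; case: (autTP (el (i, val k))^-1%g).
apply: leq_trans; rewrite leq_mul2r; apply/orP; right; apply: sub_count => x /=.
by rewrite mkseq_bact => /eqP <-; rewrite wactK.
Qed.

Lemma sum_double (f : nat -> nat) n :
  (\sum_(k < 2 * n) f k = \sum_(m < n) (f m.*2 + f m.*2.+1))%N.
Proof.
elim: n => [|n IHn]; first by rewrite muln0 !big_ord0.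
rewrite (_ : 2 * n.+1 = (2 * n).+2)%N; last by lia.
by rewrite !big_ord_recr /= IHn mul2n addnA.
Qed.

(** For each path, the idle and the active choice send a ray to the two possible values of letter
    [j] while keeping its first [j] letters, so the mass of a cylinder is halved exactly. *)
Lemma evenly_push_mover j mu : evenly j mu -> evenly j.+1 (push mu (Mv j)).
Proof.
move=> jmu v; case/lastP: v => [//|w t]; rewrite size_rcons => -[sw].
rewrite count_push size_push (sum_double (fun k => count (fun x =>
  mkseq (bact x (el (Mv j, k))) j.+1 == rcons w t) mu)).
have E m : (count (fun x => mkseq (bact x (el (Mv j, m.*2))) j.+1 == rcons w t) mu +
    count (fun x => mkseq (bact x (el (Mv j, m.*2.+1))) j.+1 == rcons w t) mu =
    count (fun x => mkseq x j == w) mu)%N.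
  rewrite -[RHS]size_filter -(count_predC (fun x => x j == t)).
  rewrite !count_filter /= odd_double /=; congr (_ + _)%N; apply: eq_count => x /=.
    by rewrite bact1 mkseqS eqseq_rcons andbC.
  by rewrite mover_act eqseq_rcons andbC; case: (x j); case: t.
rewrite (eq_bigr _ (fun m _ => E (val m))) sum_nat_const card_ord expnS.
have := jmu w sw; set C := count _ _; set p := size (paths j) => CN.
rewrite (_ : p * C * (2 * 2 ^ j) = 2 * p * (C * 2 ^ j))%N; last by ring.
by rewrite leq_mul2l CN orbT.
Qed.

(** * The probability that the walk meets a bad point *)

Variable escape : R.

(** A union bound for the probability that the walk is fatal, from a law that is even to depth [h].
    A mover has two bounds: a ray is bad for at most one of the paths, and the rays bad for one path
    meet only [2 ^ j.+1] cylinders of depth [h]. *)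
Fixpoint cost (h : nat) (L : seq item) : R :=
  match L with
  | [::] => 0
  | Lamp :: L' => 2^-1 ^+ h + cost h L'
  | Mv j :: L' => Num.min escape (2 ^+ j.+1 * 2^-1 ^+ h) + cost (maxn h j.+1) L'
  end.

Fixpoint staged (h : nat) (L : seq item) : bool :=
  match L with
  | [::] => true
  | Lamp :: L' => staged h L'
  | Mv j :: L' => (j <= h)%N && staged (maxn h j.+1) L'
  end.

Hypothesis paths_uniq : forall j, uniq (paths j).
Hypothesis paths_size : forall j, {in paths j &, forall v w, size v = size w}.
Hypothesis paths_many : forall j, 1 <= escape * (size (paths j))%:R.

Lemma evenly_count h mu v : evenly h mu -> size v = h ->
  (count (fun x => mkseq x h == v) mu)%:R <= (size mu)%:R * 2^-1 ^+ h :> R.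
Proof.
move=> hmu sv; rewrite exprVn ler_pdivlMr ?exprn_gt0 //.
by rewrite -natrX -natrM ler_nat hmu.
Qed.

Lemma count_lamp h mu k : evenly h mu ->
  (count (bad (Lamp, k)) mu)%:R <= (size mu)%:R * 2^-1 ^+ h :> R.
Proof.
move=> hmu; apply: le_trans (evenly_count hmu (size_nseq h true)).
rewrite ler_nat; apply: sub_count => x /asboolP ->.
by rewrite mkseq_rho.
Qed.

Lemma count_mover h mu j k : evenly h mu -> (j <= h)%N ->
  (count (bad (Mv j, k)) mu)%:R <= (size mu)%:R * (2 ^+ j.+1 * 2^-1 ^+ h) :> R.
Proof.
move=> hmu; rewrite leq_eqVlt => /orP[/eqP ->|jh].
  apply: (@le_trans _ _ (size mu)%:R); first by rewrite ler_nat count_size.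
  rewrite ler_peMr // exprS -mulrA -exprMn divff ?pnatr_eq0 // expr1n mulr1.
  by rewrite ler1n.
pose pat := mkseq (nth true (path_of j k)) (h - j.+1).
have le1 : (count (bad (Mv j, k)) mu <=
    \sum_(u : j.+1.-tuple bool) count (fun x => mkseq x h == u ++ pat) mu)%N.
  elim: mu {hmu} => [//|x mu IHmu] /=.
  rewrite big_split /= leq_add //; case: asboolP => [bx|//].
  have su : size (mkseq x j.+1) == j.+1 by rewrite size_mkseq.
  have xE : mkseq x h = mkseq x j.+1 ++ pat.
    rewrite -[in LHS](subnKC jh) mkseqD /pat; congr (_ ++ mkseq _ _).
    by apply/funext => i; rewrite addSnnS bx.
  by rewrite (bigD1 (Tuple su)) //= xE eqxx.
apply: (@le_trans _ _ ((\sum_(u : j.+1.-tuple bool) count (fun x => mkseq x h == u ++ pat) mu)%N)%:R).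
  by rewrite ler_nat.
rewrite natr_sum (@le_trans _ _ (\sum_(u : j.+1.-tuple bool) (size mu)%:R * 2^-1 ^+ h)) //.
  apply: ler_sum => u _; apply: evenly_count => //.
  by rewrite size_cat size_tuple size_mkseq subnKC.
rewrite sumr_const card_tuple card_bool -[leLHS]mulr_natr natrX mulrCA mulrC mulrA.
by rewrite mulrAC mulrC mulrA (mulrC (size mu)%:R).
Qed.

(** Distinct paths of equal length prescribe distinct tails, so [x] follows at most one of them;
    that path is counted twice, once for each parity. *)
Lemma sum_escape j x :
  \sum_(k < nopt (Mv j)) (bad (Mv j, val k) x)%:R <= (nopt (Mv j))%:R * escape.
Proof.
rewrite /nopt -natr_sum (sum_double (fun k => nat_of_bool (bad (Mv j, k) x))).
have E m : (bad (Mv j, m.*2) x + bad (Mv j, m.*2.+1) x =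
    2 * `[< forall i, x (j + i.+1)%N = nth true (nth [::] (paths j) m) i >])%N.
  by rewrite /bad /path_of doubleK /= uphalf_double mul2n addnn.
rewrite (eq_bigr _ (fun m _ => E (val m))) -big_distrr /=.
set s := (\sum_(m < _) _)%N.
have s1 : (s <= 1)%N.
  rewrite /s; have [|] := pselect (exists m : 'I_(size (paths j)),
     forall i, x (j + i.+1)%N = nth true (nth [::] (paths j) m) i); last first.
    move=> nm; rewrite big1 // => m _; case: asboolP => // bm.
    by case: nm; exists m.
  move=> [m bm]; rewrite (bigD1 m) //= big1 ?addn0 ?leq_b1 // => m' m'm.
  case: asboolP => // bm'; case/eqP: m'm; apply: val_inj => /=.
  apply/eqP; rewrite -(nth_uniq [::] _ _ (paths_uniq j)) //; apply/eqP.
  have sz : size (nth [::] (paths j) m') = size (nth [::] (paths j) m).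
    by apply: (@paths_size j); apply: mem_nth.
  apply: (@eq_from_nth _ true) => // i _; by rewrite -bm -bm'.
apply: (@le_trans _ _ (2 * 1)%:R); first by rewrite ler_nat leq_mul2l s1.
by rewrite muln1 natrM -mulrA ler_peMr // mulrC paths_many.
Qed.

Lemma sumr_count (T : Type) (P : pred T) s :
  \sum_(x <- s) (P x)%:R = (count P s)%:R :> R.
Proof. by elim: s => [|x s IHs]; rewrite ?big_nil // big_cons IHs -natrD. Qed.

Lemma fatal_cost h mu L : evenly h mu -> staged h L ->
  \sum_(x <- mu) sumC L (fun c => (fatal c x)%:R) <= (size mu)%:R * total L * cost h L.
Proof.
elim: L h mu => [|i L IHL] h mu hmu /=.
  by rewrite mulr0 big1.
move=> st.
pose h' := if i is Mv j then maxn h j.+1 else h.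
have hmu' : evenly h' (push mu i).
  rewrite /h'; case: i st {h'} => [|j /andP[jh _]]; first by move=> _; exact: evenly_push.
  move: jh; rewrite leq_eqVlt => /orP[/eqP jh|jh]; last first.
    by rewrite (maxn_idPl jh); exact: evenly_push.
  by move: hmu; rewrite -jh => hmu; rewrite maxnE subSnn addn1; exact: evenly_push_mover.
have st' : staged h' L by move: st; rewrite /h'; case: (i) => [|j /andP[]].
have := IHL h' _ hmu' st'; rewrite size_push natrM => IH.
pose B := if i is Mv j then Num.min escape (2 ^+ j.+1 * 2^-1 ^+ h) else 2^-1 ^+ h : R.
have costE : cost h (i :: L) = B + cost h' L by rewrite /B /h'; case: (i).
have bad_bound : \sum_(x <- mu) \sum_(k < nopt i) (bad (i, val k) x)%:R
    <= (size mu)%:R * (nopt i)%:R * B.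
  have swapped (C : R) : (forall k, (count (bad (i, k)) mu)%:R <= (size mu)%:R * C) ->
      \sum_(x <- mu) \sum_(k < nopt i) (bad (i, val k) x)%:R
      <= (size mu)%:R * (nopt i)%:R * C.
    move=> HC; rewrite exchange_big.
    rewrite (@le_trans _ _ (\sum_(k < nopt i) (size mu)%:R * C)) //.
      apply: ler_sum => k _; apply: le_trans (HC k).
      by rewrite (sumr_count (bad (i, val k))).
    by rewrite sumr_const card_ord -[leLHS]mulr_natr mulrAC.
  rewrite /B; case: i st {h' hmu' st' IH costE B} swapped => [_|j /andP[jh _]] swapped.
    by apply: swapped => k; exact: count_lamp hmu.
  rewrite minEle; case: ifP => _; last by apply: swapped => k; exact: count_mover hmu jh.
  rewrite (@le_trans _ _ (\sum_(x <- mu) (nopt (Mv j))%:R * escape)) //.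
    by apply: ler_sum => x _; exact: sum_escape.
  by rewrite big_const_seq count_predT iter_addr_0 -[leLHS]mulr_natl mulrA.
rewrite -/(cost h (i :: L)) costE -/(total (i :: L)) total_cons.
have -> : (size mu)%:R * ((nopt i)%:R * total L) * (B + cost h' L) =
   total L * ((size mu)%:R * (nopt i)%:R * B) +
   (nopt i)%:R * (size mu)%:R * total L * cost h' L by ring.
have tot0 := total_ge0 L.
apply: le_trans (lerD (ler_wpM2l tot0 bad_bound) IH).
have -> : \sum_(x <- push mu i) sumC L (fun c => (fatal c x)%:R) =
    \sum_(x <- mu) \sum_(k < nopt i) sumC L (fun c => (fatal c (bact x (el (i, val k))))%:R).
  rewrite /push big_allpairs_dep exchange_big; apply: eq_bigr => x _.
  rewrite -(big_mkord xpredT (fun k => sumC L (fun c => (fatal c (bact x (el (i, k))))%:R))).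
  by rewrite /index_iota subn0.
have orb_le (b f : bool) : (b || f)%:R <= b%:R + f%:R :> R.
  by rewrite -natrD ler_nat; case: b; case: f.
rewrite mulr_sumr -big_split; apply: ler_sum => x _ /=.
rewrite mulr_sumr -big_split; apply: ler_sum => k _ /=.
rewrite mulrC -sumC_const -sumCD; apply: sumC_le => c.
exact: orb_le.
Qed.

Fixpoint nlamps (L : seq item) : nat :=
  if L is i :: L' then (if i is Lamp then (nlamps L').+1 else nlamps L') else 0%N.

(* Every part of the walk following a lamp is run from [rho]. *)
Fixpoint cheap (delta : R) (L : seq item) : bool :=
  match L with
  | [::] => true
  | Lamp :: L' => [&& staged 0 L', cost 0 L' <= delta & cheap delta L']
  | Mv _ :: L' => cheap delta L'
  end.

Lemma nfatal_cost delta L : cheap delta L ->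
  sumC L (fun c => (nfatal c)%:R) <= (nlamps L)%:R * delta * total L.
Proof.
elim: L => [|i L IHL]; first by rewrite /= !mul0r.
case: i => [|j] /= ch; last first.
  have IH := IHL ch.
  rewrite (@le_trans _ _ (\sum_(k < 2 * size (paths j)) (nlamps L)%:R * delta * total L)) //.
    by apply: ler_sum => k _; under eq_sumC do rewrite /= add0n.
  rewrite -[total (Mv j :: L)]/(\sum_(k < 2 * size (paths j)) total L) -mulr_sumr.
  by [].
move: ch => /and3P[st co ch]; have IH := IHL ch.
have fc : sumC L (fun c => (fatal c rho)%:R) <= total L * delta.
  have e0 : evenly 0 [:: rho] by move=> v /size0nil ->.
  have := fatal_cost e0 st; rewrite big_seq1 /= mul1r => /le_trans -> //.
  by rewrite ler_wpM2l ?total_ge0.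
rewrite -[total (Lamp :: L)]/(\sum_(k < 2) total L) mulr_sumr; apply: ler_sum => k _.
rewrite -[sumC _ _]/(sumC L (fun c => (fatal c rho + nfatal c)%:R)).
under eq_sumC do rewrite natrD.
rewrite sumCD -natr1; lra.
Qed.

Lemma decode_boundE y L : decode_bound y L * 2 ^+ nlamps L = (1 + 2 * y) ^+ nlamps L * total L.
Proof.
elim: L => [|[|j] L IHL]; first by rewrite /= /total /= !mulr1.
  rewrite total_cons /= !exprS; move: IHL; set t := total L; set d := decode_bound y L.
  set a := 2 ^+ _; set b := _ ^+ nlamps L => E.
  by rewrite mulrACA E; ring.
by rewrite total_cons /= -mulrA IHL mulrCA.
Qed.

Lemma total_gt0 L : 0 < total L.
Proof.
elim: L => [|i L IHL]; first by rewrite /total /= ltr01.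
rewrite total_cons mulr_gt0 // ltr0n /nopt; case: i => // j.
rewrite muln_gt0 /= lt0n; apply/eqP => s0.
by have := paths_many j; rewrite s0 mulr0 ler10.
Qed.

Lemma sumC_eq_total (c : R) L : total L * c = sumC L (fun=> c).
Proof. by rewrite sumC_const mulrC. Qed.

(* With [y = 1/4], Markov's inequality bounds the sum of [y ^ nfatal c] from below, and
   [decode] bounds it from above. *)
Lemma many_products (A : seq autT) L : uniq A ->
  (forall c, map fst c = L -> prodc c \in A) ->
  cheap (32%:R)^-1 L -> (6 / 5) ^+ nlamps L <= 2 * (size A)%:R :> R.
Proof.
move=> uA LA ch; pose y : R := 4^-1.
have y0 : 0 <= y by rewrite /y; lra.
have y1 : y <= 1 by rewrite /y; lra.
(* The mean of [nfatal] is at most [n / 32], so it exceeds [n / 16] for at most half of the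
   choices. *)
set n := nlamps L; set q := (n %/ 16)%N.
have upper : sumC L (fun c => y ^+ nfatal c) <= (size A)%:R * decode_bound y L.
  rewrite (@le_trans _ _ (sumC L (fun c => \sum_(g <- A) y ^+ nfatal c * (prodc c == g)%:R))) //.
    apply: sumC_le_in => c /LA cA; rewrite (bigD1_seq _ cA) //= eqxx mulr1 lerDl.
    by apply: sumr_ge0 => g _; rewrite mulr_ge0 ?exprn_ge0.
  rewrite sumC_sum (@le_trans _ _ (\sum_(g <- A) decode_bound y L)) //.
    by apply: ler_sum => g _; exact: decode.
  by rewrite big_const_seq count_predT iter_addr_0 -[leLHS]mulr_natl.
have t0 := total_gt0 L.
have lower : total L * y ^+ q <= 2 * sumC L (fun c => y ^+ nfatal c).
  have H c : y ^+ q <= y ^+ nfatal c + y ^+ q * ((n.+1)%:R^-1 * 16 * (nfatal c)%:R) :> R.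
    have [le|lt] := leqP (nfatal c) q.
      apply: (@le_trans _ _ (y ^+ nfatal c)); first by rewrite ler_wiXn2l.
      by rewrite lerDl !mulr_ge0 ?exprn_ge0 ?invr_ge0.
    rewrite -[leLHS]add0r lerD ?exprn_ge0 // ler_peMr ?exprn_ge0 //.
    rewrite -mulrA mulrC ler_pdivlMr ?ltr0n // mul1r -natrM ler_nat.
    by move: lt; rewrite /q; lia.
  have := sumC_le L H; rewrite sumCD -sumC_eq_total sumCZ sumCZ.
  have := nfatal_cost ch; set N := sumC L (fun c => (nfatal c)%:R) => Nle Hle.
  have n1 : 0 < n.+1%:R :> R by rewrite ltr0n.
  have nle : n.+1%:R^-1 * 16 * N <= 2^-1 * total L.
    rewrite -mulrA mulrC ler_pdivrMr //.
    rewrite (@le_trans _ _ (16 * (n%:R * 32%:R^-1 * total L))) ?ler_wpM2l //.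
    rewrite -natr1; nra.
  have : y ^+ q * (n.+1%:R^-1 * 16 * N) <= y ^+ q * (2^-1 * total L).
    by rewrite ler_wpM2l ?exprn_ge0.
  move: Hle; move: (y ^+ q) (sumC L _) (_ * N) (total L) => Y T0 Z T Hle ?; lra.
have dE := decode_boundE y L.
have y4 : y ^+ q * 4 ^+ q = 1 by rewrite -exprMn /y mulVf ?expr1n // pnatr_eq0.
have P2 : 0 < 2 ^+ n :> R by rewrite exprn_gt0.
have h1 : total L * y ^+ q * 2 ^+ n <= 2 * (size A)%:R * ((1 + 2 * y) ^+ n * total L).
  rewrite -dE mulrA; apply: ler_pM => //; rewrite ?mulr_ge0 ?exprn_ge0 ?(ltW t0) //.
  by apply: le_trans lower _; rewrite -mulrA ler_wpM2l.
have h2 : 2 ^+ n <= 2 * (size A)%:R * (3 / 2) ^+ n * 4 ^+ q :> R.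
  have -> : 3 / 2 = 1 + 2 * y :> R by rewrite /y; field.
  rewrite -(ler_pM2l t0) -(ler_pM2l (_ : 0 < y ^+ q)) ?exprn_gt0 ?invr_gt0 //.
  set z := 2 * _ * _; rewrite (_ : y ^+ q * (total L * (z * 4 ^+ q)) = total L * z).
    rewrite /z [X in _ <= X]mulrC -[X in _ <= X]mulrA mulrA (mulrC (y ^+ q)).
    exact: h1.
  have E (a b c d : R) : a * (c * (d * b)) = (a * b) * (c * d) by ring.
  by rewrite E y4 mul1r.
(* Each lamp gains [2 / (1 + 2 y) = 4 / 3], and [4 ^ q] loses at most [10 / 9] per lamp because
   [(10 / 9) ^ 16 >= 4]; the quotient is [6 / 5]. *)
have h3 : 4 ^+ q <= (10 / 9) ^+ n :> R.
  have b1 : 1 <= 10 / 9 :> R by lra.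
  apply: (@le_trans _ _ ((10 / 9) ^+ (16 * q))); last first.
    by apply: ler_weXn2l => //; rewrite /q mulnC leq_divM.
  have b4 : 3 / 2 <= (10 / 9) ^+ 4 :> R by rewrite !exprS expr0; lra.
  have b5 : (3 / 2) ^+ 4 <= ((10 / 9) ^+ 4) ^+ 4 :> R.
    by apply: lerXn2r; rewrite ?nnegrE ?exprn_ge0 //; lra.
  have b6 : 4 <= (3 / 2) ^+ 4 :> R by rewrite !exprS expr0; lra.
  rewrite exprM (_ : 16 = 4 * 4)%N // exprM.
  apply: lerXn2r; rewrite ?nnegrE ?exprn_ge0 //; first lra.
have h4 : (6 / 5) ^+ n * ((3 / 2) ^+ n * (10 / 9) ^+ n) = 2 ^+ n :> R.
  by rewrite -!exprMn; congr (_ ^+ _); field.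
have p3 : 0 < (3 / 2) ^+ n :> R by rewrite exprn_gt0 //; lra.
have p4 : 0 < (10 / 9) ^+ n :> R by rewrite exprn_gt0 //; lra.
rewrite -(ler_pM2r (mulr_gt0 p3 p4)) h4; apply: le_trans h2 _.
by rewrite mulrA ler_wpM2l // !mulr_ge0 // ltW.
Qed.

End Walk.

End RandomWalk.

(** * Scheduling the steps of the walk *)

Section Scheduling.
Local Open Scope ring_scope.

Definition movers (n : nat) : seq item := [seq Mv j | j <- iota 0 n].

Lemma moversS n : movers n.+1 = movers n ++ [:: Mv n].
Proof. by rewrite /movers -addn1 iotaD map_cat add0n. Qed.

Definition level_after (h : nat) (L : seq item) : nat :=
  foldl (fun h i => if i is Mv j then maxn h j.+1 else h) h L.

Lemma level_after_cat h L1 L2 : level_after h (L1 ++ L2) = level_after (level_after h L1) L2.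
Proof. by rewrite /level_after foldl_cat. Qed.

Lemma staged_cat h L1 L2 : staged h (L1 ++ L2) = staged h L1 && staged (level_after h L1) L2.
Proof. by elim: L1 h => [//|[|j] L1 IHL] h /=; rewrite IHL // andbA. Qed.

Lemma level_after_movers h n : level_after h (movers n) = maxn h n.
Proof.
elim: n => [|n IHn]; first by rewrite maxn0.
by rewrite moversS level_after_cat IHn /= -maxnA; congr maxn; apply/maxn_idPr.
Qed.

Lemma staged_movers h n : staged h (movers n).
Proof.
elim: n => [//|n IHn]; rewrite moversS staged_cat IHn level_after_movers /= andbT.
exact: leq_maxr.
Qed.

(** Each scale repeats the previous one and then randomises [M] further letters. With
    [D = 2 ^ (M - e)], just below [2 ^ M], the expected number of returns to [rho] within a scale
    stays below [2^-e], while the number of lamps [D ^ l] is nearly two to the number of letters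
    used. *)
Fixpoint schedule (M D l : nat) : seq item :=
  if l is l'.+1 then flatten (nseq D (schedule M D l')) ++ movers (l.+1 * M)
  else Lamp :: movers M.

Definition after_lamp (s L : seq item) : Prop := exists L1, L = L1 ++ Lamp :: s.

Lemma after_lamp_cat s X Y : after_lamp s (X ++ Y) ->
  (exists2 s1, after_lamp s1 X & s = s1 ++ Y) \/ after_lamp s Y.
Proof.
elim: X => [|x X IHX] /=; first by right.
move=> [[|y L1] /= [-> E]].
  by left; exists X => //; exists [::].
have [|[s1 [L2 ->] ->]|] := IHX; first by exists L1.
  by left; exists s1 => //; exists (y :: L2).
by right.
Qed.

Lemma after_lamp_movers s n : ~ after_lamp s (movers n).
Proof.
move=> [L1 E].
have : all (fun i => if i is Mv _ then true else false) (movers n).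
  by rewrite /movers all_map; apply/allP.
by rewrite E all_cat /= andbF.
Qed.

Lemma after_lamp_nseq s X D : after_lamp s (flatten (nseq D X)) ->
  exists c s1, [/\ (c < D)%N, after_lamp s1 X & s = s1 ++ flatten (nseq c X)].
Proof.
elim: D => [|D IHD] /=; first by move=> [[]].
move=> /after_lamp_cat [[s1 s1X ->]|/IHD[c [s1 [cD s1X ->]]]]; first by exists D, s1.
by exists c, s1; split=> //; apply: ltnW.
Qed.

Lemma nlamps_cat L1 L2 : nlamps (L1 ++ L2) = (nlamps L1 + nlamps L2)%N.
Proof. by elim: L1 => [//|[|j] L1 IHL] /=; rewrite IHL. Qed.

Lemma nlamps_movers n : nlamps (movers n) = 0%N.
Proof. by elim: n => // n IHn; rewrite moversS nlamps_cat IHn. Qed.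

Lemma nlamps_nseq n X : nlamps (flatten (nseq n X)) = (n * nlamps X)%N.
Proof. by elim: n => [//|n IHn] /=; rewrite nlamps_cat IHn mulSn. Qed.

Lemma nlamps_schedule M D l : nlamps (schedule M D l) = (D ^ l)%N.
Proof.
elim: l => [|l IHl] /=; first by rewrite nlamps_movers.
rewrite nlamps_cat nlamps_movers addn0 expnS -IHl.
exact: nlamps_nseq.
Qed.

Section Cost.
Variables (R : realFieldType) (escape : R).
Hypothesis escape0 : 0 <= escape.
Local Notation cost := (cost escape).

Lemma cost_cat h L1 L2 : cost h (L1 ++ L2) = cost h L1 + cost (level_after h L1) L2.
Proof. by elim: L1 h => [|[|j] L1 IHL] h /=; rewrite ?add0r // IHL addrA. Qed.

Lemma cost_movers_escape h n : cost h (movers n) <= n%:R * escape.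
Proof.
elim: n => [|n IHn]; first by rewrite mul0r.
rewrite moversS cost_cat level_after_movers /= -[n.+1%:R]natr1 mulrDl mul1r lerD // addr0.
by rewrite ge_min lexx.
Qed.

Lemma cost_movers_level h n : cost h (movers n) <= 2 ^+ n.+1 * 2^-1 ^+ h.
Proof.
have p0 : 0 <= 2^-1 ^+ h :> R by rewrite exprn_ge0 // invr_ge0.
elim: n => [|n IHn]; first by rewrite mulr_ge0.
rewrite moversS cost_cat level_after_movers /= addr0.
have -> : 2 ^+ n.+2 * 2^-1 ^+ h = 2 ^+ n.+1 * 2^-1 ^+ h + 2 ^+ n.+1 * 2^-1 ^+ h :> R.
  by rewrite [2 ^+ n.+2]exprS; ring.
rewrite lerD // ge_min; apply/orP; right; rewrite ler_wpM2l ?exprn_ge0 //.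
by rewrite ler_wiXn2l ?leq_maxl ?invr_ge0 // invf_le1 // ler1n.
Qed.

Lemma cost_ge0 h L : 0 <= cost h L.
Proof.
elim: L h => [//|[|j] L IHL] h /=; rewrite addr_ge0 ?exprn_ge0 ?invr_ge0 //.
by rewrite le_min escape0 mulr_ge0 ?exprn_ge0 // invr_ge0.
Qed.

Variables (q e : nat).
Local Notation M := (q * e)%N.
Local Notation D := (2 ^ (M - e))%N.
Hypothesis q0 : (0 < q)%N.

Lemma level_after_nseq h c X : level_after h X = h ->
  level_after h (flatten (nseq c X)) = h.
Proof. by move=> hX; elim: c => //= c IHc; rewrite level_after_cat hX. Qed.

Lemma level_after_schedule h l : (l.+1 * M <= h)%N -> level_after h (schedule M D l) = h.
Proof.
elim: l => [|l IHl] hl /=.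
  by rewrite level_after_movers; apply/maxn_idPl; rewrite mul1n in hl.
have hl' : (l.+1 * M <= h)%N by apply: leq_trans hl; rewrite leq_mul2r leqnSn orbT.
by rewrite level_after_cat (level_after_nseq _ (IHl hl')) level_after_movers; apply/maxn_idPl.
Qed.

Lemma staged_nseq h c X : level_after h X = h -> staged h X -> staged h (flatten (nseq c X)).
Proof. by move=> hX sX; elim: c => //= c IHc; rewrite staged_cat hX sX. Qed.

Lemma cost_nseq h c X : level_after h X = h ->
  cost h (flatten (nseq c X)) = c%:R * cost h X.
Proof.
move=> hX; elim: c => [|c IHc] /=; first by rewrite mul0r.
by rewrite cost_cat hX IHc -[in RHS]natr1 mulrDl mul1r addrC.
Qed.

Lemma staged_schedule h l : (l.+1 * M <= h)%N -> staged h (schedule M D l).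
Proof.
elim: l => [|l IHl] hl /=; first exact: staged_movers.
have hl' : (l.+1 * M <= h)%N by apply: leq_trans hl; rewrite leq_mul2r leqnSn orbT.
by rewrite staged_cat staged_movers andbT staged_nseq ?level_after_schedule ?IHl.
Qed.

Variable K : nat.
Definition tau : R := 2 * K%:R * 2^-1 ^+ M.
Hypothesis K0 : (0 < K)%N.
Hypothesis escapeE : escape = 2^-1 ^+ ((2 * q + 1) * M).

Lemma half_exp (a b : nat) : (a <= b)%N -> 2 ^+ a * 2^-1 ^+ b = 2^-1 ^+ (b - a) :> R.
Proof.
move=> ab; rewrite -[in LHS](subnKC ab) exprD mulrA -exprMn divff ?pnatr_eq0 //.
by rewrite expr1n mul1r.
Qed.

Lemma half_exp_le (a b : nat) : (a <= b)%N -> 2^-1 ^+ b <= 2^-1 ^+ a :> R.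
Proof. by move=> ab; rewrite ler_wiXn2l ?invr_ge0 // invf_le1 // ler1n. Qed.

Lemma tau_ge0 : 0 <= tau.
Proof. by rewrite /tau !mulr_ge0 ?exprn_ge0 ?invr_ge0. Qed.

Lemma escape_tau : K%:R * escape <= tau.
Proof.
rewrite /tau escapeE (@le_trans _ _ (K%:R * 2^-1 ^+ M)) //.
  rewrite ler_wpM2l // half_exp_le //; nia.
by rewrite -mulrA ler_peMl ?ler1n // mulr_ge0 ?exprn_ge0 ?invr_ge0.
Qed.

(* A substep of scale [l] is run [D ^ d.+1] times, [d = j - l], at level [j.+1 * M]: for
   small [d] its cost is controlled by [escape], for large [d] by equidistribution. *)
Lemma cost_movers_tau j l : (l <= j)%N -> (l.+1 * M <= K)%N ->
  D%:R ^+ (j - l).+1 * cost (j.+1 * M) (movers (l.+1 * M)) <= tau.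
Proof.
move=> lj lK; rewrite -natrX -expnM natrX.
(* Up to [2 q] repetitions by [D], the product is below [2 ^ (2 q M)], and [escape] leaves [2^-M].
   Beyond that, the repetitions exceed the equidistribution gain by one factor [2 ^ M] at most, but
   each [D] falls short of [2 ^ M] by [2 ^ e], in total by more than [2 ^ (2 q e) = 2 ^ (2 M)]. *)
have [small|large] := leqP (j - l).+1 (2 * q).
  apply: (@le_trans _ _ (2 ^+ ((M - e) * (j - l).+1) * (K%:R * escape))).
    rewrite ler_wpM2l ?exprn_ge0 // (le_trans (cost_movers_escape _ _)) //.
    by rewrite ler_wpM2r ?ler_nat.
  rewrite mulrCA escapeE half_exp; last by nia.
  rewrite /tau -mulrA mulrCA ler_wpM2l //.
  apply: (@le_trans _ _ (2^-1 ^+ M)); first by rewrite half_exp_le //; nia.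
  by rewrite ler_peMl ?exprn_ge0 ?invr_ge0 // ler1n.
apply: (@le_trans _ _ (2 ^+ ((M - e) * (j - l).+1) *
   (2 ^+ (l.+1 * M).+1 * 2^-1 ^+ (j.+1 * M)))).
  by rewrite ler_wpM2l ?exprn_ge0 // cost_movers_level.
rewrite mulrA -exprD addnS exprS -mulrA half_exp; last by nia.
rewrite /tau -mulrA ler_wpM2l //.
apply: (@le_trans _ _ (2^-1 ^+ M)); first by rewrite half_exp_le //; nia.
by rewrite ler_peMl ?exprn_ge0 ?invr_ge0 // ler1n.
Qed.

(** The factor in front is the number of times that scale [l] is performed while the level is
    [j.+1 * M]. Carrying it through the induction makes every scale add a single [tau]. *)
Lemma cost_schedule j l : (l <= j)%N -> (j.+1 * M <= K)%N ->
  D%:R ^+ (j - l).+1 * cost (j.+1 * M) (schedule M D l) <=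
  D%:R ^+ j.+1 * 2^-1 ^+ (j.+1 * M) + l.+1%:R * tau.
Proof.
elim: l => [_|l IHl lj] jK.
  rewrite subn0 mulrDr lerD // mul1r.
  have := @cost_movers_tau j 0 (leq0n j); rewrite subn0 mul1n; apply.
  by apply: leq_trans jK; rewrite leq_pmull.
have lj' := ltnW lj.
have hl : (l.+1 * M <= j.+1 * M)%N by rewrite leq_mul2r ltnS lj' orbT.
rewrite /= cost_cat level_after_nseq ?level_after_schedule //.
rewrite cost_nseq ?level_after_schedule // mulrDr -[l.+2%:R]natr1 mulrDl mul1r addrA lerD //.
  rewrite mulrA -exprSr.
  have -> : ((j - l.+1).+2 = (j - l).+1)%N by lia.
  exact: IHl.
by apply: cost_movers_tau => //; apply: leq_trans jK; rewrite leq_mul2r ltnS lj orbT.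
Qed.

Definition scale_cost (l : nat) : R := 2^-1 ^+ e + l.+2%:R * tau.

Lemma cost_repeat j c : (c < D)%N -> (j.+1 * M <= K)%N ->
  cost (j.+1 * M) (flatten (nseq c (schedule M D j))) <= 2^-1 ^+ e + j.+1%:R * tau.
Proof.
move=> cD jK; rewrite cost_nseq ?level_after_schedule //.
apply: (@le_trans _ _ (D%:R * cost (j.+1 * M) (schedule M D j))).
  by rewrite ler_wpM2r ?cost_ge0 // ler_nat ltnW.
have := cost_schedule (leqnn j) jK; rewrite subnn expr1 => /le_trans -> //.
rewrite lerD2r -natrX -expnM natrX half_exp; last by nia.
by apply: half_exp_le; nia.
Qed.

(** What follows a lamp splits by scale: the rest of the current copy, then fewer than [D] full
    copies run at the level just reached, then the movers raising that level. Each scale costs at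
    most [scale_cost]. *)
Lemma after_lamp_cost l s : (l.+1 * M <= K)%N -> after_lamp s (schedule M D l) ->
  [/\ staged 0 s, level_after 0 s = (l.+1 * M)%N & cost 0 s <= l.+1%:R * scale_cost l].
Proof.
have sc0 l' : tau <= scale_cost l'.
  rewrite /scale_cost -[l'.+2%:R]natr1 mulrDl mul1r addrA lerDr addr_ge0 ?exprn_ge0 ?invr_ge0 //.
  by rewrite mulr_ge0 ?tau_ge0.
have moversK n : (n <= K)%N -> cost 0 (movers n) <= tau.
  move=> nK; apply: le_trans (cost_movers_escape _ _) _; apply: le_trans escape_tau.
  by rewrite ler_wpM2r ?ler_nat.
elim: l s => [|l IHl] s lK.
  rewrite /= mul1n in lK * => -[[|y L1] /= [E]].
    rewrite -E staged_movers level_after_movers max0n; split=> //.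
    by rewrite mul1r; apply: le_trans (sc0 0%N); apply: moversK.
  by move=> E'; case: (@after_lamp_movers s M); exists L1.
have lK' : (l.+1 * M <= K)%N by apply: leq_trans lK; rewrite leq_mul2r leqnSn orbT.
move=> /after_lamp_cat[|/after_lamp_movers//] [s1 /after_lamp_nseq[c [s2 [cD s2l ->]]] ->].
have [st lev co] := IHl s2 lK' s2l.
have lva := level_after_schedule (leqnn (l.+1 * M)).
rewrite -catA !staged_cat !level_after_cat !cost_cat st lev level_after_nseq //.
rewrite staged_nseq ?staged_schedule // staged_movers level_after_movers; split=> //.
  by apply/maxn_idPr; rewrite leq_mul2r leqnSn orbT.
have mono : scale_cost l <= scale_cost l.+1.
  by rewrite lerD2l ler_wpM2r ?tau_ge0 // ler_nat.
rewrite -[l.+2%:R]natr1 mulrDl mul1r; apply: lerD.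
  by apply: le_trans co _; rewrite ler_wpM2l.
rewrite /scale_cost -[l.+3%:R]natr1 mulrDl mul1r addrA; apply: lerD.
  apply: le_trans (cost_repeat cD lK') _; rewrite lerD2l ler_wpM2r ?tau_ge0 //.
  by rewrite ler_nat.
apply: le_trans (cost_movers_escape _ _) _; apply: le_trans escape_tau.
by rewrite ler_wpM2r ?ler_nat.
Qed.

Lemma cheapI delta L :
  (forall s, after_lamp s L -> staged 0 s /\ cost 0 s <= delta) -> cheap escape delta L.
Proof.
elim: L => [//|[|j] L IHL] H /=.
  have [-> ->] := H L (ex_intro _ [::] erefl); apply: IHL => s [L1 E].
  by apply: H; exists (Lamp :: L1); rewrite E.
by apply: IHL => s [L1 E]; apply: H; exists (Mv j :: L1); rewrite E.
Qed.

Lemma cheap_schedule J : (J.+1 * M <= K)%N -> J.+1%:R * scale_cost J <= 32%:R^-1 ->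
  cheap escape 32%:R^-1 (schedule M D J).
Proof.
move=> JK small; apply: cheapI => s /(after_lamp_cost JK)[st _ co].
by split=> //; apply: le_trans small.
Qed.

End Cost.

End Scheduling.

(** * A lower bound for the number of elements of a ball *)

Section LowerBound.
Local Open Scope ring_scope.

(** Left turns are allowed only below label [i], where [killed i] has trivial off-spine coordinate;
    these paths satisfy [splice_ok], and every occurrence of [i] doubles their number. *)
Fixpoint frees (w : nat -> 'I_3) (i : 'I_3) (n : nat) : seq (seq bool) :=
  if n is n'.+1 then
    [seq true :: v | v <- frees (shift_letters w) i n'] ++
    (if w 0%N == i then [seq false :: v | v <- frees (shift_letters w) i n'] else [::])
  else [:: [::]].

Lemma frees_size w i n v : v \in frees w i n -> size v = n.
Proof.
elim: n w v => [|n IHn] w v /=; first by rewrite inE => /eqP ->.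
by rewrite mem_cat => /orP[/mapP[u /IHn <- ->]//|]; case: ifP => // _ /mapP[u /IHn <- ->].
Qed.

Lemma frees_uniq w i n : uniq (frees w i n).
Proof.
elim: n w => [//|n IHn] w /=; rewrite cat_uniq map_inj_uniq; last by move=> ? ? [].
rewrite IHn /=; case: ifP => _; last by [].
rewrite map_inj_uniq; last by move=> ? ? [].
by rewrite IHn andbT; apply/hasPn => _ /mapP[u _ ->]; apply/mapP => -[].
Qed.

Lemma size_frees w i n : size (frees w i n) = (2 ^ count (fun m => w m == i) (iota 0 n))%N.
Proof.
elim: n w => [//|n IHn] w; rewrite /= size_cat size_map IHn -[iota 1 n]/(iota (1 + 0) n) iotaDl count_map.
rewrite (eq_count (a2 := fun m => shift_letters w m == i)) //.
case: ifP => _; last by rewrite addn0.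
by rewrite size_map IHn addnn -mul2n -expnS.
Qed.

Lemma frees_ok w i n v : v \in frees w i n ->
  splice_ok (w 0%N) (shift_letters w) (killed i) v.
Proof.
elim: n w v => [|n IHn] w v /=; first by rewrite inE => /eqP ->.
rewrite mem_cat => /orP[/mapP[u /IHn uok ->] //|].
by case: eqP => // wi /mapP[u /IHn uok ->] /=; rewrite chi_killed wi eqxx.
Qed.

Definition in_ball (R : realFieldType) omega (x : R) (g : autT) : Prop :=
  exists2 u : seq klein, (size u)%:R <= x & evk omega u = g.

Lemma in_ballM (R : realFieldType) omega (x y : R) g h :
  in_ball omega x g -> in_ball omega y h -> in_ball omega (x + y) (g * h)%g.
Proof.
move=> [u ux <-] [v vy <-]; exists (u ++ v); last by rewrite evk_cat.
by rewrite size_cat natrD lerD.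
Qed.

Lemma in_ball1 (R : realFieldType) omega (x : R) : 0 <= x -> in_ball omega x 1%g.
Proof. by move=> x0; exists [::]; rewrite ?evk_nil. Qed.

Section LowerCount.
Variables (R : realFieldType) (omega : nat -> 'I_3) (lampletter : klein).
Variables (W m K : nat) (Lam : nat -> R).
Hypothesis lampletter_often : forall n, exists m, (n <= m)%N /\ chi (omega m) lampletter.
Hypothesis many_free : forall j i, (j < K)%N ->
  (m <= count (fun n => omega (j + n)%N == i) (iota 0 W))%N.
Hypothesis Lam0 : 1 <= Lam 0.
Hypothesis LamS : forall n, 2 * Lam n <= Lam n.+1.
Hypothesis size_zetas : forall j u, (size (zetas omega j u))%:R <= Lam j * (size u)%:R.

(** The letter has to survive at level [j - 1] for the parity condition of [evk_zetas], and to be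
    killed at a label that recurs often for the paths to branch. *)
Definition moverletter (j : nat) : klein := killed (inext (omega j.-1)).

(** From [K] on, which the schedule never reaches, a default family of [2 ^ m] paths keeps the
    hypotheses of the walk true for every [j]. *)
Definition paths (j : nat) : seq (seq bool) :=
  if (j < K)%N then frees (shiftn omega j) (inext (omega j.-1)) W
  else frees (fun=> ord0) ord0 m.

Definition len (i : item) : R := if i is Mv j then Lam j * (4 ^ (W + 3))%:R else 2.

Lemma Lam_gt0 n : 0 < Lam n.
Proof.
elim: n => [|n IHn]; first exact: lt_le_trans Lam0.
by apply: lt_le_trans (LamS n); rewrite mulr_gt0.
Qed.

Lemma LamD n p : 2 ^+ p * Lam n <= Lam (n + p)%N.
Proof.
elim: p => [|p IHp]; first by rewrite mul1r addn0.
by rewrite addnS exprS -mulrA; apply: le_trans (LamS _); rewrite ler_wpM2l.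
Qed.

Lemma Lam_le n p : (n <= p)%N -> Lam n <= Lam p.
Proof.
move=> np; rewrite -(subnKC np); apply: le_trans (LamD _ _).
by rewrite ler_peMl ?(ltW (Lam_gt0 n)) // exprn_ege1 // ler1n.
Qed.

Lemma len_ge0 i : 0 <= len i.
Proof. by case: i => [|j] //=; rewrite mulr_ge0 ?(ltW (Lam_gt0 _)). Qed.

Lemma chi_moverletter j j' : j = j'.+1 -> chi (omega j') (moverletter j).
Proof. by move=> ->; rewrite /moverletter chi_killed inext_neq. Qed.

Lemma paths_sizeW j v : (j < K)%N -> v \in paths j -> size v = W.
Proof. by move=> jK; rewrite /paths jK => /frees_size. Qed.

Lemma el_in_ball o : (if o.1 is Mv j then (j < K)%N else true) ->
  in_ball omega (len o.1) (el omega lampletter moverletter paths o).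
Proof.
case: o => -[|j] k /=; case: (odd k).
- move=> _; exists [:: k0; lampletter]; first by rewrite lexx.
  by rewrite !evk_cons evk_nil Bg0 !mulg1 mulKaa.
- by move=> _; apply: in_ball1.
- move=> jK; set v := path_of paths j k.
  have [vs vok] : (size v <= W)%N /\
      splice_ok (omega j) (shiftn omega j.+1) (moverletter j) v.
    rewrite /v /path_of; have [lt|ge] := ltnP k./2 (size (paths j)); last first.
      by rewrite nth_default.
    have := mem_nth [::] lt; set u := nth _ _ _ => uin.
    rewrite (paths_sizeW jK uin); split=> //.
    move: uin; rewrite /paths jK => /frees_ok.
    by rewrite shift_shiftn /shiftn addn0.
  have [u [us ->]] := mover_word (@chi_moverletter j) vok.
  exists (zetas omega j u) => //.
  apply: le_trans (size_zetas j u) _; rewrite ler_wpM2l ?(ltW (Lam_gt0 j)) // ler_nat.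
  by apply: leq_trans us _; rewrite leq_exp2l // leq_add2r.
- move=> _; apply: in_ball1; exact: (len_ge0 (Mv j)).
Qed.

Lemma prodc_in_ball L c : map fst c = L ->
  all (fun i => if i is Mv j then (j < K)%N else true) L ->
  in_ball omega (\sum_(i <- L) len i) (prodc omega lampletter moverletter paths c).
Proof.
move=> <-; elim: c => [|o c IHc] /=.
  by move=> _; rewrite big_nil /prodc big_nil; exact: in_ball1.
move=> /andP[oK cK]; rewrite big_cons prodc_cons.
by apply: in_ballM; [exact: el_in_ball | exact: IHc].
Qed.

Lemma all_movers n : (n <= K)%N ->
  all (fun i => if i is Mv j then (j < K)%N else true) (movers n).
Proof.
move=> nK; rewrite /movers all_map; apply/allP => j; rewrite mem_iota /= => jn.
exact: leq_trans nK.
Qed.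

Lemma all_schedule M D l : (l.+1 * M <= K)%N ->
  all (fun i => if i is Mv j then (j < K)%N else true) (schedule M D l).
Proof.
elim: l => [|l IHl] lK /=; first by rewrite all_movers //; rewrite mul1n in lK.
rewrite all_cat all_movers // andbT.
have IH : all (fun i => if i is Mv j then (j < K)%N else true) (schedule M D l).
  by apply: IHl; apply: leq_trans lK; rewrite leq_mul2r leqnSn orbT.
by elim: (D in nseq D _) => //= n IHn; rewrite all_cat IH.
Qed.

Let B : R := (4 ^ (W + 3))%:R.

Lemma B_ge1 : 1 <= B. Proof. by rewrite /B ler1n expn_gt0. Qed.

Lemma B_ge0 : 0 <= B. Proof. exact: le_trans B_ge1. Qed.

Lemma len_movers n : \sum_(i <- movers n) len i <= n%:R * (Lam n * B).
Proof.
elim: n => [|n IHn]; first by rewrite big_nil mul0r.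
rewrite moversS big_cat big_seq1 /= -[n.+1%:R]natr1 mulrDl mul1r lerD //.
  apply: le_trans IHn _; rewrite ler_wpM2l // ler_wpM2r ?B_ge0 ?Lam_le //.
by rewrite ler_wpM2r ?B_ge0 ?Lam_le.
Qed.

Lemma len_nseq n X : \sum_(i <- flatten (nseq n X)) len i = n%:R * \sum_(i <- X) len i.
Proof.
elim: n => [|n IHn] /=; first by rewrite big_nil mul0r.
by rewrite big_cat /= IHn -[n.+1%:R]natr1 mulrDl mul1r addrC.
Qed.

(** The [D <= 2 ^ M] copies are absorbed by the doubling of [Lam] over [M] levels, so every scale
    contributes the same amount, whence the factor [l.+1]. *)
Lemma len_schedule M e l : (l.+1 * M <= K)%N ->
  \sum_(i <- schedule M (2 ^ (M - e)) l) len i <= l.+1%:R * (K%:R + 2) * (Lam (l.+1 * M) * B).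
Proof.
have B0 n : 0 <= Lam n * B by rewrite mulr_ge0 ?(ltW (Lam_gt0 _)) ?B_ge0.
have BL n : 1 <= Lam n * B.
  have := @ler_pM R 1 (Lam n) 1 B; rewrite mulr1; apply; rewrite ?ler01 ?B_ge1 //.
  by apply: le_trans Lam0 _; exact: Lam_le.
have sub n : (n <= K)%N -> \sum_(i <- movers n) len i <= K%:R * (Lam n * B).
  move=> nK; apply: le_trans (len_movers n) _.
  by rewrite ler_wpM2r ?ler_nat.
elim: l => [|l IHl] lK.
  rewrite /= big_cons mul1r mul1n mulrDl addrC lerD //; last first.
    by rewrite ler_peMr.
  by apply: sub; rewrite mul1n in lK.
have lK' : (l.+1 * M <= K)%N by apply: leq_trans lK; rewrite leq_mul2r leqnSn orbT.
rewrite /= big_cat len_nseq /= -[l.+2%:R]natr1 mulrDl mul1r mulrDl; apply: lerD; last first.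
  by apply: le_trans (sub _ lK) _; rewrite ler_wpM2r // lerDl.
apply: (@le_trans _ _ ((2 ^ (M - e))%:R * (l.+1%:R * (K%:R + 2) * (Lam (l.+1 * M) * B)))).
  by rewrite ler_wpM2l // IHl.
rewrite mulrCA; apply: ler_wpM2l; first by rewrite mulr_ge0 // addr_ge0.
rewrite mulrA; apply: ler_wpM2r; first exact: B_ge0.
have -> : (l.+2 * M = l.+1 * M + M)%N by rewrite mulSn addnC.
apply: le_trans (LamD _ _); rewrite ler_wpM2r ?(ltW (Lam_gt0 _)) // -natrX ler_nat.
by rewrite leq_exp2l // leq_subr.
Qed.

Lemma lower_count (q e J : nat) (A : seq autT) :
  (0 < q)%N -> (0 < K)%N -> (J.+1 * (q * e) <= K)%N -> ((2 * q + 1) * (q * e) <= m)%N ->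
  J.+1%:R * scale_cost R q e K J <= 32%:R^-1 ->
  uniq A ->
  (forall g, in_ball omega (J.+1%:R * (K%:R + 2) * (Lam (J.+1 * (q * e)) * B)) g -> g \in A) ->
  (6 / 5) ^+ ((2 ^ (q * e - e)) ^ J) <= 2 * (size A)%:R :> R.
Proof.
move=> q0 K0 JK qm small uA AP.
pose escape : R := 2^-1 ^+ ((2 * q + 1) * (q * e)).
have esc0 : 0 <= escape by rewrite exprn_ge0 // invr_ge0.
have many j : 1 <= escape * (size (paths j))%:R.
  have le : (2 ^ m <= size (paths j))%N.
    rewrite /paths; case: ifP => jK; rewrite size_frees leq_exp2l //.
      exact: many_free.
    by rewrite (eq_count (a2 := predT)) ?count_predT ?size_iota.
  apply: (@le_trans _ _ (escape * (2 ^ m)%:R)); last by rewrite ler_wpM2l // ler_nat.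
  rewrite natrX /escape -(subnKC qm) exprD mulrA -exprMn mulVf ?pnatr_eq0 //.
  by rewrite expr1n mul1r exprn_ege1 // ler1n.
have paths_uniq j : uniq (paths j) by rewrite /paths; case: ifP => _; exact: frees_uniq.
have paths_size j : {in paths j &, forall v w : seq bool, size v = size w}.
  by move=> v w; rewrite /paths; case: ifP => _ /frees_size -> /frees_size ->.
have ch := cheap_schedule esc0 q0 K0 (erefl escape) JK small.
have := many_products lampletter_often paths_uniq paths_size many uA _ ch.
rewrite nlamps_schedule; apply => c cL; apply: AP.
have [u us uE] := prodc_in_ball cL (all_schedule _ JK).
exists u; last exact: uE.
by apply: le_trans us _; exact: len_schedule.
Qed.

End LowerCount.

End LowerBound.

(** * The sequence omega attached to a choice of modes *)

Section Blocks.
Local Open Scope nat_scope.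

Definition next_pos (s : nat * nat) : nat * nat :=
  if s.2.+1 == 3 * s.1 then (s.1.+1, 0) else (s.1, s.2.+1).

(* Level [n] is at offset [off n] in the block [blk n]; block [b] consists of [3 b] levels. *)
Definition pos (n : nat) : nat * nat := iter n next_pos (1, 0).
Definition blk n := (pos n).1.
Definition off n := (pos n).2.

Definition tri (b : nat) : nat := \sum_(c < b) c.

Lemma triS b : tri b.+1 = tri b + b.
Proof. by rewrite /tri big_ord_recr. Qed.

Lemma posS n : pos n.+1 = next_pos (pos n). Proof. by []. Qed.

Lemma pos_spec n : [/\ 0 < blk n, off n < 3 * blk n & n = 3 * tri (blk n) + off n].
Proof.
elim: n => [|n [b0 ob nE]]; first by rewrite /blk /off /= /tri big_ord1.
rewrite /blk /off posS /next_pos -/(off n) -/(blk n); case: eqP => /= e.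
  by split=> //; rewrite triS {1}nE; lia.
by split=> //; [lia | rewrite {1}nE addnS].
Qed.

Lemma pos_step n : (off n).+1 = 3 * blk n /\ blk n.+1 = (blk n).+1 /\ off n.+1 = 0 \/
  (off n).+1 < 3 * blk n /\ blk n.+1 = blk n /\ off n.+1 = (off n).+1.
Proof.
have [_ lt _] := pos_spec n.
rewrite [blk n.+1]/blk [off n.+1]/off posS /next_pos -/(off n) -/(blk n).
by case: eqP => e; [left | right]; split=> //; lia.
Qed.

Lemma blk_le m n : m <= n -> blk m <= blk n.
Proof.
move=> /subnKC <-; elim: (n - m) => [|d IHd]; first by rewrite addn0.
by apply: leq_trans IHd _; rewrite addnS; case: (pos_step (m + d)) => -[_ [-> _]].
Qed.

Lemma tri2 b : 2 * tri b.+1 = b * b.+1.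
Proof.
elim: b => [|b IHb]; first by rewrite /tri big_ord1.
by rewrite triS mulnDr IHb; nia.
Qed.

Lemma blk_sqr n : (blk n).-1 ^ 2 <= n.
Proof.
have [b0 _ nE] := pos_spec n; rewrite [leqRHS]nE; move: b0.
case: (blk n) => // b _; have := tri2 b; rewrite -mulnn /=; nia.
Qed.

Lemma off0_often n : exists2 m, n <= m & off m = 0.
Proof.
have [d] := ubnP (3 * blk n - off n); elim: d n => // d IHd n lt.
have [|[lt' [b o]]] := pos_step n; first by move=> [_ [_ o]]; exists n.+1.
have [|m nm om] := IHd n.+1; first by rewrite b o; lia.
by exists m => //; apply: ltnW.
Qed.

Section Mode.
Variable slow : nat -> bool.

Definition omega n : 'I_3 :=
  Ordinal (ltn_pmod (if slow (blk n) then off n %/ blk n else off n) (isT : 0 < 3)).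

Definition fast n := ~~ slow (blk n).

(** Marks the levels after which the mode or the label is not the one that the potential and the
    norm anticipate; they can occur only at the ends of runs and blocks. *)
Definition switch n : bool :=
  ~~ ((fast n == fast n.+1) && (omega n.+1 == if fast n then inext (omega n) else omega n)).

Lemma switch_off n : switch n ->
  [|| (off n).+1 == blk n, (off n).+1 == 2 * blk n | (off n).+1 == 3 * blk n].
Proof.
apply: contraLR; rewrite !negb_or => /and3P[/eqP n1 /eqP n2 /eqP n3].
rewrite /switch negbK /fast /omega; have [b0 lt _] := pos_spec n.
case: (pos_step n) => -[e [be oe]]; first by case: n3.
rewrite be eqxx /= oe; case: (slow (blk n)) => /=; last first.
  by apply/eqP; apply: val_inj => /=; lia.
apply/eqP; apply: val_inj => /=.
have [lt1|ge1] := ltnP (off n).+1 (blk n); first by rewrite !divn_small // ltnW.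
have [lt2|ge2] := ltnP (off n).+1 (2 * blk n).
  have E o : blk n <= o -> o < 2 * blk n -> o %/ blk n = 1.
    by move=> h1 h2; apply/eqP; rewrite eqn_leq -ltnS ltn_divLR // leq_divRL // mul1n h1 h2.
  by rewrite !E //; lia.
have E o : 2 * blk n <= o -> o < 3 * blk n -> o %/ blk n = 2.
  by move=> h1 h2; apply/eqP; rewrite eqn_leq -ltnS ltn_divLR // leq_divRL // h1 h2.
by rewrite !E //; lia.
Qed.

Definition nswitch n := \sum_(m < n) switch m.

Lemma nswitch_blk n : nswitch n <= 3 * blk n.
Proof.
suff: nswitch n + 3 <= 3 * blk n + (blk n <= off n) + (2 * blk n <= off n).
  by have := leq_b1 (blk n <= off n); have := leq_b1 (2 * blk n <= off n); lia.
elim: n => [|n IHn]; first by rewrite /nswitch big_ord0.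
rewrite /nswitch big_ord_recr /= -/(nswitch n).
have [b0 lt _] := pos_spec n.
have sw := @switch_off n; case: (pos_step n) => -[e [-> ->]].
  have : (switch n : nat) <= 1 by case: (switch n).
  have -> : ((blk n).+1 <= 0) = false by []; have -> : (2 * (blk n).+1 <= 0) = false by lia.
  move: IHn; have -> : (blk n <= off n) = true by lia.
  have -> : (2 * blk n <= off n) = true by lia.
  by lia.
move: IHn; case: (switch n) sw => [/(_ isT)|_] /=; last first.
  case: (leqP (blk n) (off n)); case: (leqP (2 * blk n) (off n));
  case: (leqP (blk n) (off n).+1); case: (leqP (2 * blk n) (off n).+1) => /=; lia.
move=> /or3P[] /eqP E.
- have -> : (blk n <= off n) = false by lia.
  have -> : (blk n <= (off n).+1) = true by lia.
  have -> : (2 * blk n <= off n) = false by lia.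
  by lia.
- have -> : (blk n <= off n) = true by lia.
  have -> : (blk n <= (off n).+1) = true by lia.
  have -> : (2 * blk n <= off n) = false by lia.
  have -> : (2 * blk n <= (off n).+1) = true by lia.
  by lia.
- by lia.
Qed.

Definition nletter (i : 'I_3) n := \sum_(m < n) (omega m == i).

Definition letter_in_block (i : 'I_3) b o :=
  if slow b then minn b (o - i * b) else (o + 2 - i) %/ 3.

(** A complete block [b] contains each label exactly [b] times in both modes, so the count depends
    on the modes only through the current block. *)
Lemma nletterE i n : nletter i n = tri (blk n) + letter_in_block i (blk n) (off n).
Proof.
elim: n => [|n IHn].
  rewrite /nletter big_ord0 /blk /off /= /tri big_ord1 /letter_in_block /=.
  by case: (slow 1); case: i => [[|[|[|]]] ?].
rewrite /nletter big_ord_recr /= -/(nletter i n) IHn.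
have [b0 lt _] := pos_spec n.
have step : letter_in_block i (blk n) (off n) + (omega n == i) =
    letter_in_block i (blk n) (off n).+1.
  rewrite /letter_in_block /omega -val_eqE /=; case: (slow (blk n)); last first.
    by case: i {IHn} => [[|[|[|]]] ?] //=; case: eqP; lia.
  have D0 : (off n %/ blk n == 0) = (off n < blk n).
    by rewrite -leqn0 -ltnS ltn_divLR // mul1n.
  have D2 : (off n %/ blk n == 2) = (2 * blk n <= off n).
    rewrite eqn_leq -ltnS ltn_divLR // lt /= leq_divRL //.
  have lt3 : off n %/ blk n < 3 by rewrite ltn_divLR.
  rewrite modn_small //; case: i {IHn} => [[|[|[|]]] ?] //=.
  - by rewrite D0; case: (ltnP (off n) (blk n)); lia.
  - have -> : (off n %/ blk n == 1) = (blk n <= off n < 2 * blk n).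
      by move: lt3 D0 D2; case: (off n %/ blk n) => [|[|[|]]] //= _; lia.
    by case: (leqP (blk n) (off n)); case: (ltnP (off n) (2 * blk n)) => /=; lia.
  - by rewrite D2; case: (leqP (2 * blk n) (off n)); lia.
rewrite -addnA step; case: (pos_step n) => -[e [-> ->]] //.
rewrite triS e -addnA; congr (_ + _); rewrite /letter_in_block.
by case: (slow (blk n)); case: (slow (blk n).+1); case: i {IHn step} => [[|[|[|]]] ?] //=; lia.
Qed.

Lemma letter_in_block_le i n : letter_in_block i (blk n) (off n) <= blk n.
Proof.
have [b0 lt _] := pos_spec n; rewrite /letter_in_block; case: ifP => _; first exact: geq_minl.
lia.
Qed.

Lemma count_nletter i j W :
  count (fun n => omega (j + n) == i) (iota 0 W) = nletter i (j + W) - nletter i j.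
Proof.
elim: W => [|W IHW]; first by rewrite addn0 subnn.
have le : nletter i j <= nletter i (j + W).
  elim: (W) => [|V IHV]; first by rewrite addn0.
  by apply: leq_trans IHV _; rewrite addnS [leqRHS]/nletter big_ord_recr leq_addr.
rewrite -[iota 0 W.+1]/(iota 0 (1 + W)) addnC iotaD count_cat IHW /= add0n addn0 addnS.
by rewrite [nletter i (j + W).+1]/nletter big_ord_recr /= -/(nletter i (j + W)) addnBAC.
Qed.

Lemma many_letters i j W m : 3 * m + 6 * blk (j + W) <= W ->
  m <= count (fun n => omega (j + n) == i) (iota 0 W).
Proof.
move=> H; rewrite count_nletter !nletterE.
have [_ lt1 E1] := pos_spec j; have [_ lt2 E2] := pos_spec (j + W).
have := letter_in_block_le i j; have := blk_le (leq_addr W j); lia.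
Qed.

Lemma lampletter_often n : exists m, n <= m /\ chi (omega m) (true, false).
Proof.
have [m nm om] := off0_often n; exists m; split=> //.
by rewrite /omega om div0n if_same.
Qed.

Definition nfast n := \sum_(m < n) fast m.

End Mode.

End Blocks.

(** * Growth rates of word lengths under substitution *)

Section WordLengths.
Local Open Scope ring_scope.

Lemma killed_eq i j : (killed i == killed j) = (i == j).
Proof. by case: i => [[|[|[|]]] ?] //; case: j => [[|[|[|]]] ?]. Qed.
Lemma killed_neq0 i : (killed i == k0) = false.
Proof. by case: i => [[|[|[|]]] ?]. Qed.
Lemma neq0_killed i : (k0 == killed i) = false.
Proof. by rewrite eq_sym killed_neq0. Qed.
Lemma inext3 i : inext (inext (inext i)) = i.
Proof. by apply: val_inj; case: i => [[|[|[|]]] ?]. Qed.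
Lemma inext_neq' i : (inext i == i) = false. Proof. by rewrite eq_sym inext_neq. Qed.
Lemma inext2_neq' i : (inext (inext i) == i) = false. Proof. by rewrite eq_sym inext2_neq. Qed.
Lemma klein_cases i (P : klein -> Prop) : P k0 -> P (killed i) -> P (killed (inext i)) ->
  P (killed (inext (inext i))) -> forall k, P k.
Proof. by case: i => [[|[|[|]]] ?] // ? ? ? ? [[] []]. Qed.

Definition kleinE := (killed_eq, killed_neq0, neq0_killed, inext3, inext_neq, inext2_neq,
  inext_neq', inext2_neq', eqxx, chi_killed, chi0).

Section Potential.
Variables (R : realFieldType) (eta : R).
Hypothesis heta : eta * eta * eta + eta * eta + eta = 2.

Lemma eta_gt : 3 / 4 < eta.
Proof.
rewrite ltNge; apply/negP => le.
have [e0|e0] := leP 0 eta.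
  have h1 : eta * eta <= 3 / 4 * (3 / 4) by apply: ler_pM.
  have h2 : eta * eta * eta <= 3 / 4 * (3 / 4) * (3 / 4) by apply: ler_pM => //; rewrite mulr_ge0.
  by move: heta; lra.
have : eta * (eta * eta + eta + 1) <= 0.
  rewrite mulr_le0_ge0 ?(ltW e0) //; have := sqr_ge0 (eta + 1); have := sqr_ge0 eta.
  by rewrite !expr2; lra.
by move: heta; lra.
Qed.

Lemma eta_lt1 : eta < 1.
Proof.
rewrite ltNge; apply/negP => le; have := eta_gt => g.
have h1 : 1 <= eta * eta by rewrite -[1]mulr1 ler_pM.
have h2 : 1 <= eta * eta * eta by rewrite -[1]mulr1 ler_pM.
by move: heta; lra.
Qed.

Lemma eta_gt0 : 0 < eta. Proof. by have := eta_gt; lra. Qed.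

(* The vectors [(eta^2, eta, 1)], indexed by how soon a letter is killed, form the Perron
   eigenvector of the substitution along [012012...], with eigenvalue [2 / eta]. *)
Definition potential (b : bool) (r : 'I_3) (k : klein) : R :=
  if b then
    if k == killed (inext r) then eta else
    if k == killed (inext (inext r)) then 1 else eta * eta
  else if k == killed r then 1 else 2^-1.

Definition rate (b : bool) : R := if b then 2 / eta else 2.

Lemma rate_eta : 2 / eta = eta * eta + eta + 1.
Proof.
have e0 := eta_gt0; apply: (@mulIf _ eta); first by rewrite gt_eqF.
by rewrite divfK ?gt_eqF //; move: heta; lra.
Qed.

(** There is equality for nontrivial letters. On slow levels a killed letter yields itself and two
    survivors, [1 + 1/2 + 1/2 = 2], and a survivor is doubled. On fast levels
    [2 / eta = eta^2 + eta + 1] serves the killed letter. *)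
Lemma potential_zeta b r k : \sum_(l <- zeta1 r k) potential b r l <=
  rate b * potential b (if b then inext r else r) k.
Proof.
have e0 := eta_gt0; have e1 := eta_lt1.
have h1 := rate_eta; have h2 : 2 / eta * eta = 2 by rewrite divfK // gt_eqF.
have h3 : 2 / eta * (eta * eta) = 2 * eta by rewrite mulrA h2.
move: k; apply: (klein_cases (i := r)); rewrite /zeta1 /potential /rate !kleinE /= ?(big_cons, big_nil);
  case: b; rewrite ?kleinE //=.
all: try lra.
by rewrite h3 addr0; have := ler_wpM2r (ltW e0) (ltW e1); lra.
Qed.

Lemma potential_bounds b r k : 2^-1 <= potential b r k <= 1.
Proof.
have e0 := eta_gt; have e1 := eta_lt1; have e00 := eta_gt0.
have h : 3 / 4 * (3 / 4) <= eta * eta by apply: ler_pM; lra.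
have h' : eta * eta <= 1 by rewrite -[leRHS]mulr1 ler_pM ?ltW.
by rewrite /potential; case: b; repeat case: ifP => _; apply/andP; split; lra.
Qed.

Lemma rate_ge2 b : 2 <= rate b.
Proof.
rewrite /rate; case: b => //; have e0 := eta_gt0; rewrite ler_pdivlMr //.
by have := eta_lt1; lra.
Qed.

(* Under a vertex labelled [r], a letter [k] survives on one side and leaves an [a] on the other
   when [chi r k]; these weights make the total weight of both sides [eta] times that of [k]. *)
Definition weight (b : bool) (r : 'I_3) (k : klein) : R :=
  if ~~ b || (k == k0) then 0 else
  if k == killed r then 1 - eta else
  if k == killed (inext r) then 1 - eta * eta else eta * eta * eta.

Definition aweight (b : bool) : R := if b then 1 - eta * eta * eta else 1.

Definition urate (b : bool) : R := if b then eta else 1.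

(** By the equation of [eta], the sums [weight + aweight] of the three nontrivial letters on a fast
    level are [eta^2], [eta] and [1]; the left-hand sides are [eta^3], [eta^2] and [eta]. On slow
    levels the norm merely counts the letters [a]. *)
Lemma weight_step b r k :
  weight b (if b then inext r else r) k + aweight b * (chi r k)%:R <=
  urate b * (weight b r k + aweight b).
Proof.
have E : eta * (eta * eta * eta) = 2 * eta - eta * eta - eta * eta * eta.
  have -> : 2 * eta = (eta * eta * eta + eta * eta + eta) * eta by rewrite heta.
  by ring.
have e0 := eta_gt0; have e1 := eta_lt1.
have h : eta * (1 - eta * eta * eta) >= 0.
  rewrite mulr_ge0 ?(ltW e0) // subr_ge0.
  have h' : eta * eta <= 1 by rewrite -[leRHS]mulr1 ler_pM ?ltW.
  have : eta * eta * eta <= 1 * 1 by apply: ler_pM; rewrite ?mulr_ge0 //; lra.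
  by rewrite mulr1.
move: k; apply: (klein_cases (i := r)); rewrite /weight /aweight /urate !kleinE /=;
  case: b; rewrite ?kleinE //=.
all: try lra.
  have -> : eta * (1 - eta * eta + (1 - eta * eta * eta)) =
    2 * eta - eta * eta * eta - eta * (eta * eta * eta) by ring.
  rewrite E; move: heta; clear; move: (eta * eta * eta) (eta * eta) => x y Hx; lra.
have -> : eta * (eta * eta * eta + (1 - eta * eta * eta)) = eta by ring.
move: heta; lra.
Qed.

Lemma aweight_bounds b : 4^-1 <= aweight b <= 1.
Proof.
rewrite /aweight; case: b; last by apply/andP; split; lra.
have e0 := eta_gt; have h : 3 / 4 * (3 / 4) <= eta * eta by apply: ler_pM; lra.
have h2 : 0 <= eta * eta * eta by rewrite !mulr_ge0 // ltW ?eta_gt0.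
by apply/andP; split; move: heta; lra.
Qed.

Lemma weight_bounds b r k : 0 <= weight b r k /\ weight b r k + aweight b <= 1.
Proof.
have e0 := eta_gt; have e1 := eta_lt1; have e00 := eta_gt0.
have h1 : eta * eta <= eta by have := ler_wpM2r (ltW e00) (ltW e1); lra.
have h0 : 0 <= eta * eta by rewrite mulr_ge0 ?ltW.
have h2 : 0 <= eta * eta * eta by rewrite !mulr_ge0 // ltW.
have h3 : 3 / 4 * (3 / 4) <= eta * eta by apply: ler_pM; lra.
have h4 : 3 / 4 * (3 / 4) * (3 / 4) <= eta * eta * eta by apply: ler_pM => //; lra.
by rewrite /weight /aweight; case: b; repeat case: ifP => _ /=; split; move: heta; lra.
Qed.

(** Lets [nrm] merge neighbouring letters without increasing the norm. *)
Lemma weight_add b r (k l : klein) : weight b r (klein_add k l) <= weight b r k + weight b r l.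
Proof.
have e0 := eta_gt; have e1 := eta_lt1; have e00 := eta_gt0.
have h1 : eta * eta <= eta by have := ler_wpM2r (ltW e00) (ltW e1); lra.
have h3 : 3 / 4 * (3 / 4) <= eta * eta by apply: ler_pM; lra.
have h4 : 3 / 4 * (3 / 4) * (3 / 4) <= eta * eta * eta by apply: ler_pM => //; lra.
rewrite /weight; case: b => /=; last by rewrite addr0.
by case: r => [[|[|[|]]] ?] //; case: k => [[] []]; case: l => [[] []];
  rewrite /klein_add /killed /inext /k0 /= -?pair_eqE /=; move: heta; lra.
Qed.

Section Levels.
Variable slow : nat -> bool.
Local Notation omega := (omega slow).
Local Notation fast := (fast slow).
Local Notation switch := (switch slow).
Local Notation nfast := (nfast slow).
Local Notation nswitch := (nswitch slow).

(** Potentials lie between [1/2] and [1], so changing the pattern costs at most a factor [2]. *)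
Definition lo_mult n : R := rate (fast n) * (if switch n then 2 else 1).

Definition lo_potential n (u : seq klein) : R := \sum_(k <- u) potential (fast n) (omega n) k.

Lemma lo_potential_zeta n u :
  lo_potential n (zeta (omega n) u) <= lo_mult n * lo_potential n.+1 u.
Proof.
rewrite /lo_potential /zeta big_flatten /= big_map mulr_sumr; apply: ler_sum => k _.
apply: le_trans (potential_zeta _ _ _) _.
have r0 : 0 <= rate (fast n) by apply: le_trans (rate_ge2 _).
rewrite /lo_mult -mulrA ler_wpM2l //; case sw: (switch n).
  have /andP[_ h1] := potential_bounds (fast n) (if fast n then inext (omega n) else omega n) k.
  have /andP[h2 _] := potential_bounds (fast n.+1) (omega n.+1) k.
  by lra.
by move: sw; rewrite /switch => /negbFE/andP[/eqP -> /eqP ->]; rewrite mul1r.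
Qed.

(** The leading [2] pays for returning from the potential, at least [1/2] per letter, to the number
    of letters. *)
Definition Lam (n : nat) : R := 2 * \prod_(m < n) lo_mult m.

Lemma lo_mult_ge2 n : 2 <= lo_mult n.
Proof.
rewrite /lo_mult -[leLHS]mulr1 ler_pM ?rate_ge2 //.
by case: ifP => _; lra.
Qed.

Lemma Lam_ge1 : 1 <= Lam 0. Proof. by rewrite /Lam big_ord0; lra. Qed.

Lemma LamS n : 2 * Lam n <= Lam n.+1.
Proof.
rewrite /Lam big_ord_recr /= ler_wpM2l // mulrC ler_wpM2l ?lo_mult_ge2 //.
by apply: prodr_ge0 => m _; apply: le_trans (lo_mult_ge2 _).
Qed.

Lemma lo_potential_zetas n j u : lo_potential n (zetas (shiftn omega n) j u) <=
  (\prod_(m < j) lo_mult (n + m)%N) * lo_potential (n + j)%N u.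
Proof.
elim: j n => [|j IHj] n /=; first by rewrite big_ord0 mul1r addn0.
rewrite /shiftn addn0 -/(shiftn omega n) shift_shiftn.
apply: le_trans (lo_potential_zeta _ _) _; rewrite big_ord_recl /= addn0 -mulrA.
rewrite ler_wpM2l; [by []|by apply: le_trans (lo_mult_ge2 _)|].
have := IHj n.+1; rewrite addSnnS; congr (_ <= _ * _).
by apply: eq_bigr => m _; rewrite /= addSnnS.
Qed.

Lemma lo_potential_bounds n u :
  2^-1 * (size u)%:R <= lo_potential n u <= (size u)%:R.
Proof.
rewrite /lo_potential; elim: u => [|k u /andP[h1 h2]].
  by rewrite big_nil mulr0 lexx.
have /andP[h3 h4] := potential_bounds (fast n) (omega n) k.
rewrite big_cons /= -[(size u).+1%:R]natr1; apply/andP; split; lra.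
Qed.

Lemma size_zetas j u : (size (zetas omega j u))%:R <= Lam j * (size u)%:R.
Proof.
have /andP[h1 _] := lo_potential_bounds 0 (zetas omega j u).
have /andP[_ h2] := lo_potential_bounds j u.
have := lo_potential_zetas 0 j u; rewrite add0n [shiftn _ _]/(omega) => h3.
have p0 : 0 <= \prod_(m < j) lo_mult (0 + m)%N.
  by apply: prodr_ge0 => m _; apply: le_trans (lo_mult_ge2 _).
have h4 := le_trans h3 (ler_wpM2l p0 h2).
by rewrite /Lam -mulrA; move: (le_trans h1 h4); rewrite ler_pdivrMl.
Qed.

Definition scale_length n : R := 2 ^+ n / eta ^+ nfast n.

Lemma LamE n : Lam n <= 2 * (2 ^+ nswitch n * scale_length n).
Proof.
rewrite /Lam ler_wpM2l //; elim: n => [|n IHn].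
  by rewrite big_ord0 /scale_length /nswitch /nfast !big_ord0 !expr0 invr1 !mulr1.
have s0 : 0 <= 2 ^+ nswitch n * scale_length n.
  by rewrite !mulr_ge0 ?exprn_ge0 // invr_ge0 exprn_ge0 // ltW ?eta_gt0.
rewrite big_ord_recr /=; apply: le_trans (ler_wpM2r _ IHn) _.
  by apply: le_trans (lo_mult_ge2 _).
rewrite /scale_length /nswitch /nfast !big_ord_recr /= -/(nswitch n) -/(nfast n).
rewrite /lo_mult /rate !exprD exprS; case: (fast n); case: (switch n);
  rewrite ?expr1 ?expr0 ?mulr1; set p := 2 ^+ n; set p' := 2 ^+ _; set q := eta ^+ _;
  rewrite ?invfM; set q' := q^-1; set z := eta^-1; lra.
Qed.

End Levels.
End Potential.

End WordLengths.

(** * Asymptotic form of the lower bound *)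

Section LowerEstimates.
Local Open Scope ring_scope.

Section LowerAsymptotics.
Variables (R : realType) (eta : R).
Hypothesis heta : eta * eta * eta + eta * eta + eta = 2.
Variable slow : nat -> bool.
Local Notation omega := (omega slow).
Local Notation nswitch := (nswitch slow).
Local Notation scale_length := (scale_length eta slow).

Lemma blk_linear (q n : nat) : (0 < q)%N -> (blk n)%:R <= 1 + q%:R + n%:R / q%:R :> R.
Proof.
move=> q0; have := blk_sqr n; set b := blk n => sq.
have q0' : 0 < q%:R :> R by rewrite ltr0n.
have [le|lt] := leqP b.-1 q.
  apply: (@le_trans _ _ (1 + q%:R)); last by rewrite lerDl divr_ge0.
  by rewrite nat1r ler_nat; lia.
have : (q * b <= q + n)%N by rewrite -mulnn in sq; nia.
rewrite -(ler_nat R) natrM natrD => h.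
have h' : b%:R <= 1 + n%:R / q%:R :> R.
  rewrite -(ler_pM2l q0') mulrDr mulr1 mulrCA divff ?gt_eqF // mulr1; exact: h.
by lra.
Qed.

Lemma ln2_le1 : ln 2 <= 1 :> R.
Proof. by have := @le_ln1Dx R 1; rewrite -[1 + 1]/2; apply; lra. Qed.

Lemma ln2_gt0 : 0 < ln 2 :> R.
Proof. by apply: ln_gt0; lra. Qed.

Lemma ln_linear (q : nat) (x : R) : (0 < q)%N -> 0 < x -> ln x <= x / q%:R + ln q%:R.
Proof.
move=> q0 x0; have q0' : 0 < q%:R :> R by rewrite ltr0n.
rewrite -[in leLHS](divfK (_ : q%:R != 0) x) ?gt_eqF // lnM ?posrE ?divr_gt0 // lerD2r.
by apply/ltW/ln_sublinear; rewrite divr_gt0.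
Qed.

Lemma scale_length_gt0 k : 0 < scale_length k.
Proof. by rewrite divr_gt0 ?exprn_gt0 // (eta_gt0 heta). Qed.

Lemma nfastS n : nfast slow n.+1 = (nfast slow n + fast slow n)%N.
Proof. by rewrite /nfast big_ord_recr. Qed.

Lemma scale_lengthS k : 2 * scale_length k <= scale_length k.+1 <= 3 * scale_length k.
Proof.
have e0 := eta_gt0 heta; have e1 := eta_lt1 heta; have e3 := eta_gt heta.
have s0 := scale_length_gt0 k.
have -> : scale_length k.+1 = 2 * scale_length k / eta ^+ (fast slow k).
  by rewrite /scale_length nfastS exprD exprS invfM !mulrA; ring.
case: (fast slow k); rewrite ?expr1 ?expr0 ?divr1; last by apply/andP; split; lra.
apply/andP; split; first by rewrite ler_pdivlMr // ler_piMr ?ltW // mulr_gt0.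
by rewrite ler_pdivrMr //; nra.
Qed.

Lemma scale_length_le j k : (j <= k)%N -> scale_length j <= scale_length k.
Proof.
move=> /subnKC <-; elim: (k - j)%N => [|d IHd]; first by rewrite addn0.
apply: le_trans IHd _; rewrite addnS; have /andP[h _] := scale_lengthS (j + d).
by have := scale_length_gt0 (j + d); lra.
Qed.

(** As [K] is linear in [e] while [q >= 2], [e * 2 ^ (- q e)] is still at most [2^-e]; the whole is
    a constant times [2^-e], and [2^-e <= 1 / e]. *)
Lemma small_scale_cost (q J e : nat) : (2 <= q)%N ->
  (32 * (J.+1 * (1 + 2 * J.+2 * (J.+1 * q))) <= e)%N ->
  J.+1%:R * scale_cost R q e (J.+1 * (q * e)) J <= 32%:R^-1.
Proof.
move=> q2 eL; rewrite /scale_cost /tau.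
have h2 : e%:R * 2^-1 ^+ (q * e) <= 2^-1 ^+ e :> R.
  have -> : (q * e = e + (q - 1) * e)%N by nia.
  rewrite exprD mulrCA ler_piMr ?exprn_ge0 ?invr_ge0 //.
  apply: (@le_trans _ _ (2 ^+ e * 2^-1 ^+ ((q - 1) * e))).
    by rewrite ler_wpM2r ?exprn_ge0 ?invr_ge0 // -natrX ler_nat ltnW // ltn_expl.
  rewrite half_exp; last by nia.
  by rewrite exprn_ile1 ?invr_ge0 // invf_le1 // ler1n.
apply: (@le_trans _ _ ((J.+1 * (1 + 2 * J.+2 * (J.+1 * q)))%N%:R * 2^-1 ^+ e)).
  rewrite [X in _ <= X * _]natrM -[leRHS]mulrA ler_wpM2l //.
  have E (n : nat) : (1 + n)%N%:R = 1 + n%:R :> R by rewrite natrD.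
  rewrite (E (2 * J.+2 * (J.+1 * q))%N) [leRHS]mulrDl mul1r lerD2l.
  have -> : J.+2%:R * (2 * (J.+1 * (q * e))%:R * 2^-1 ^+ (q * e)) =
     (2 * J.+2 * (J.+1 * q))%:R * (e%:R * 2^-1 ^+ (q * e)) :> R.
    by rewrite !natrM; ring.
  by rewrite ler_wpM2l.
set C := (J.+1 * _)%N in eL *.
apply: (@le_trans _ _ (C%:R * e%:R^-1)).
  rewrite ler_wpM2l // exprVn lef_pV2 ?posrE ?exprn_gt0 ?ltr0n //; last by nia.
  by rewrite -natrX ler_nat ltnW // ltn_expl.
have e0 : 0 < e%:R :> R by rewrite ltr0n; nia.
rewrite ler_pdivrMr // mulrC ler_pdivlMr // -natrM ler_nat mulnC.
exact: eL.
Qed.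

Lemma lower_count_at (q k : nat) (A : seq autT) :
  let J := ((2 * q + 1) * q).-1 in let e := (k %/ (J.+1 * q))%N in
  let K := (J.+1 * (q * e))%N in
  let W := (3 * ((2 * q + 1) * (q * e)) + 6 * blk (3 * k))%N in
  (2 <= q)%N -> (W <= 2 * k)%N ->
  (32 * (J.+1 * (1 + 2 * J.+2 * (J.+1 * q))) <= e)%N ->
  uniq A ->
  (forall g, in_ball omega (J.+1%:R * (K%:R + 2) * (Lam eta slow K * (4 ^ (W + 3))%:R)) g ->
     g \in A) ->
  (6 / 5) ^+ ((2 ^ (q * e - e)) ^ J) <= 2 * (size A)%:R :> R.
Proof.
move=> J e K W q2 W2 eL uA AP.
have K_le : (K <= k)%N by rewrite /K mulnA mulnC leq_divM.
have e0 : (0 < e)%N by nia.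
apply: (@lower_count R omega (true, false) W ((2 * q + 1) * (q * e)) K (Lam eta slow)) => //.
- exact: lampletter_often.
- move=> j i jK; apply: many_letters.
  have : (blk (j + W) <= blk (3 * k))%N by apply: blk_le; lia.
  have WE : W = (3 * ((2 * q + 1) * (q * e)) + 6 * blk (3 * k))%N by []. by lia.
- exact: Lam_ge1.
- exact: LamS.
- exact: size_zetas.
- lia.
- by rewrite /K !muln_gt0 e0 /=; lia.
- exact: small_scale_cost.
Qed.

Lemma lower_asymptotics (eps : R) : 0 < eps -> exists k0, forall k, (k0 <= k)%N ->
  forall A : seq autT, uniq A ->
  (forall g, in_ball omega (expR (eps * k%:R) * scale_length k) g -> g \in A) ->
  expR ((ln 2 - eps) * k%:R) <= ln (size A)%:R.
Proof.
move=> eps0.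
have [q [q100 qeps]] : exists q : nat, (100 <= q)%N /\ 100%:R / q%:R <= eps.
  have x0 : 0 <= 100%:R / eps by rewrite divr_ge0 ?ltW.
  exists (100 + Num.bound (100%:R / eps))%N; split; first exact: leq_addr.
  have := archi_boundP x0; set z := Num.bound _ => h.
  rewrite ler_pdivrMr ?ltr0n // mulrC -ler_pdivrMr //.
  by apply: le_trans (ltW h) _; rewrite ler_nat leq_addl.
(* With this [J], [K] is [q] times the number [m] of branchings that [escape] demands; hence [W] and
   [ln (4 ^ W)] are of order [k / q]. *)
pose J := ((2 * q + 1) * q).-1; pose n1 := (J.+1 * q)%N.
have JE : J.+1 = ((2 * q + 1) * q)%N by rewrite /J prednK //; nia.
have n10 : (0 < n1)%N by rewrite muln_gt0 /=; lia.
have [E0 E0E] : exists E0, E0 = (32 * (J.+1 * (1 + 2 * J.+2 * n1)))%N by eexists.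
have q0' : 0 < q%:R :> R by rewrite ltr0n; lia.
have q0 : (0 < q)%N by lia.
pose C : R := ln J.+1%:R + ln q%:R + 100%:R + 20%:R * q%:R + n1%:R.
have C0 : 0 <= C.
  by rewrite /C !addr_ge0 ?mulr_ge0 // ln_ge0 // ler1n.
have y0 : 0 <= C / eps by apply: divr_ge0 => //; apply: ltW.
have [k0 [kE kq kn kC]] : exists k0 : nat, [/\ (n1 * E0 <= k0)%N, (100 * q <= k0)%N,
    (100 * n1 <= k0)%N & (2 * Num.bound (C / eps) <= k0)%N].
  exists (maxn (maxn (n1 * E0) (100 * q)) (maxn (100 * n1) (2 * Num.bound (C / eps))))%N.
  by rewrite !leq_max !leqnn ?orbT.
exists k0 => k kk0 A uA AP.
have {}kE := leq_trans kE kk0; have {}kq := leq_trans kq kk0.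
have {}kn := leq_trans kn kk0; have {}kC := leq_trans kC kk0.
have Cle : 2 * C <= eps * k%:R.
  have := archi_boundP y0; set z := Num.bound _ => h.
  have : 2 * z%:R <= k%:R :> R.
    by rewrite -natrM ler_nat.
  by move: h; rewrite ltr_pdivrMr // => h1 h2; nra.
pose x : R := k%:R; pose u : R := x / q%:R.
have u0 : 0 <= u by rewrite divr_ge0.
have uE : 100%:R * u <= eps * x.
  by rewrite /u mulrCA mulrC ler_wpM2r // mulrC.
have u1 : 100%:R * u <= x.
  rewrite /u mulrCA ler_piMr // ler_pdivrMr // mul1r ler_nat; exact: q100.
pose e := (k %/ n1)%N; pose K := (J.+1 * (q * e))%N.
pose m := ((2 * q + 1) * (q * e))%N.
pose W := (3 * m + 6 * blk (3 * k))%N.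
have Kk : (K <= k)%N by rewrite /K mulnA mulnC leq_divM.
have kK : (k < K + n1)%N.
  by rewrite /K mulnA mulnC -/n1 [X in (X < _)%N](divn_eq k n1) ltn_add2l ltn_pmod.
have mu : m%:R <= u.
  rewrite /u ler_pdivlMr // -natrM ler_nat; apply: leq_trans Kk.
  by rewrite /m /K JE [leqLHS]mulnAC leqnn.
have b3 : (blk (3 * k))%:R <= 1 + q%:R + 3 * u.
  by have := blk_linear (3 * k) q0; rewrite natrM /u mulrA.
have bK : (blk K)%:R <= 1 + q%:R + u.
  apply: le_trans (blk_linear k q0); rewrite ler_nat; exact: blk_le.
have Wu : W%:R <= 21%:R * u + 6 + 6 * q%:R.
  by rewrite /W natrD (natrM _ 3 m) (natrM _ 6 (blk _)); lra.
have qx : 100%:R * q%:R <= x.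
  by rewrite -natrM ler_nat.
have q1 : 100%:R <= q%:R :> R by rewrite ler_nat.
have W2 : (W <= 2 * k)%N.
  by rewrite -(ler_nat R) [leRHS]natrM -/x; lra.
have eL : (E0 <= e)%N.
  by rewrite /e leq_divRL // mulnC.
have := @lower_count_at q k A; rewrite -/J /= -/n1 -E0E -/e -/K -/m -/W.
move=> /(_ _ W2 eL uA); rewrite -/m => H.
have {H} count : (6 / 5) ^+ ((2 ^ (q * e - e)) ^ J) <= 2 * (size A)%:R :> R.
  apply: H => [|g [w ww wg]]; first exact: leq_trans q100.
  apply: AP; exists w => //; apply: le_trans ww _.
  have sl := scale_length_le Kk; have sl0 := scale_length_gt0 K.
  have LK := LamE heta slow K; have LK0 : 0 < Lam eta slow K.
    exact: (Lam_gt0 (Lam_ge1 eta slow) (LamS heta slow)).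
  have K2 : 0 < K%:R + 2 :> R by rewrite ltr_wpDl.
  have [P4 [P4E P40 P4ln]] : exists P4 : R,
      [/\ P4 = (4 ^ (W + 3))%:R, 0 < P4 & ln P4 = ln 4 * (W + 3)%:R].
    exists (4 ^+ (W + 3)); rewrite natrX; split; first by [].
      by rewrite exprn_gt0.
    by rewrite lnXn // mulr_natr.
  have [P2 [P2E P20 P2ln]] : exists P2 : R,
      [/\ P2 = 2 ^+ nswitch K, 0 < P2 & ln P2 = ln 2 * (nswitch K)%:R].
    by exists (2 ^+ nswitch K); split=> //; rewrite ?exprn_gt0 // lnXn // mulr_natr.
  rewrite -P4E; rewrite -P2E in LK.
  have P0 : 0 < J.+1%:R * (K%:R + 2) :> R by rewrite mulr_gt0 ?ltr0n.
  apply: (@le_trans _ _ (J.+1%:R * (K%:R + 2) * (2 * P2 * P4) * scale_length k)).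
    rewrite -[leRHS]mulrA ler_wpM2l ?(ltW P0) // [leRHS]mulrAC ler_wpM2r ?(ltW P40) //.
    apply: le_trans LK _; rewrite -mulrA ler_wpM2l // ler_wpM2l ?(ltW P20) //.
  rewrite ler_wpM2r ?(ltW (scale_length_gt0 k)) //.
  rewrite -ler_ln ?posrE ?expR_gt0 ?mulr_gt0 // expRK.
  have ln2 := ln2_le1; have ln20 := ln2_gt0.
  have ln4 : ln 4 = 2 * ln 2 :> R.
    by rewrite (_ : 4 = 2 * 2) ?lnM ?posrE //; [ring | lra].
  rewrite !lnM ?posrE ?mulr_gt0 // P4ln P2ln ln4.
  have l1 : ln (K%:R + 2) <= u + 1 + ln q%:R.
    apply: le_trans (ln_linear q0 K2) _; rewrite lerD2r mulrDl lerD //.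
      by rewrite /u ler_wpM2r ?invr_ge0 ?(ltW q0') // ler_nat.
    by rewrite ler_pdivrMr //; lra.
  have l2 : ln 2 * (nswitch K)%:R <= 3 * (1 + q%:R + u).
    apply: (@le_trans _ _ (nswitch K)%:R); first by rewrite ler_piMl.
    apply: (@le_trans _ _ (3 * blk K)%:R); first by rewrite ler_nat nswitch_blk.
    by rewrite natrM ler_wpM2l.
  have l3 : 2 * ln 2 * (W + 3)%:R <= 2 * (21%:R * u + 6 + 6 * q%:R + 3).
    rewrite -mulrA ler_wpM2l // (@le_trans _ _ (W + 3)%:R) //; first by rewrite ler_piMl.
    by rewrite natrD lerD2r.
  have n1q : q%:R <= n1%:R :> R by rewrite ler_nat /n1 leq_pmull.
  move: l1 l2 l3 Cle uE ln2 n1q q1 u0; rewrite /C -/x.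
  clear; move: (ln J.+1%:R) (ln q%:R) (ln (K%:R + 2)) (ln 2 * _) (2 * ln 2 * _) => *; lra.
have A0 : 0 < (size A)%:R :> R.
  have : 0 < (6 / 5) ^+ ((2 ^ (q * e - e)) ^ J) :> R by rewrite exprn_gt0 //; lra.
  by move: count => /[swap] /lt_le_trans /[apply]; rewrite pmulr_rgt0.
pose a := ((q * e - e) * J)%N.
(* The number of lamps is [2 ^ a]. Compared with [K], each of the [J] scales loses [e] letters and
   one further scale loses all its [q * e]; together this is at most [2 k / q]. *)
have aK : (K <= a + e * (q + J))%N.
  rewrite /a /K mulnBl mulnDr mulSn (mulnC J) (mulnC e q).
  by move: (q * e * J)%N (e * J)%N (q * e)%N; clear => *; lia.
have qJ : (q <= J.+1)%N by rewrite JE leq_pmull // addn1.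
have eu : (e * (q + J))%:R <= 2 * u.
  rewrite /u mulrA ler_pdivlMr // -natrM -[2 * x](natrM R 2 k) ler_nat.
  apply: (@leq_trans (2 * K)); last by rewrite leq_mul2l.
  rewrite /K (_ : 2 * (J.+1 * (q * e)) = e * (2 * J.+1) * q)%N; last by ring.
  rewrite leq_mul2r leq_mul2l; move: qJ; move: (J) (q); clear => j p; lia.
have ax : x - n1%:R - 2 * u <= a%:R.
  have h1 : x <= K%:R + n1%:R by rewrite -natrD ler_nat ltnW.
  have h2 : K%:R <= a%:R + (e * (q + J))%:R :> R by rewrite -natrD ler_nat.
  by lra.
have [Y [YE Yexp]] : exists Y : nat, Y = ((2 ^ (q * e - e)) ^ J)%N /\ Y%:R = expR (ln 2 * a%:R) :> R.
  exists ((2 ^ (q * e - e)) ^ J)%N; split=> //.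
  by rewrite expRM_natr lnK ?posrE // -expnM natrX.
rewrite -YE in count.
have ln65 : 6^-1 <= ln (6 / 5) :> R.
  have h : (6 / 5)^-1 = 1 + - 6^-1 :> R by field.
  have := @le_ln1Dx R (- 6^-1); rewrite -h lnV ?posrE; last by lra.
  by move=> H; have := H ltac:(lra); lra.
have lA : Y%:R * ln (6 / 5) <= ln 2 + ln (size A)%:R :> R.
  have -> : ln 2 + ln (size A)%:R = ln (2 * (size A)%:R) :> R by rewrite lnM ?posrE.
  rewrite mulr_natl -lnXn; last by lra.
  by rewrite ler_ln ?posrE ?mulr_gt0 // exprn_gt0 //; lra.
have n1x : 100%:R * n1%:R <= x by rewrite -natrM ler_nat.
have ln2' : 2^-1 <= ln 2 :> R.
  have h : 2^-1 = 1 + - 2^-1 :> R by field.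
  have := @le_ln1Dx R (- 2^-1); rewrite -h lnV ?posrE //.
  by move=> H; have := H ltac:(lra); lra.
have Yge : expR (ln 2 * x - n1%:R - 2 * u) <= Y%:R.
  rewrite Yexp ler_expR; have := ler_wpM2l (ltW ln2_gt0) ax.
  have : ln 2 * (n1%:R + 2 * u) <= n1%:R + 2 * u.
    by rewrite ler_piMl ?ln2_le1 // addr_ge0 // mulr_ge0.
  by clear; lra.
have Cn : 100%:R + n1%:R <= C.
  have : 0 <= ln J.+1%:R :> R by rewrite ln_ge0 // ler1n.
  have : 0 <= ln q%:R :> R by rewrite ln_ge0 // ler1n.
  by rewrite /C; move: q0'; clear; move: (ln _) (ln _) => *; lra.
have Y12 : 12%:R <= Y%:R :> R.
  apply: le_trans Yge; apply: le_trans (expR_ge1Dx _).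
  have : 2^-1 * x <= ln 2 * x by rewrite ler_wpM2r.
  by move: n1x u1 qx q1; clear; lra.
have YZ : 12%:R * expR ((ln 2 - eps) * x) <= Y%:R.
  apply: le_trans Yge.
  have -> : ln 2 * x - n1%:R - 2 * u = (eps * x - n1%:R - 2 * u) + (ln 2 - eps) * x by ring.
  rewrite expRD ler_wpM2r ?expR_ge0 //; apply: le_trans (expR_ge1Dx _).
  by have := ler0n R n1; move: Cn Cle uE; rewrite -/x; clear; lra.
have := ler_wpM2l (ler0n R Y) ln65; have := ln2_le1; rewrite -/x.
by move: lA Y12 YZ; clear; lra.
Qed.

End LowerAsymptotics.

End LowerEstimates.

(** * Encoding the elements of the wreath product *)

Section Encoding.
Local Open Scope group_scope.

Section LampWords.
Variable F : finGroupType.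

(* [None] stands for [a], and [Some (k, f)] for the letter [k] preceded by the lamp [f] at [rho]. *)
Definition lletter := option (klein * F).

Definition lmark (f : F) (x : ray) : F := if `[< x = rho >] then f else 1.

Fixpoint lampw (w : nat -> 'I_3) (u : seq lletter) (x : ray) : F :=
  match u with
  | [::] => 1
  | None :: u' => lampw w u' (bact x gen_a)
  | Some (k, f) :: u' => lmark f x * lampw w u' (bact x (Bg w k))
  end.

Definition autw (w : nat -> 'I_3) (u : seq lletter) : autT :=
  ev w [seq omap fst l | l <- u].

Definition samew w (u v : seq lletter) : Prop :=
  autw w u = autw w v /\ lampw w u =1 lampw w v.

(** The argument [t] follows the image of the first letter of the ray. Since [rho] begins with
    [true], lamps survive on that side only. *)
Fixpoint sec (i : 'I_3) (t : bool) (u : seq lletter) : seq lletter :=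
  match u with
  | [::] => [::]
  | None :: u' => sec i (~~ t) u'
  | Some (k, f) :: u' =>
      if t then Some (k, f) :: sec i t u'
      else if chi i k then None :: sec i t u' else sec i t u'
  end.

Definition parity (u : seq lletter) : bool := odd (count (fun l => l == None) u).

Definition rtail (x : ray) : ray := fun n => x n.+1.

Lemma bact_node0 x g0 g1 s : bact x (node g0 g1 s) 0%N = s (x 0%N).
Proof. by rewrite /bact mkseqSl wact_node. Qed.

Lemma rtail_node x g0 g1 s :
  rtail (bact x (node g0 g1 s)) = bact (rtail x) (if x 0%N then g1 else g0).
Proof. by apply/funext => n; rewrite /rtail {1}/bact mkseqSl wact_node. Qed.

Lemma autw_cons w l u : autw w (l :: u) =
  (if l is Some (k, _) then Bg w k else gen_a) * autw w u.
Proof. by rewrite /autw /= ev_cons; case: l => [[]|]. Qed.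

Lemma autw_sec w t y u : wact (autw w u) (t :: y) =
  t (+) parity u :: wact (autw (shift_letters w) (sec (w 0%N) t u)) y.
Proof.
elim: u t y => [|[[k f]|] u IHu] t y; first by rewrite /autw /= !ev_nil addbF.
  rewrite autw_cons wactM BgE wact_node perm1 IHu /=; congr (_ :: _).
  case: t => /=; first by rewrite autw_cons wactM.
  by rewrite /aexp; case: (chi _ k); rewrite ?autw_cons ?wactM.
by rewrite autw_cons wactM wact_gen_a IHu /parity /= addNb addbN.
Qed.

Lemma rhoE x : `[< x = rho >] = x 0%N && `[< rtail x = rho >].
Proof.
apply/asboolP/andP => [->|[x0 /asboolP xr]]; first by split=> //; apply/asboolP.
by apply/funext => -[//|n]; rewrite -[LHS]/(rtail x n) xr.
Qed.

Lemma lampw_sec w u x :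
  lampw w u x = lampw (shift_letters w) (sec (w 0%N) (x 0%N) u) (rtail x).
Proof.
elim: u x => [//|[[k f]|] u IHu] x /=; last first.
  rewrite IHu /gen_a bact_node0 rtail_node if_same bact1.
  by have -> : tperm false true (x 0%N) = ~~ x 0%N by exact: flipE.
rewrite IHu BgE bact_node0 perm1 rtail_node /lmark rhoE.
case: (x 0%N) => //=; rewrite mul1g /aexp; case: (chi _ k) => //=.
by rewrite bact1.
Qed.

Lemma samew_sec w u v : parity u = parity v ->
  (forall t, samew (shift_letters w) (sec (w 0%N) t u) (sec (w 0%N) t v)) -> samew w u v.
Proof.
move=> puv suv; split; last by move=> x; rewrite [LHS]lampw_sec [RHS]lampw_sec; case: (suv (x 0%N)).
by apply: autT_ext => -[|t y]; rewrite ?wact_nil // [LHS]autw_sec [RHS]autw_sec puv; case: (suv t) => ->.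
Qed.

Definition lmul (x y : klein * F) : klein * F := (klein_add x.1 y.1, x.2 * y.2).

(** Adjacent letters merge and their lamps multiply because the letters fix [rho]. Adjacent [a] are
    not cancelled; a trivial syllable separates them. *)
Fixpoint nrm (u : seq lletter) : seq (klein * F) :=
  match u with
  | [::] => [:: (k0, 1)]
  | None :: u' => (k0, 1) :: nrm u'
  | Some x :: u' => if nrm u' is y :: r then lmul x y :: r else [:: x]
  end.

Fixpoint denrm_tail (r : seq (klein * F)) : seq lletter :=
  if r is y :: r' then None :: Some y :: denrm_tail r' else [::].

(* [denrm [:: x0; ...; xn]] is the word [x0 a x1 a ... a xn]. *)
Definition denrm (r : seq (klein * F)) : seq lletter :=
  if r is x :: r' then Some x :: denrm_tail r' else [::].

Lemma nrm_neq0 u : exists y r, nrm u = y :: r.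
Proof.
elim: u => [|[x|] u [y [r E]]] /=; first by exists (k0, 1), [::].
  by rewrite E; exists (lmul x y), r.
by exists (k0, 1), (nrm u).
Qed.

Lemma samew_refl w u : samew w u u. Proof. by []. Qed.
Lemma samew_sym w u v : samew w u v -> samew w v u.
Proof. by move=> [h1 h2]; split=> // x; rewrite h2. Qed.
Lemma samew_trans w u v z : samew w u v -> samew w v z -> samew w u z.
Proof. by move=> [h1 h2] [h3 h4]; split; [rewrite h1 | move=> x; rewrite h2]. Qed.

Lemma samew_cons w l u v : samew w u v -> samew w (l :: u) (l :: v).
Proof.
move=> [h1 h2]; split; first by rewrite !autw_cons h1.
by move=> x; case: l => [[k f]|] /=; rewrite h2.
Qed.

Lemma samew_one w u : samew w (Some (k0, 1) :: u) u.
Proof.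
split; first by rewrite autw_cons Bg0 mul1g.
by move=> x /=; rewrite Bg0 bact1 /lmark; case: ifP; rewrite mul1g.
Qed.

Lemma samew_lmul w x y u : samew w (Some (lmul x y) :: u) (Some x :: Some y :: u).
Proof.
case: x y => [k f] [l g]; split; first by rewrite !autw_cons mulgA BgM.
move=> x /=; rewrite -BgM bactM mulgA; congr (_ * _).
have E : `[< bact x (Bg w k) = rho >] = `[< x = rho >].
  apply/asboolP/asboolP => [h|->]; last exact: bact_rho.
  by rewrite -[x]bact1 -(Bg2 w k) bactM h bact_rho.
by rewrite /lmark E; case: ifP => _ //; rewrite mulg1.
Qed.

Lemma samew_nrm w u : samew w (denrm (nrm u)) u.
Proof.
elim: u => [|[x|] u IHu]; first exact: samew_one.
  have [y [r E]] := nrm_neq0 u; move: IHu; rewrite /= E => IHu.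
  by apply: samew_trans (samew_lmul _ _ _ _) _; exact: samew_cons.
have [y [r E]] := nrm_neq0 u; move: IHu; rewrite /= E => IHu.
by apply: samew_trans (samew_one _ _) _; exact: samew_cons.
Qed.

Definition secn (i : 'I_3) (t : bool) (u : seq (klein * F)) : seq (klein * F) :=
  nrm (sec i t (denrm u)).

Definition symbol : finType := (bool + option (klein * F))%type.

Fixpoint ser (w : nat -> 'I_3) (k : nat) (u : seq (klein * F)) : seq symbol :=
  if k is k'.+1 then
    inl (parity (denrm u)) :: ser (shift_letters w) k' (secn (w 0%N) false u)
      ++ ser (shift_letters w) k' (secn (w 0%N) true u)
  else rcons [seq inr (Some x) | x <- u] (inr None).

(** Parities at the inner vertices and the words at the leaves determine the element. Preorder and
    the terminator [inr None] make this a prefix code; the arbitrary continuations [r] and [s] let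
    the induction peel off one subtree after the other. *)
Lemma ser_inj w k u v r s : ser w k u ++ r = ser w k v ++ s ->
  samew w (denrm u) (denrm v) /\ r = s.
Proof.
elim: k w u v r s => [|k IHk] w u v r s.
  rewrite /= !cat_rcons => E.
  suff [-> ->] : u = v /\ r = s by split.
  elim: u v E => [|x u IHu] [|y v] //= [].
    by move=> ->.
  by move=> -> /IHu[-> ->].
rewrite /= -!catA => -[puv] /IHk[s0 /IHk[s1 rs]]; split=> //.
apply: samew_sec puv _ => t.
apply: samew_trans (samew_sym (samew_nrm _ _)) _; apply: samew_trans (samew_nrm _ _).
by case: t.
Qed.

Fixpoint short_words (Q : finType) (T : nat) : seq (seq Q) :=
  if T is T'.+1 then [::] :: [seq q :: s | q <- enum Q, s <- short_words Q T'] else [:: [::]].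

Lemma size_short_words (Q : finType) T : (size (short_words Q T) <= #|Q|.+1 ^ T)%N.
Proof.
elim: T => [//|T IHT] /=; rewrite size_allpairs -cardE expnS mulSn.
have p0 : (0 < #|Q|.+1 ^ T)%N by rewrite expn_gt0.
by rewrite -add1n leq_add // leq_mul.
Qed.

Lemma mem_short_words (Q : finType) T (s : seq Q) : (size s <= T)%N -> s \in short_words Q T.
Proof.
elim: T s => [|T IHT] [|q s] //= sT; rewrite inE /=.
by apply: allpairs_f; [rewrite mem_enum | exact: IHT].
Qed.

Lemma few_codes (Q : finType) (T : eqType) (A : seq T) (c : T -> seq Q) (n : nat) :
  uniq A -> {in A &, injective c} -> {in A, forall x, (size (c x) <= n)%N} ->
  (size A <= #|Q|.+1 ^ n)%N.
Proof.
move=> uA cI cn; apply: leq_trans (size_short_words Q n).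
rewrite -(size_map c); apply: uniq_leq_size; first by rewrite map_inj_in_uniq.
by move=> _ /mapP[x xA ->]; apply: mem_short_words; exact: cn.
Qed.

Local Open Scope ring_scope.

(** * The contracting norm and the length of the code *)

Section Norm.
Variables (R : realFieldType) (eta : R).
Hypothesis heta : eta * eta * eta + eta * eta + eta = 2.
Variable slow : nat -> bool.
Local Notation omega := (omega slow).
Local Notation fast := (fast slow).
Local Notation switch := (switch slow).

Definition up_weight n (k : klein) : R := weight eta (fast n) (omega n) k.
Definition up_a n : R := aweight eta (fast n).
Definition up_norm n (u : seq (klein * F)) : R := \sum_(x <- u) (up_weight n x.1 + up_a n).
(** At a switch only crude bounds remain: a syllable weighs between [1/4] and [1], and [urate] is at
    least [3/4]; the factor [8] exceeds the required [16/3]. *)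
Definition up_mult n : R := urate eta (fast n) * (if switch n then 8 else 1).

Definition raw_norm n (u : seq lletter) : R :=
  \sum_(l <- u) (if l is Some x then up_weight n x.1 else up_a n).

Lemma up_weight0 n : up_weight n k0 = 0.
Proof. by rewrite /up_weight /weight eqxx orbT. Qed.

Lemma up_norm_nrm n u : up_norm n (nrm u) <= up_a n + raw_norm n u.
Proof.
rewrite /up_norm /raw_norm; elim: u => [|[x|] u IHu] /=.
- by rewrite big_seq1 big_nil up_weight0 addr0 add0r.
- have [y [r E]] := nrm_neq0 u; move: IHu; rewrite E !big_cons /=.
  by have := weight_add heta (fast n) (omega n) x.1 y.1; rewrite /up_weight; lra.
- by rewrite !big_cons /= up_weight0; lra.
Qed.

Lemma raw_norm_sec n (i : 'I_3) u : raw_norm n (sec i false u) + raw_norm n (sec i true u) =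
  \sum_(l <- u) (if l is Some x then up_weight n x.1 + up_a n * (chi i x.1)%:R else 0).
Proof.
rewrite /raw_norm; elim: u => [|[[k f]|] u IHu] /=; first by rewrite !big_nil addr0.
  rewrite !big_cons -IHu /=; case: (chi i k); rewrite ?big_cons /=; lra.
by rewrite big_cons -IHu addrC add0r.
Qed.

Lemma up_step n k : up_weight n.+1 k + up_a n.+1 * (chi (omega n) k)%:R <=
  up_mult n * (up_weight n k + up_a n).
Proof.
rewrite /up_weight /up_a /up_mult; case sw: (switch n); last first.
  move: sw; rewrite /switch => /negbFE/andP[/eqP <- /eqP ->].
  by rewrite mulr1; exact: weight_step.
have [w0 w1] := weight_bounds heta (fast n) (omega n) k.
have [w0' w1'] := weight_bounds heta (fast n.+1) (omega n.+1) k.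
have /andP[a1 a2] := aweight_bounds heta (fast n).
have /andP[a1' a2'] := aweight_bounds heta (fast n.+1).
have h : aweight eta (fast n.+1) * (chi (omega n) k)%:R <= aweight eta (fast n.+1).
  by case: (chi _ k); rewrite ?mulr1 ?mulr0 //; lra.
have u34 : 3 / 4 <= urate eta (fast n).
  by rewrite /urate; case: (fast n); [apply: ltW; exact: eta_gt | lra].
have : 3 / 4 * (4^-1) <= urate eta (fast n) * (weight eta (fast n) (omega n) k + aweight eta (fast n)).
  by apply: ler_pM; lra.
lra.
Qed.

Lemma up_norm_secn n u :
  up_norm n.+1 (secn (omega n) false u) + up_norm n.+1 (secn (omega n) true u) <=
  up_mult n * up_norm n u + 2.
Proof.
have h0 := up_norm_nrm n.+1 (sec (omega n) false (denrm u)).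
have h1 := up_norm_nrm n.+1 (sec (omega n) true (denrm u)).
have := raw_norm_sec n.+1 (omega n) (denrm u).
have /andP[_ a2] := aweight_bounds heta (fast n.+1).
set S := \sum_(l <- _) _ => E.
have : S <= up_mult n * up_norm n u.
  rewrite /S /up_norm mulr_sumr; case: u {h0 h1 E S} => [|x u] /=; first by rewrite !big_nil.
  rewrite !big_cons lerD ?up_step //; elim: u => [|y u IHu] /=; first by rewrite !big_nil.
  by rewrite !big_cons add0r lerD ?up_step.
by rewrite /secn /up_a in h0 h1 *; lra.
Qed.

Lemma up_norm_size n u : (size u)%:R <= 4 * up_norm n u.
Proof.
rewrite /up_norm; elim: u => [|x u IHu]; first by rewrite big_nil mulr0.
rewrite big_cons -[(size (x :: u))%:R]natr1.
have [w0 _] := weight_bounds heta (fast n) (omega n) x.1.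
have /andP[a1 _] := aweight_bounds heta (fast n).
by rewrite /up_weight /up_a; lra.
Qed.

Lemma up_norm_le n u : up_norm n u <= (size u)%:R.
Proof.
rewrite /up_norm; elim: u => [|x u IHu]; first by rewrite big_nil.
rewrite big_cons -[(size (x :: u))%:R]natr1.
have [_ w1] := weight_bounds heta (fast n) (omega n) x.1.
by rewrite /up_weight /up_a; lra.
Qed.

Lemma up_mult_le n : 0 <= up_mult n <= 8 ^+ switch n.
Proof.
have e0 := eta_gt0 heta; have e1 := eta_lt1 heta.
rewrite /up_mult /urate; case: (fast n); case: (switch n);
  rewrite ?expr1 ?expr0; apply/andP; split; lra.
Qed.

(** Normalising adds a constant at each vertex, which accumulates to a multiple of [2 ^ k],
    comparable with the number of leaves; a switch may magnify it by [8]. *)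
Lemma size_ser n k u :
  (size (ser (shiftn omega n) k u))%:R <=
  4 * (\prod_(m < k) up_mult (n + m)%N) * up_norm n u +
  8 * (2 ^+ k - 1) * \prod_(m < k) 8 ^+ switch (n + m)%N + (2 ^+ k.+1 - 1).
Proof.
elim: k n u => [|k IHk] n u.
  rewrite /= size_rcons size_map !big_ord0 -natr1 expr0 expr1.
  by have := up_norm_size n u; lra.
have w0 : shiftn omega n 0%N = omega n by rewrite /shiftn addn0.
rewrite /= size_cat shift_shiftn w0 -[(_ + _).+1%:R]natr1 natrD.
have I0 := IHk n.+1 (secn (omega n) false u); have I1 := IHk n.+1 (secn (omega n) true u).
have E (f : nat -> R) : \prod_(m < k.+1) f (n + m)%N = f n * \prod_(m < k) f (n.+1 + m)%N.
  rewrite big_ord_recl /= addn0; congr (_ * _); apply: eq_bigr => m _.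
  by rewrite /= addSnnS.
rewrite (E up_mult) (E (fun m => 8 ^+ switch m)).
move: I0 I1; set P := \prod_(m < k) up_mult _; set S := \prod_(m < k) 8 ^+ _ => I0 I1.
have P0 : 0 <= P by apply: prodr_ge0 => m _; case/andP: (up_mult_le (n.+1 + m)).
have PS : P <= S by apply: ler_prod => m _; exact: up_mult_le.
have step := ler_wpM2l P0 (up_norm_secn n u).
have S0 : 0 <= S by apply: le_trans PS.
have s1 : S <= 8 ^+ switch n * S by rewrite ler_peMl //; case: (switch n); rewrite ?expr1 ?expr0; lra.
have p1 : 1 <= 2 ^+ k :> R by rewrite exprn_ege1 // ler1n.
rewrite !exprS in I0 I1 *; set p := 2 ^+ k in p1 I0 I1 *.
set a := up_norm n.+1 _ in I0 step; set b := up_norm n.+1 _ in I1 step.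
have s2 : 8 * (2 * p - 1) * S <= 8 * (2 * p - 1) * (8 ^+ switch n * S).
  by rewrite ler_wpM2l //; lra.
have -> : 4 * (up_mult n * P) * up_norm n u = 4 * (P * (up_mult n * up_norm n u + 2)) - 8 * P.
  by ring.
nra.
Qed.

End Norm.

End LampWords.

End Encoding.

(** * From words to balls for an arbitrary generating set *)

Section WreathBalls.
Local Open Scope classical_set_scope.
Local Open Scope group_scope.

Section WordBall.
Variables (G : groupType) (S : {fset G}).

Lemma word_ball1 r : word_ball S r 1.
Proof. by exists [::]; rewrite big_nil. Qed.

Lemma word_ball_le r r' : (r <= r')%N -> word_ball S r `<=` word_ball S r'.
Proof. by move=> rr' x [s [sr sS ->]]; exists s; split=> //; apply: leq_trans rr'. Qed.

Lemma word_ballM r r' x y : word_ball S r x -> word_ball S r' y -> word_ball S (r + r') (x * y).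
Proof.
move=> [s [sr sS ->]] [t [tr tS ->]]; exists (s ++ t); split.
- by rewrite size_cat leq_add.
- by rewrite all_cat sS.
- by rewrite big_cat.
Qed.

Lemma word_ballV r x : word_ball S r x -> word_ball S r x^-1.
Proof.
move=> [s [sr sS ->]]; exists (rev [seq y^-1 | y <- s]); split.
- by rewrite size_rev size_map.
- rewrite all_rev all_map; apply: sub_all sS => y /=.
  by rewrite invgK orbC.
- elim: s {sr sS} => [|y s IHs]; first by rewrite !big_nil invg1.
  by rewrite big_cons invgM IHs /= rev_cons -cats1 big_cat big_seq1.
Qed.

Lemma generated_word_ball x : Defs.generated [set` S] x -> exists r, word_ball S r x.
Proof.
apply: (@generated_min _ _ [set x | exists r, word_ball S r x]).
  split=> [|y z [r yr] [r' zr']|y [r yr]]; first by exists 0%N; exact: word_ball1.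
    by exists (r + r')%N; exact: word_ballM.
  by exists r; exact: word_ballV.
move=> y yS; exists 1%N, [:: y]; rewrite big_seq1; split=> //=.
by rewrite andbT; apply/orP; left.
Qed.

Lemma word_ball_prod (I : Type) (s : seq I) (f : I -> G) c :
  (forall i, word_ball S c (f i)) -> word_ball S (c * size s) (\prod_(i <- s) f i).
Proof.
move=> fc; elim: s => [|i s IHs]; first by rewrite big_nil; exact: word_ball1.
by rewrite big_cons mulnS; exact: word_ballM.
Qed.

Lemma mem_growth r x : (x \in (fset_set (word_ball S r) : seq G)) = (x \in word_ball S r).
Proof. by rewrite in_fset_set //; exact: finite_word_ball. Qed.

End WordBall.

(** * Words representing elements of the wreath product *)

Section Transfer.
Variables (F : finGroupType) (omega : nat -> 'I_3).
Local Notation X := (Xtype omega).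
Local Notation G := (Ggroup omega).
Local Notation Gam := (Gamma F omega).

Definition rep (g : Gam) (u : seq (lletter F)) : Prop :=
  Defs.gval g.2 = autw omega u /\ forall x : X, g.1 x = lampw omega u (\val x).

Lemma rep_inj g h u v : rep g u -> rep h v -> samew omega u v -> g = h.
Proof.
case: g h => [p g] [q h] [/= g2 g1] [/= h2 h1] [uv1 uv2].
congr pair; last by apply: gval_inj; rewrite g2 h2.
by apply: lamps_ext => x; rewrite g1 h1.
Qed.

Lemma autw_cat w (u v : seq (lletter F)) : autw w (u ++ v) = autw w u * autw w v.
Proof. by rewrite /autw map_cat ev_cat. Qed.

Lemma lampw_cat w (u v : seq (lletter F)) x :
  lampw w (u ++ v) x = lampw w u x * lampw w v (bact x (autw w u)).
Proof.
elim: u x => [|[[k f]|] u IHu] x; rewrite /= ?IHu.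
- by rewrite mul1g /autw /= ev_nil bact1.
- by rewrite autw_cons bactM mulgA.
- by rewrite autw_cons bactM.
Qed.

Lemma repM g h u v : rep g u -> rep h v -> rep (g * h) (u ++ v).
Proof.
case: g h => [p g] [q h] [/= g2 g1] [/= h2 h1]; split.
  by rewrite autw_cat -g2 -h2.
move=> x; rewrite lampw_cat -g1 -g2.
rewrite -[in RHS](h1 (Xact omega x g)).
by [].
Qed.

Lemma rep1 : rep 1 [::].
Proof. by split; rewrite /= /autw /= ?ev_nil. Qed.

Definition linv (l : lletter F) : lletter F := if l is Some (k, f) then Some (k, f^-1) else None.

Lemma samew_linv l : samew omega [:: l; linv l] [::].
Proof.
case: l => [[k f]|]; split.
- by rewrite !autw_cons mulgA Bg2 mul1g.
- move=> x /=; rewrite mulg1 /lmark.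
  have -> : `[< bact x (Bg omega k) = rho >] = `[< x = rho >].
    apply/asboolP/asboolP => [h|->]; last exact: bact_rho.
    by rewrite -[x]bact1 -(Bg2 omega k) bactM h bact_rho.
  by case: ifP => _; rewrite ?mulgV ?mulg1.
- by rewrite !autw_cons mulgA mulaa mul1g.
- by move=> x.
Qed.

Lemma samew_cat (u u' v v' : seq (lletter F)) : samew omega u u' -> samew omega v v' ->
  samew omega (u ++ v) (u' ++ v').
Proof.
move=> [h1 h2] [h3 h4]; split; first by rewrite !autw_cat h1 h3.
by move=> x; rewrite !lampw_cat h1 h2 h4.
Qed.

Lemma repV g u : rep g u -> rep g^-1 (rev [seq linv l | l <- u]).
Proof.
have K : samew omega (u ++ rev [seq linv l | l <- u]) [::].
  elim: u => [//|l u IHu]; rewrite /= rev_cons -cats1 catA.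
  apply: samew_trans (samew_linv l); apply: samew_cons.
  exact: (samew_cat IHu (samew_refl omega [:: linv l])).
move=> [g2 g1]; have [K1 K2] := K.
have E2 : Defs.gval g.2^-1 = autw omega (rev [seq linv l | l <- u]).
  rewrite gvalV g2; apply: (@mulgI _ (autw omega u)).
  by rewrite mulgV -autw_cat K1 /autw /= ev_nil.
split; first exact: E2.
move=> x; pose y := Xact omega x g.2^-1.
have yx : bact (\val y) (autw omega u) = \val x.
  by rewrite -g2 /= -bactM gvalV mulVg bact1.
have := K2 (\val y); rewrite lampw_cat yx -g1 /= => /eqP.
rewrite -eq_invg_mul => /eqP <-.
by [].
Qed.

Definition embed (g : G) : Gam := (lamp_one X F, g).
Definition lampel (p : lamps X F) : Gam := (p, 1).

Lemma rep_embed g : exists u, rep (embed g) u.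
Proof.
suff: Defs.generated (Ggens omega) `<=` [set t | exists u : seq (lletter F),
    autw omega u = t /\ forall x, lampw omega u x = 1].
  move=> /(_ _ (gvalP g)) [u [ug u1]]; exists u; split; first exact: esym ug.
  by move=> x; rewrite u1.
apply: generated_min; last first.
  have B k : exists u : seq (lletter F), autw omega u = Bg omega k /\
      forall x, lampw omega u x = 1.
    exists [:: Some (k, 1)]; split; first by rewrite autw_cons /autw /= ev_nil mulg1.
    by move=> x /=; rewrite /lmark; case: ifP; rewrite mulg1.
  move=> t [[[->|->]|->]|->]; rewrite ?gen_bg ?gen_cg ?gen_dg; try exact: B.
  by exists [:: None]; split=> //; rewrite autw_cons /autw /= ev_nil mulg1.
split=> [|s t [u [us u1]] [v [vt v1]]|s [u [us u1]]].
- by exists [::]; rewrite /autw /= ev_nil.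
- exists (u ++ v); split; first by rewrite autw_cat us vt.
  by move=> x; rewrite lampw_cat u1 v1 mulg1.
- exists (rev [seq omap (fun p => (p.1, 1)) l | l <- u]); split.
    rewrite /autw map_rev -map_comp ev_rev -us /autw; congr (ev _ _)^-1.
    by apply: eq_map => -[[]|].
  move=> x; have : all (fun l => if l is Some (_, f) then f == 1 else true)
      (rev [seq omap (fun p : klein * F => (p.1, 1 : F)) l | l <- u]).
    by rewrite all_rev all_map; apply/allP => -[[]|] //= *; rewrite eqxx.
  elim: (rev _) x => [//|[[k f]|] r IHr] x /=; last exact: IHr.
  by case/andP=> /eqP -> /IHr ->; rewrite /lmark; case: ifP; rewrite mulg1.
Qed.

Lemma rep_exists g : exists u, rep g u.
Proof.
have rep_delta0 f : rep (lampel (lamp_delta (exist _ rho (rho_orbit omega)) f)) [:: Some (k0, f)].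
  split; first by rewrite autw_cons Bg0 /autw /= ev_nil mulg1.
  move=> x /=; rewrite mulg1 /lmark.
  have -> : (x == exist _ rho (rho_orbit omega)) = `[< \val x = rho >].
    by apply/eqP/asboolP => [->|h] //; apply: val_inj.
  by [].
have rep_delta x f : exists u, rep (lampel (lamp_delta x f)) u.
  have [h hx] : exists h : G, Xact omega (exist _ rho (rho_orbit omega)) h = x.
    case: (x) => y yX; have [h _ hy] := set_mem yX.
    by exists h; apply: val_inj.
  have [u ru] := rep_embed h.
  exists (rev [seq linv l | l <- u] ++ ([:: Some (k0, f)] ++ u)).
  have -> : lampel (lamp_delta x f) =
      (embed h)^-1 * (lampel (lamp_delta (exist _ rho (rho_orbit omega)) f) * embed h).
    rewrite /lampel; have e : (1 : G) = h^-1 * (1 * h) by rewrite mul1g mulVg.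
    rewrite {1}e; congr pair; apply: lamps_ext => y.
    rewrite [RHS]/= invg1 mul1g mulg1.
    change ((if y == x then f else 1) =
      (if Xact omega y h^-1 == exist _ rho (rho_orbit omega) then f else 1)).
    congr (if _ then _ else _); rewrite -hx; apply/eqP/eqP => [->|<-].
      by rewrite -ractM mulgV ract1.
    by rewrite -ractM mulVg ract1.
  by apply: repM; [exact: repV | exact: repM].
have rep_lamp p : exists u, rep (lampel p) u.
  have [s sP] : exists s : seq X, forall x, p x != 1 -> x \in s.
    have /finite_seqP[s sE] := lampP p; exists s => x px.
    by have : [set x | p x != 1] x by []; rewrite sE.
  elim: s p sP => [|x s IHs] p sP.
    exists [::]; suff -> : lampel p = 1 by exact: rep1.
    congr pair; apply: lamps_ext => x /=; apply/eqP/negPn/negP => /sP.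
    by rewrite in_nil.
  have [u ru] := rep_delta x (p x).
  have [|v rv] := IHs (lamp_mul (lamp_delta x (p x)^-1) p).
    move=> y /=; have [->|yx] := eqVneq y x; first by rewrite mulVg eqxx.
    by rewrite mul1g => /sP; rewrite in_cons (negPf yx).
  exists (u ++ v).
  have -> : lampel p = lampel (lamp_delta x (p x)) *
      lampel (lamp_mul (lamp_delta x (p x)^-1) p).
    have e : (1 : G) = 1 * 1 by rewrite mul1g.
    rewrite /lampel {1}e; congr pair; apply: lamps_ext => y /=.
    rewrite Xact1; case: eqP => [->|_]; last by rewrite !mul1g.
    by rewrite mulKVg.
  exact: repM.
case: g => p g; have [u ru] := rep_lamp p; have [v rv] := rep_embed g.
exists (u ++ v); have -> : (p, g) = lampel p * embed g :> Gam.
  rewrite wreathM /= mul1g; congr pair.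
  by apply: lamps_ext => x /=; rewrite mulg1.
exact: repM.
Qed.

Variable S : {fset Gam}.

Lemma ball_rep : exists C : nat, forall r g, word_ball S r g ->
  exists2 u, (size u <= C * r)%N & rep g u.
Proof.
have [C CP] : exists C : nat, forall g, (g \in S) || (g^-1 \in S) ->
    exists2 u, (size u <= C)%N & rep g u.
  have [C CP] : exists C : nat, forall g, g \in S -> exists2 u, (size u <= C)%N & rep g u.
    have : forall s : seq Gam, exists C : nat, forall g, g \in s ->
        exists2 u, (size u <= C)%N & rep g u.
      elim=> [|h s [C CP]]; first by exists 0%N.
      have [u ru] := rep_exists h; exists (maxn (size u) C) => g.
      rewrite inE => /orP[/eqP ->|/CP[v vC rv]]; first by exists u => //; exact: leq_maxl.
      by exists v => //; apply: leq_trans vC (leq_maxr _ _).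
    by move=> /(_ S) [C CP]; exists C => g gS; apply: CP.
  exists C => g /orP[/CP//|/CP[u uC ru]].
  exists (rev [seq linv l | l <- u]); first by rewrite size_rev size_map.
  by rewrite -[g]invgK; exact: repV.
exists C => r g [s [sr sS ->]].
elim: s r sr sS => [|h s IHs] [|r] //= sr.
- by exists [::]; rewrite ?big_nil //; exact: rep1.
- by exists [::]; rewrite ?big_nil //; exact: rep1.
case/andP=> /CP[u uC ru] /(IHs _ sr)[v vC rv].
exists (u ++ v); first by rewrite size_cat mulnS leq_add.
by rewrite big_cons; exact: repM.
Qed.

Hypothesis genS : generates S.

Lemma ball_evk : exists C : nat, forall u : seq klein,
  exists2 g, word_ball S (C * size u) g & Defs.gval g.2 = evk omega u.
Proof.
have gen x : exists r, word_ball S r x.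
  by apply: generated_word_ball; rewrite [Defs.generated _]genS.
have Gk k : Defs.generated (Ggens omega) (gen_a * Bg omega k).
  have [G1 GM _] := is_subgroup_generated (Ggens omega).
  apply: GM; first by apply: generated_sub; do 3 left.
  case: k => [[] []].
  - by apply: generated_sub; do 2 left; right; rewrite gen_bg.
  - by apply: generated_sub; left; right; rewrite gen_cg.
  - by apply: generated_sub; right; rewrite gen_dg.
  - by rewrite -/k0 Bg0.
pose gk k : G := exist (fun y => y \in Defs.generated (Ggens omega)) _ (mem_set (Gk k)).
have [C CP] : exists C, forall k, word_ball S C (embed (gk k)).
  have [r1 h1] := gen (embed (gk (true, true))); have [r2 h2] := gen (embed (gk (true, false))).
  have [r3 h3] := gen (embed (gk (false, true))); have [r4 h4] := gen (embed (gk (false, false))).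
  exists (r1 + r2 + r3 + r4)%N => -[[] []].
  - by apply: word_ball_le h1; rewrite -!addnA leq_addr.
  - by apply: word_ball_le h2; rewrite -!addnA addnCA leq_addr.
  - by apply: word_ball_le h3; rewrite addnAC leq_addl.
  - by apply: word_ball_le h4; rewrite leq_addl.
exists C => u; exists (\prod_(k <- u) embed (gk k)); first exact: word_ball_prod.
rewrite /evk; elim: u => [|k u IHu]; first by rewrite !big_nil.
by rewrite !big_cons /= -IHu.
Qed.

End Transfer.

End WreathBalls.

(** * Growth at the scale lengths *)

Section ScaleGrowth.
Local Open Scope classical_set_scope.
Local Open Scope ring_scope.

Section GrowthBounds.
Variables (R : realType) (F : finGroupType) (eta : R).
Hypothesis heta : eta * eta * eta + eta * eta + eta = 2.
Variable slow : nat -> bool.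
Local Notation omega := (omega slow).
Variable S : {fset Gamma F omega}.

Lemma growth_lower : generates S ->
  exists C : nat, forall eps : R, 0 < eps -> exists k0, forall k, (k0 <= k)%N ->
    forall r : nat, C%:R * (expR (eps * k%:R) * scale_length eta slow k) <= r%:R ->
    expR ((ln 2 - eps) * k%:R) <= ln (growth S r)%:R.
Proof.
move=> genS; have [C CP] := ball_evk genS; exists C => eps /(lower_asymptotics heta slow)[k0 k0P].
exists k0 => k kk0 r Cr.
pose A : seq autT := undup [seq Defs.gval g.2 | g <- fset_set (word_ball S r)].
have AA g : in_ball omega (expR (eps * k%:R) * scale_length eta slow k) g -> g \in A.
  move=> [u su <-]; have [h hr <-] := CP u.
  rewrite mem_undup; apply/mapP; exists h => //.
  rewrite (in_fset_set (finite_word_ball S r)).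
  apply/mem_set; apply: word_ball_le hr.
  rewrite -(ler_nat R); apply: le_trans Cr; rewrite natrM ler_wpM2l //.
have := k0P k kk0 A (undup_uniq _) AA => h; apply: le_trans h _.
have sA : (size A <= growth S r)%N.
  by apply: leq_trans (size_undup _) _; rewrite size_map.
have [->|A0] := posnP (size A).
  rewrite ln0 //; have [->|g0] := posnP (growth S r); first by rewrite ln0.
  by rewrite ln_ge0 // ler1n.
by rewrite ler_ln ?posrE ?ltr0n ?(leq_trans A0) // ler_nat.
Qed.

Lemma size_nrm (u : seq (lletter F)) : (size (nrm u) <= (size u).+1)%N.
Proof.
elim: u => [//|[x|] u IHu] //=.
have [y [t E]] := nrm_neq0 u; move: IHu; rewrite E /=; exact: leqW.
Qed.

Lemma prod_up_mult k : \prod_(m < k) up_mult eta slow (0 + m) =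
  eta ^+ nfast slow k * 8 ^+ nswitch slow k.
Proof.
elim: k => [|k IHk]; first by rewrite big_ord0 /nfast /nswitch !big_ord0 mulr1.
rewrite big_ord_recr IHk /= nfastS /nswitch big_ord_recr /= -/(nswitch slow k) !exprD /up_mult /urate add0n.
by case: (fast slow k); case: (switch slow k); rewrite /= ?expr1 ?expr0; ring.
Qed.

(** For [r <= scale_length k] the contraction [eta ^ nfast] brings the total norm down to order
    [2 ^ k], where the additive terms of [size_ser] dominate anyway. *)
Lemma growth_upper :
  exists C : nat, forall k r : nat, r%:R <= scale_length eta slow k ->
    ln (growth S r)%:R <= C%:R * 8 ^+ nswitch slow k * 2 ^+ k :> R.
Proof.
have e1 := eta_lt1 heta; have e0 := eta_gt0 heta.
have [C CP] := ball_rep S; pose Q := symbol F.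
exists ((4 * C + 14) * #|Q|.+1)%N => k r rk.
have /choice[c cP] : forall g : Gamma F omega, exists u : seq (lletter F),
    word_ball S r g -> (size u <= C * r)%N /\ rep g u.
  move=> g; have [/CP[u u1 u2]|] := pselect (word_ball S r g); first by exists u.
  by exists [::].
pose code g := ser omega k (nrm (c g)).
pose N := ((4 * C + 14) * 8 ^ nswitch slow k * 2 ^ k)%N.
have inb g : g \in (fset_set (word_ball S r) : seq _) -> word_ball S r g.
  by rewrite mem_growth => /set_mem.
have : (growth S r <= #|Q|.+1 ^ N)%N.
  apply: (@few_codes Q _ _ code); first exact: fset_uniq.
    move=> g h /inb/cP[_ rg] /inb/cP[_ rh] gh.
    have [sgh _] : samew omega (denrm (nrm (c g))) (denrm (nrm (c h))) /\ [::] = [::] :> seq Q.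
      by apply: (@ser_inj _ omega k); rewrite !cats0.
    apply: (rep_inj rg rh); apply: samew_trans (samew_nrm omega (c h)).
    exact: samew_trans (samew_sym (samew_nrm omega (c g))) sgh.
  move=> g /inb/cP[sg _]; rewrite -(ler_nat R).
  have := size_ser heta slow 0 k (nrm (c g)).
  have -> : shiftn omega 0 = omega by apply/funext => m.
  move=> /le_trans; apply; rewrite prod_up_mult.
  have := up_norm_le heta slow 0 (nrm (c g)).
  have : (size (nrm (c g)))%:R <= C%:R * r%:R + 1 :> R.
    by rewrite -natrM natr1 ler_nat; apply: leq_trans (size_nrm _) _; rewrite ltnS.
  have -> : \prod_(m < k) 8 ^+ switch slow (0 + m) = 8 ^+ nswitch slow k :> R.
    by rewrite prodrXr.
  rewrite !natrM !natrX natrD natrM.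
  have f0 : 0 < eta ^+ nfast slow k by rewrite exprn_gt0.
  have f1 : eta ^+ nfast slow k <= 1 by rewrite exprn_ile1 // ltW.
  move: rk; rewrite /scale_length ler_pdivlMr //.
  have : 1 <= 8 ^+ nswitch slow k :> R by rewrite exprn_ege1 // ler1n.
  have : 1 <= 2 ^+ k :> R by rewrite exprn_ege1 // ler1n.
  rewrite exprS.
  have : 0 <= C%:R :> R by [].
  move: (up_norm _ _ _ _) (8 ^+ _) (2 ^+ k) (eta ^+ _) f0 f1 (size (nrm (c g)))%:R r%:R C%:R; clear=> U E T f f0 f1 s x c0 c00 T1 E1 xT sc Us.
  have h1 : f * U <= f * (c0 * x + 1) by rewrite ler_wpM2l ?(ltW f0) //; apply: le_trans Us sc.
  have h2 : c0 * (x * f) <= c0 * T by rewrite ler_wpM2l.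
  have h3 : f * U <= c0 * T + T by nra.
  have h4 : E * (f * U) <= E * (c0 * T + T) by rewrite ler_wpM2l //; lra.
  have h5 : T <= E * T by nra.
  lra.
rewrite -(ler_nat R) natrX => gN.
have [->|g0] := posnP (growth S r); first by rewrite ln0 // !mulr_ge0 // exprn_ge0.
have {}gN : ln (growth S r)%:R <= ln (#|Q|.+1%:R ^+ N) :> R.
  by rewrite ler_ln ?posrE ?exprn_gt0 ?ltr0n.
apply: le_trans gN _; rewrite lnXn // -[ln _ *+ N]mulr_natl.
have -> : ((4 * C + 14) * #|Q|.+1)%:R * 8 ^+ nswitch slow k * 2 ^+ k = N%:R * #|Q|.+1%:R :> R.
  by rewrite /N !natrM !natrX; ring.
by rewrite ler_wpM2l // ltW // ln_sublinear.
Qed.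

End GrowthBounds.

End ScaleGrowth.

(** * Choosing the modes *)

Section ModeChoice.
Local Open Scope ring_scope.

Definition fast_blocks (slow : nat -> bool) (b : nat) : nat := (\sum_(c < b) ~~ slow c * c)%N.

Lemma fast_blocksS slow b : fast_blocks slow b.+1 = (fast_blocks slow b + ~~ slow b * b)%N.
Proof. by rewrite /fast_blocks big_ord_recr. Qed.

Lemma nfast_blocks slow n :
  nfast slow n = (3 * fast_blocks slow (blk n) + ~~ slow (blk n) * off n)%N.
Proof.
elim: n => [|n IHn].
  by rewrite /nfast /fast_blocks big_ord0 /blk /off /= big_ord1 !muln0.
rewrite /nfast big_ord_recr /= -/(nfast slow n) IHn /fast.
case: (pos_step n) => -[e [-> ->]]; last by lia.
by rewrite fast_blocksS muln0 addn0; case: (slow _) => /=; lia.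
Qed.

Lemma tri_le a b : (a <= b)%N -> (tri a <= tri b)%N.
Proof.
by move=> /subnKC <-; elim: (b - a)%N => [|d IHd]; rewrite ?addn0 ?addnS ?triS //; lia.
Qed.

Lemma blk_tri b : blk (3 * tri b.+1) = b.+1 /\ off (3 * tri b.+1) = 0%N.
Proof.
have [b0 lt E] := pos_spec (3 * tri b.+1); move: b0 lt E.
move: (blk _) (off _) => c o c0 lt E.
have cb : c = b.+1.
  have [h|h|//] := ltngtP c b.+1.
    by have := tri_le h; rewrite triS; lia.
  by have := tri_le h; rewrite (triS b.+1); lia.
by split=> //; rewrite cb in E; lia.
Qed.

Lemma tri_sqr b : (tri b <= b ^ 2)%N.
Proof. by case: b => [|b]; [rewrite /tri big_ord0 | have := tri2 b; rewrite -mulnn; nia]. Qed.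

Section Greedy.
Variables (R : realType) (P Q : R).
Hypotheses (Q0 : 0 <= Q) (QP : Q <= P) (P1 : P <= 1).

(* The phases are [2 ^ 2 ^ i <= n < 2 ^ 2 ^ i.+1], long enough for the earlier ones to be negligible. *)
Definition target (n : nat) : R := if odd (trunc_log 2 (trunc_log 2 n)) then P else Q.

(** A third of the number of fast levels in the blocks before [n], [tri n] being a third of all
    their levels. It is computed before the modes are defined from it; [greedyE] closes the loop. *)
Fixpoint greedy (n : nat) : nat :=
  if n is m.+1 then
    (greedy m + ((greedy m)%:R <= target m * (tri m)%:R)%R * m)%N
  else 0%N.

Definition greedy_slow (n : nat) : bool := ~~ ((greedy n)%:R <= target n * (tri n)%:R :> R).

Lemma greedyE n : fast_blocks greedy_slow n = greedy n.
Proof.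
elim: n => [|n IHn]; first by rewrite /fast_blocks big_ord0.
by rewrite fast_blocksS IHn /= negbK.
Qed.

Lemma target_bounds n : Q <= target n <= P.
Proof. by rewrite /target; case: ifP; rewrite lexx QP. Qed.

Lemma greedy_bounds n :
  Q * (tri n)%:R - n%:R <= (greedy n)%:R <= P * (tri n)%:R + n%:R.
Proof.
elim: n => [|n /andP[IH1 IH2]]; first by rewrite /tri big_ord0 /= !mulr0; lra.
have /andP[t1 t2] := target_bounds n.
rewrite /= triS !natrD natrM -[n.+1%:R]natr1.
have T0 : 0 <= (tri n)%:R :> R by []; have n0 : 0 <= n%:R :> R by [].
move: ((tri n)%:R) T0 n%:R n0 (target n) t1 t2 (greedy n)%:R IH1 IH2.
move=> T T0 x x0 t t1 t2 g IH1 IH2.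
have a1 := ler_wpM2r T0 t1; have a2 := ler_wpM2r T0 t2.
have b1 := ler_wpM2r x0 Q0; have b2 := ler_wpM2r x0 QP; have b3 := ler_wpM2r x0 P1.
by case: (lerP g (t * T)) => h /=; apply/andP; split; nra.
Qed.

(** At most [tri m] is inherited from earlier phases; afterwards each choice pushes the discrepancy
    towards zero and overshoots by no more than the current block. *)
Lemma greedy_phase m n p : 0 <= p <= 1 -> (m <= n)%N ->
  (forall c, (m <= c < n)%N -> target c = p) ->
  `|(greedy n)%:R - p * (tri n)%:R| <= (tri m)%:R + n%:R.
Proof.
move=> /andP[p0 p1] /subnKC <-; elim: (n - m)%N => [|d IHd] tp.
  rewrite addn0 ler_norml.
  have : (greedy m <= tri m)%N.
    elim: (m) => [//|c IHc] /=; rewrite triS leq_add //.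
    by case: (_ <= _ :> R); rewrite ?mul1n ?mul0n.
  rewrite -(ler_nat R); have : 0 <= (greedy m)%:R :> R by [].
  have : 0 <= m%:R :> R by [].
  move: (greedy m)%:R m%:R (tri m)%:R => g x T x0 g0 gT.
  have T0 : 0 <= T by apply: le_trans gT.
  have T1 := ler_wpM2r T0 p0; have T2 := ler_wpM2r T0 p1.
  by apply/andP; split; lra.
have {IHd}: `|(greedy (m + d))%:R - p * (tri (m + d))%:R| <= (tri m)%:R + (m + d)%:R.
  by apply: IHd => c /andP[c1 c2]; apply: tp; rewrite c1 addnS ltnW.
rewrite addnS /= tp ?leq_addr ?addnS //= triS !natrD natrM -[(m + d).+1%:R]natr1.
have T0 : 0 <= (tri m)%:R :> R by []; have x0 : 0 <= (m + d)%:R :> R by [].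
rewrite !ler_norml !natrD in x0 *.
move=> /andP[h1 h2]; have b2 := ler_wpM2r x0 p0; have b3 := ler_wpM2r x0 p1.
by case: (lerP (greedy (m + d))%:R (p * (tri (m + d))%:R)) => h /=;
  rewrite ?mul1r ?mul0r; apply/andP; split; lra.
Qed.

Lemma greedy_target i : exists2 n, (i < n)%N &
  `|(greedy n)%:R - (if odd i then P else Q) * (tri n)%:R| <= 2 * n%:R.
Proof.
(* The end of phase [i]. It is the square of the beginning [m], so the inherited [tri m <= m ^ 2] is
   itself no more than one block. *)
exists (2 ^ 2 ^ i.+1)%N.
  by do 2 apply: ltn_trans (ltn_expl _ (isT : 1 < 2)%N).
pose m := (2 ^ 2 ^ i)%N; have mE : (2 ^ 2 ^ i.+1 = m ^ 2)%N by rewrite -expnM expnSr.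
rewrite mE; have mn : (m <= m ^ 2)%N by rewrite -mulnn leq_pmulr // expn_gt0.
apply: (le_trans (greedy_phase _ mn _)).
- by case: ifP => _; rewrite ?P1 ?Q0 ?(le_trans Q0 QP) ?(le_trans QP P1).
- move=> c /andP[c1 c2]; rewrite /target (@trunc_log_eq 2 i) //.
  have c0 : (0 < c)%N by apply: leq_trans c1; rewrite expn_gt0.
  rewrite -mE in c2; rewrite trunc_log_max //=.
  rewrite ltnNge; apply: contraL c2 => h; rewrite -leqNgt.
  by apply: leq_trans (trunc_logP (isT : 1 < 2)%N c0); rewrite leq_exp2l.
- by rewrite mulr_natl mulr2n lerD2r ler_nat tri_sqr.
Qed.

End Greedy.

Lemma mode_exists (R : realType) (P Q : R) : 0 <= Q -> Q <= P -> P <= 1 ->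
  exists slow : nat -> bool, [/\
    forall k, Q * k%:R - 6 * (blk k)%:R <= (nfast slow k)%:R <= P * k%:R + 6 * (blk k)%:R,
    forall K, exists2 k, (K <= k)%N & P * k%:R - 6 * (blk k)%:R <= (nfast slow k)%:R &
    forall K, exists2 k, (K <= k)%N & (nfast slow k)%:R <= Q * k%:R + 6 * (blk k)%:R].
Proof.
move=> Q0 QP P1; pose slow := greedy_slow P Q.
have often i : exists2 k, (i <= k)%N & `|(nfast slow k)%:R - (if odd i then P else Q) * k%:R| <= 6 * (blk k)%:R.
  have [[//|n] ni h] := greedy_target Q0 QP P1 i.
  have [b o] := blk_tri n; exists (3 * tri n.+1)%N.
    by rewrite triS; lia.
  rewrite nfast_blocks b o muln0 addn0 greedyE !natrM mulrCA -mulrBr normrM ger0_norm //.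
  by move: h; move: `|_| => x; lra.
exists slow; split=> [k|K|K].
- have [b0 lt E] := pos_spec k.
  rewrite {1 5}E nfast_blocks greedyE !natrD !natrM.
  have /andP[h1 h2] := greedy_bounds Q0 QP P1 (blk k).
  have : (off k)%:R <= 3 * (blk k)%:R :> R by rewrite -natrM ler_nat ltnW.
  have o0 : 0 <= (off k)%:R :> R by [].
  have f1 : 0 <= (~~ slow (blk k))%:R * (off k)%:R :> R by [].
  have f2 : (~~ slow (blk k))%:R * (off k)%:R <= (off k)%:R :> R.
    by rewrite ler_piMl // lern1 leq_b1.
  have b1 := ler_wpM2r o0 QP; have b2 := ler_wpM2r o0 Q0; have b3 := ler_wpM2r o0 P1.
  by move=> ob; apply/andP; split; lra.
- have [k h1] := often (K.*2.+1); rewrite /= odd_double /= ler_norml => /andP[h2 h3].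
  by exists k; [lia | lra].
- have [k h1] := often (K.*2); rewrite odd_double /= ler_norml => /andP[h2 h3].
  by exists k; [lia | lra].
Qed.

End ModeChoice.

(** * Limits superior and inferior *)

Section LimitValues.
Local Open Scope classical_set_scope.
Local Open Scope ring_scope.

Section Limits.
Variable R : realType.

Lemma limn_esup_EFin (u : nat -> R) (b : R) :
  (forall d, 0 < d -> exists N, forall n, (N <= n)%N -> u n <= b + d) ->
  (forall d, 0 < d -> forall N, exists2 n, (N <= n)%N & b - d <= u n) ->
  limn_esup (fun n => (u n)%:E) = b%:E.
Proof.
move=> ub ob; rewrite limn_esup_lim (cvg_lim _ (@cvg_esups_inf R _)) //.
apply/eqP; rewrite eq_le; apply/andP; split.
  apply/lee_addgt0Pr => d /ub[N NP]; apply: (@le_trans _ _ (esups (fun n => (u n)%:E) N)).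
    by apply: ereal_inf_lbound; exists N.
  by apply: ge_ereal_sup => _ [n /= Nn <-]; rewrite lee_fin; exact: NP.
apply: le_ereal_inf_tmp => _ [N _ <-]; apply/lee_addgt0Pr => d d0.
have [n Nn bn] := ob d d0 N; apply: (@le_trans _ _ ((u n)%:E + d%:E)%E).
  by rewrite lee_fin; lra.
by apply: leeD2r; apply: ereal_sup_ubound; exists n.
Qed.

Lemma limn_einf_EFin (u : nat -> R) (a : R) :
  (forall d, 0 < d -> exists N, forall n, (N <= n)%N -> a - d <= u n) ->
  (forall d, 0 < d -> forall N, exists2 n, (N <= n)%N & u n <= a + d) ->
  limn_einf (fun n => (u n)%:E) = a%:E.
Proof.
move=> la oa; rewrite /limn_einf.
have -> : (\- (fun n => (u n)%:E))%E = (fun n => (- u n)%:E) by [].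
rewrite (@limn_esup_EFin _ (- a)) ?EFinN ?oppeK //.
- by move=> d /la[N NP]; exists N => n /NP; lra.
- by move=> d /oa h N; have [n Nn un] := h N; exists n => //; lra.
Qed.

Lemma bracket (u : nat -> R) : (forall k, k%:R <= u k) -> forall x K, u K < x ->
  exists2 k, (K <= k)%N & u k < x <= u k.+1.
Proof.
move=> u_ge x K uK.
have : exists n, x <= u (K + n)%N.
  have x0 : 0 <= x by apply: le_trans (ltW uK); apply: le_trans (u_ge K).
  exists (Num.truncn x).+1; apply: le_trans (u_ge _).
  by apply: le_trans (ltW (truncnS_gt x)) _; rewrite ler_nat leq_addl.
case/ex_minnP=> -[|n]; first by rewrite addn0 => /(lt_le_trans uK); rewrite ltxx.
rewrite addnS => xn min; exists (K + n)%N; first exact: leq_addr.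
rewrite xn andbT ltNge; apply/negP => /min; by rewrite ltnn.
Qed.

Lemma blk_small (A B e : R) : 0 < e -> exists k0, forall k, (k0 <= k)%N ->
  A + B * (blk k)%:R <= e * k%:R.
Proof.
move=> e0; pose B' := `|B| + 1; have B0 : 0 < B' by rewrite /B' ltr_pwDr.
pose q := (Num.truncn (2 * B' / e)).+1.
have qB : 2 * B' / e <= q%:R by rewrite ltW // truncnS_gt.
pose M := `|A| + B' * (1 + q%:R).
exists (Num.truncn (2 * M / e)).+1 => k kM.
have Mk : 2 * M / e <= k%:R.
  by apply: le_trans (ltW (truncnS_gt _)) _; rewrite ler_nat.
have bk := @blk_linear R q k isT.
move: Mk; rewrite ler_pdivrMr // => Mk.
have h1 : B * (blk k)%:R <= B' * (1 + q%:R + k%:R / q%:R).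
  apply: (@le_trans _ _ (B' * (blk k)%:R)); last by rewrite ler_wpM2l // ltW.
  by rewrite ler_wpM2r // /B'; have := ler_norm B; lra.
have h2 : B' * (k%:R / q%:R) <= e / 2 * k%:R.
  rewrite mulrA ler_pdivrMr // mulrAC ler_wpM2r //.
  by move: qB; rewrite ler_pdivrMr //; lra.
have := ler_norm A; move: h1 h2 Mk; rewrite /M.
by move: (k%:R / q%:R) `|A| => t A'; lra.
Qed.

End Limits.

End LimitValues.

(** * Logarithmic growth at the scale lengths *)

Section LogRatios.
Local Open Scope classical_set_scope.
Local Open Scope ring_scope.

Section Ratio.
Variables (R : realType) (F : finGroupType) (eta : R).
Hypothesis heta : eta * eta * eta + eta * eta + eta = 2.
Variable slow : nat -> bool.
Local Notation omega := (omega slow).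
Variable S : {fset Gamma F omega}.
Local Notation s := (scale_length eta slow).

Definition log_length k : R := ln (s k).

Definition scale_ratio k : R := k%:R * ln 2 / log_length k.

Definition growth_ratio (r : nat) : R := ln (ln (growth S r)%:R) / ln r%:R.

Lemma log_lengthE k : log_length k = k%:R * ln 2 - (nfast slow k)%:R * ln eta.
Proof.
have e0 := eta_gt0 heta.
rewrite /log_length /scale_length ln_div ?posrE ?exprn_gt0 // !lnXn //.
by rewrite -[ln 2 *+ k]mulr_natl -[ln eta *+ _]mulr_natl.
Qed.

Lemma expn_le_scale_length k : 2 ^+ k <= s k.
Proof.
have e0 := eta_gt0 heta; rewrite /scale_length ler_pdivlMr ?exprn_gt0 //.
by rewrite ler_piMr ?exprn_ge0 // exprn_ile1 ?(ltW e0) // ltW // (eta_lt1 heta).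
Qed.

Lemma scale_length_le_mul (C e : R) k : 1 <= C -> 0 < e -> s k <= C * (expR (e * k%:R) * s k).
Proof.
move=> C1 e0; rewrite mulrA ler_peMl ?(ltW (scale_length_gt0 heta slow k)) //.
by apply: mulr_ege1 => //; rewrite -[leLHS]expR0 ler_expR mulr_ge0 // ltW.
Qed.

Lemma log_length_ge k : k%:R * ln 2 <= log_length k.
Proof.
rewrite log_lengthE lerDl oppr_ge0 mulr_ge0_le0 // ln_le0 // ltW //.
exact: eta_lt1 heta.
Qed.

Lemma scale_ratio_bounds k : (0 < k)%N -> 0 < log_length k /\ 0 <= scale_ratio k <= 1.
Proof.
move=> k0; have h := log_length_ge k.
have L0 : 0 < k%:R * ln 2 :> R by rewrite mulr_gt0 ?ltr0n ?ln2_gt0.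
have L1 : 0 < log_length k by apply: lt_le_trans h.
by split=> //; rewrite /scale_ratio divr_ge0 ?(ltW L0) ?(ltW L1) //= ler_pdivrMr // mul1r.
Qed.

(** The window down to [s k / 6] covers both uses: the radii between consecutive scale lengths,
    whose ratio is at most [3], and the integer part of [s k]. *)
Lemma growth_ratio_le : forall d : R, 0 < d -> exists k0, forall k, (k0 <= k)%N ->
  forall r : nat, s k / 6 <= r%:R -> r%:R <= s k -> growth_ratio r <= scale_ratio k + d.
Proof.
move=> d d0; have [C0 C0P] := growth_upper heta S; have l2 := @ln2_gt0 R.
pose C := C0.+1; pose e := d * ln 2 / 2; have e0 : 0 < e by rewrite divr_gt0 // mulr_gt0.
have [k1 k1P] := @blk_small R (ln C%:R) (3 * ln 8) e e0.
have [k2 k2P] := @blk_small R (6 + 6 * d) 0 e e0.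
exists (maxn 3 (maxn k1 k2)) => k; rewrite !geq_max => /and3P[k3 kk1 kk2] r r1 r2.
have s8 : 8 <= s k.
  apply: le_trans (expn_le_scale_length k); rewrite (_ : 8 = 2 ^+ 3 :> R) ?ler_eXn2l ?ltr1n //.
  by rewrite !exprS expr0; lra.
have r1' : 1 < r%:R :> R by move: r1; lra.
have lr0 : 0 < ln r%:R :> R by rewrite ln_gt0.
have [L0 /andP[q0 q1]] := scale_ratio_bounds (leq_trans (isT : 0 < 3)%N k3).
have LE : k%:R * ln 2 = scale_ratio k * log_length k by rewrite /scale_ratio divfK // gt_eqF.
have L1 := log_length_ge k.
have lrL : log_length k - 6 <= ln r%:R.
  have : ln (s k / 6) <= ln r%:R by rewrite ler_ln ?posrE //; lra.
  rewrite ln_div ?posrE //; last by lra.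
  by rewrite -/(log_length k); have := @ln_sublinear R 6; lra.
have gl : ln (ln (growth S r)%:R) <= k%:R * ln 2 + e * k%:R.
  apply: le_trans (_ : ln (C%:R * 8 ^+ nswitch slow k * 2 ^+ k) <= _); last first.
    rewrite !lnM ?posrE ?exprn_gt0 ?mulr_gt0 ?exprn_gt0 // !lnXn //.
    rewrite -[ln 2 *+ k]mulr_natl -[ln 8 *+ _]mulr_natl addrC lerD2l.
    apply: le_trans (k1P k kk1); rewrite lerD2l.
    have l8 : 0 <= ln 8 :> R by rewrite ln_ge0 // ler1n.
    have := nswitch_blk slow k; rewrite -(ler_nat R) natrM => /(ler_wpM2r l8).
    by rewrite -!mulrA [ln 8 * _]mulrC.
  have X1 : 1 <= C%:R * 8 ^+ nswitch slow k * 2 ^+ k :> R.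
    by rewrite -!natrX -!natrM ler1n !muln_gt0 !expn_gt0.
  (* If the inner logarithm is not positive, the outer [ln] takes its default value [0]. *)
  have [g0|g0] := lerP (ln (growth S r)%:R : R) 0.
    by rewrite ln0 // ln_ge0.
  rewrite ler_ln ?posrE //; last by lra.
  apply: le_trans (C0P k r r2) _; rewrite -!mulrA ler_wpM2r ?mulr_ge0 ?exprn_ge0 //.
  by rewrite ler_nat /C.
rewrite /growth_ratio ler_pdivrMr //.
apply: le_trans gl _; have := k2P k kk2; rewrite mul0r addr0 => kd.
have h1 : (scale_ratio k + d) * (log_length k - 6) <= (scale_ratio k + d) * ln r%:R.
  by rewrite ler_wpM2l //; lra.
apply: le_trans h1; have h2 := ler_wpM2l (ltW d0) L1.
by rewrite LE; move: kd h2 q1; rewrite /e; lra.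
Qed.

(** The bound [e <= ln 2] is exported so that consecutive radii grow by at most [3 * expR e <= 6];
    the windows then cover all large radii. *)
Lemma growth_ratio_ge : generates S -> exists2 C : R, 1 <= C &
  forall d : R, 0 < d -> exists e : R, [/\ 0 < e, e <= ln 2 & exists k0, forall k, (k0 <= k)%N ->
  forall r : nat, C * (expR (e * k%:R) * s k) <= r%:R -> r%:R <= 6 * (C * (expR (e * k%:R) * s k)) ->
  scale_ratio k - d <= growth_ratio r].
Proof.
move=> genS; have [C0 C0P] := growth_lower heta genS; have l2 := @ln2_gt0 R.
exists C0.+1%:R; first by rewrite ler1n.
have C01 : C0%:R <= C0.+1%:R :> R by rewrite ler_nat.
set C : R := C0.+1%:R in C01 * => d d0; have C1 : 1 <= C by rewrite ler1n.
have [e [e0 e2 ed]] : exists e : R, [/\ 0 < e, e <= ln 2 & e <= d * ln 2 / 4].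
  have dl : 0 < d * ln 2 / 4 by rewrite divr_gt0 // mulr_gt0.
  exists (Num.min (ln 2) (d * ln 2 / 4)); split; first by rewrite lt_min l2 dl.
    by rewrite ge_min lexx.
  by rewrite ge_min lexx orbT.
exists e; split=> //; have [k1 k1P] := C0P e e0.
have dl : 0 < d * ln 2 / 2 by rewrite divr_gt0 // mulr_gt0.
have [k2 k2P] := @blk_small R (ln (6 * C)) 0 (d * ln 2 / 2) dl.
exists (maxn 3 (maxn k1 k2)) => k; rewrite !geq_max => /and3P[k3 kk1 kk2] r r1 r2.
have k0 : (0 < k)%N by apply: leq_trans k3.
have [L0 /andP[q0 q1]] := scale_ratio_bounds k0.
have LE : k%:R * ln 2 = scale_ratio k * log_length k by rewrite /scale_ratio divfK // gt_eqF.
have L1 := log_length_ge k.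
have s0 := scale_length_gt0 heta slow k.
have s1 : 1 < s k by apply: lt_le_trans (expn_le_scale_length k); rewrite exprn_egt1 ?ltr1n // -lt0n.
have X1 := scale_length_le_mul k C1 e0.
have r0 : 1 < r%:R :> R by apply: lt_le_trans r1; apply: lt_le_trans X1.
have lr0 : 0 < ln r%:R :> R by rewrite ln_gt0.
have lrL : ln r%:R <= log_length k + e * k%:R + ln (6 * C).
  have C0' : 0 < C by lra.
  apply: (@le_trans _ _ (ln (6 * (C * (expR (e * k%:R) * s k))))).
    by rewrite ler_ln ?posrE //; lra.
  have C6 : 0 < 6 * C by rewrite mulr_gt0.
  have E0 := expR_gt0 (e * k%:R); have E1 := mulr_gt0 E0 s0.
  have -> : ln (6 * (C * (expR (e * k%:R) * s k))) = ln (6 * C) + (e * k%:R + log_length k).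
    by rewrite mulrA lnM ?posrE // [ln (_ * s k)]lnM ?posrE // expRK.
  by lra.
have gl : (ln 2 - e) * k%:R <= ln (ln (growth S r)%:R).
  have h : expR ((ln 2 - e) * k%:R) <= ln (growth S r)%:R.
    apply: (k1P k kk1); apply: le_trans r1; apply: ler_wpM2r C01.
    by rewrite mulr_ge0 ?expR_ge0 // ltW.
  rewrite -[leLHS]expRK ler_ln ?posrE ?expR_gt0 //.
  by apply: lt_le_trans h; exact: expR_gt0.
rewrite /growth_ratio ler_pdivlMr //; apply: le_trans gl.
have K0 : 0 <= (ln 2 - e) * k%:R by rewrite mulr_ge0 // subr_ge0.
have [h|h] := lerP (scale_ratio k - d) 0.
  apply: le_trans K0; by rewrite mulr_le0_ge0 // ltW.
apply: (@le_trans _ _ ((scale_ratio k - d) * (log_length k + e * k%:R + ln (6 * C)))).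
  by rewrite ler_wpM2l // ltW.
have := k2P k kk2; rewrite mul0r addr0 => kA.
have A0 : 0 <= ln (6 * C) by rewrite ln_ge0 //; lra.
have ek : 0 <= e * k%:R by rewrite mulr_ge0 // ltW.
have h2 := ler_wpM2l (ltW d0) L1.
have h3 : e * k%:R <= d * ln 2 / 4 * k%:R by rewrite ler_wpM2r.
have h4 : scale_ratio k * (e * k%:R + ln (6 * C)) <= 1 * (e * k%:R + ln (6 * C)).
  by rewrite ler_wpM2r // addr_ge0.
have h5 : 0 <= d * (e * k%:R + ln (6 * C)) by rewrite mulr_ge0 ?addr_ge0 // ltW.
have h6 : (scale_ratio k - d) * (log_length k + e * k%:R + ln (6 * C)) =
  k%:R * ln 2 - d * log_length k + scale_ratio k * (e * k%:R + ln (6 * C))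
  - d * (e * k%:R + ln (6 * C)) by rewrite LE; ring.
rewrite h6; move: h2 h3 h4 h5 kA; move: (d * (_ + _)) (scale_ratio k * (_ + _)) (d * log_length k).
move: (ln (6 * C)) => A x y z *; lra.
Qed.

End Ratio.

End LogRatios.

(** * The exponents *)

Section FinalExponents.
Local Open Scope classical_set_scope.
Local Open Scope ring_scope.

Section Target.
Variables (R : realType) (eta : R).
Hypothesis heta : eta * eta * eta + eta * eta + eta = 2.
Variables (slow : nat -> bool) (g p d : R) (k : nat).
Hypotheses (g01 : 0 <= g <= 1) (gp : g * (ln 2 - p * ln eta) = ln 2) (d0 : 0 < d) (k0 : (0 < k)%N).
Hypothesis small : - (6 * ln eta) * (blk k)%:R <= d * ln 2 * k%:R.

Let h0 : 0 <= - ln eta.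
Proof. by rewrite oppr_ge0 ln_le0 // ltW // (eta_lt1 heta). Qed.

(** By [gp], the ratio would be exactly [g] if precisely [p * k] levels were fast; the error of [6]
    blocks is absorbed by [small]. *)
Lemma scale_ratio_ge : (nfast slow k)%:R <= p * k%:R + 6 * (blk k)%:R ->
  g - d <= scale_ratio eta slow k.
Proof.
move=> nf; case/andP: g01 => g0 g1.
have [L0 _] := scale_ratio_bounds heta slow k0.
rewrite /scale_ratio ler_pdivlMr //.
have Lk := log_length_ge heta slow k.
have := congr1 (fun x => g * x) (log_lengthE heta slow k).
have := ler_wpM2l (ltW d0) Lk.
have : g * ((nfast slow k)%:R * - ln eta) <= g * ((p * k%:R + 6 * (blk k)%:R) * - ln eta).
  by rewrite ler_wpM2l // ler_wpM2r.
have b0 : 0 <= (blk k)%:R * - ln eta by rewrite mulr_ge0.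
have := ler_wpM2r b0 g1; have := congr1 (fun x => k%:R * x) gp.
by move: small => /=; lra.
Qed.

Lemma scale_ratio_le : p * k%:R - 6 * (blk k)%:R <= (nfast slow k)%:R ->
  scale_ratio eta slow k <= g + d.
Proof.
move=> nf; case/andP: g01 => g0 g1.
have [L0 _] := scale_ratio_bounds heta slow k0.
rewrite /scale_ratio ler_pdivrMr //.
have Lk := log_length_ge heta slow k.
have := congr1 (fun x => g * x) (log_lengthE heta slow k).
have := ler_wpM2l (ltW d0) Lk.
have : g * ((p * k%:R - 6 * (blk k)%:R) * - ln eta) <= g * ((nfast slow k)%:R * - ln eta).
  by rewrite ler_wpM2l // ler_wpM2r.
have b0 : 0 <= (blk k)%:R * - ln eta by rewrite mulr_ge0.
have := ler_wpM2r b0 g1; have := congr1 (fun x => k%:R * x) gp.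
by move: small => /=; lra.
Qed.

End Target.

Section Exponents.
Variables (R : realType) (F : finGroupType) (eta : R).
Hypothesis heta : eta * eta * eta + eta * eta + eta = 2.
Variable slow : nat -> bool.
Variable S : {fset Gamma F (omega slow)}.
Hypothesis genS : generates S.
Local Notation s := (scale_length eta slow).
Local Notation gr := (growth_ratio R S).
Local Notation sr := (scale_ratio eta slow).

Lemma k_le_scale_length k : k%:R <= s k.
Proof.
apply: le_trans (expn_le_scale_length heta slow k).
by rewrite -natrX ler_nat ltnW // ltn_expl.
Qed.

Lemma scale_length_third k : s k.+1 <= 3 * s k.
Proof. by case/andP: (scale_lengthS heta slow k). Qed.

Lemma growth_ratio_le_scale d K : 0 < d -> exists r0, forall r : nat, (r0 <= r)%N ->
  exists2 k, (K <= k)%N & gr r <= sr k + d.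
Proof.
move=> /(growth_ratio_le heta S)[k0 k0P]; exists (Num.truncn (s (maxn K k0))).+1 => r rK.
have : s (maxn K k0) < r%:R.
  by apply: lt_le_trans (truncnS_gt _) _; rewrite ler_nat.
case/(bracket k_le_scale_length) => k Kk /andP[k1 k2]; exists k.+1.
  by apply: leq_trans (leqW Kk); exact: leq_maxl.
apply: k0P => //; first by apply: leq_trans (leqW Kk); exact: leq_maxr.
have := scale_length_third k; have := scale_length_gt0 heta slow k.
by move=> s0 s1; lra.
Qed.

Lemma growth_ratio_le_often d : 0 < d -> exists k0, forall k, (k0 <= k)%N ->
  exists2 r, (k <= r)%N & gr r <= sr k + d.
Proof.
move=> /(growth_ratio_le heta S)[k0 k0P]; exists (maxn 1 k0) => k; rewrite geq_max => /andP[k1 kk0].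
have s0 := scale_length_gt0 heta slow k.
have [sl su] : (Num.truncn (s k))%:R <= s k /\ s k < (Num.truncn (s k)).+1%:R.
  by apply/andP; apply: truncn_itv; exact: ltW.
have kr : (k <= Num.truncn (s k))%N by rewrite truncn_ge_nat ?k_le_scale_length // ltW.
exists (Num.truncn (s k)) => //; apply: k0P => //.
have : 1 <= (Num.truncn (s k))%:R :> R by rewrite ler1n (leq_trans k1).
by rewrite -natr1 in su; move=> t1; lra.
Qed.

Lemma growth_ratio_ge_scale d K : 0 < d -> exists r0, forall r : nat, (r0 <= r)%N ->
  exists2 k, (K <= k)%N & sr k - d <= gr r.
Proof.
have [C C1 CP] := growth_ratio_ge heta genS; move=> /CP[e [e0 e2 [k0 k0P]]].
pose u k := C * (expR (e * k%:R) * s k).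
have su k : s k <= u k := scale_length_le_mul heta slow k C1 e0.
exists (Num.truncn (u (maxn K k0))).+1 => r rK.
have : u (maxn K k0) < r%:R.
  by apply: lt_le_trans (truncnS_gt _) _; rewrite ler_nat.
case/(bracket (fun k => le_trans (k_le_scale_length k) (su k))) => k Kk /andP[k1 k2]; exists k.
  by apply: leq_trans Kk; exact: leq_maxl.
apply: k0P; [by apply: leq_trans Kk; exact: leq_maxr | exact: ltW |].
apply: le_trans k2 _; rewrite /u -[k.+1%:R]natr1 mulrDr mulr1 expRD.
have ee : expR e <= 2 by rewrite -(@lnK R 2) ?posrE // ler_expR.
have h1 := scale_length_third k; have E0 := expR_gt0 (e * k%:R).
have h2 : expR e * s k.+1 <= 2 * (3 * s k).
  by apply: ler_pM => //; rewrite ltW // scale_length_gt0.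
have h3 : expR (e * k%:R) * (expR e * s k.+1) <= expR (e * k%:R) * (2 * (3 * s k)).
  by rewrite ler_wpM2l // ltW.
have C0 : 0 <= C by apply: le_trans C1.
have := ler_wpM2l C0 h3; lra.
Qed.

Lemma growth_ratio_ge_often d : 0 < d -> exists k0, forall k, (k0 <= k)%N ->
  exists2 r, (k <= r)%N & sr k - d <= gr r.
Proof.
have [C C1 CP] := growth_ratio_ge heta genS; move=> /CP[e [e0 e2 [k0 k0P]]].
exists (maxn 1 k0) => k; rewrite geq_max => /andP[k1 kk0].
pose x := C * (expR (e * k%:R) * s k).
have sx : s k <= x := scale_length_le_mul heta slow k C1 e0.
have kx : k%:R <= x := le_trans (k_le_scale_length k) sx.
have x1 : 1 <= x by apply: le_trans kx; rewrite ler1n.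
have x0 : 0 <= x by apply: le_trans x1.
have [sl su] : (Num.truncn x)%:R <= x /\ x < (Num.truncn x).+1%:R.
  by apply/andP; exact: truncn_itv.
exists (Num.truncn x).+1; first by rewrite -(ler_nat R); apply: le_trans kx (ltW su).
by apply: k0P => //; [exact: ltW | rewrite -natr1 -/x; lra].
Qed.

Lemma exponents (a b : R) :
  (forall d, 0 < d -> exists K, forall k, (K <= k)%N -> a - d <= sr k <= b + d) ->
  (forall d K, 0 < d -> exists2 k, (K <= k)%N & sr k <= a + d) ->
  (forall d K, 0 < d -> exists2 k, (K <= k)%N & b - d <= sr k) ->
  lower_exponent R S = a%:E /\ upper_exponent R S = b%:E.
Proof.
move=> H1 H2 H3; split.
- apply: limn_einf_EFin => d d0; have d2 : 0 < d / 2 by rewrite divr_gt0.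
    have [K KP] := H1 _ d2; have [r0 r0P] := growth_ratio_ge_scale K d2.
    by exists r0 => r /r0P[k /KP/andP[h _]]; rewrite /growth_ratio; lra.
  move=> N; have [k0 k0P] := growth_ratio_le_often d2.
  have [k] := H2 _ (maxn N k0) d2; rewrite geq_max => /andP[kN /k0P[r kr h1]] h2.
  by exists r; [exact: leq_trans kr | move: h1; rewrite /growth_ratio; lra].
- apply: limn_esup_EFin => d d0; have d2 : 0 < d / 2 by rewrite divr_gt0.
    have [K KP] := H1 _ d2; have [r0 r0P] := growth_ratio_le_scale K d2.
    by exists r0 => r /r0P[k /KP/andP[_ h]]; rewrite /growth_ratio; lra.
  move=> N; have [k0 k0P] := growth_ratio_ge_often d2.
  have [k] := H3 _ (maxn N k0) d2; rewrite geq_max => /andP[kN /k0P[r kr h1]] h2.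
  by exists r; [exact: leq_trans kr | move: h1; rewrite /growth_ratio; lra].
Qed.

End Exponents.

End FinalExponents.

Unset Implicit Arguments.
Unset Strict Implicit.
Local Open Scope ring_scope.

Theorem theorem7p1 (R : realType) (F : finGroupType)
    (eta : R) (heta : root ('X^3 + 'X^2 + 'X - 2%:P) eta)
    (alpha beta : R)
    (halpha : ln 2 / (ln 2 - ln eta) <= alpha)
    (halphabeta : alpha <= beta) (hbeta : beta <= 1) :
  exists omega : nat -> 'I_3,
    forall S : {fset Gamma F omega}, generates S ->
      lower_exponent R S = alpha%:E /\ upper_exponent R S = beta%:E.
Proof.
have eq : eta * eta * eta + eta * eta + eta = 2.
  by move/rootP: heta; rewrite !hornerE /= !exprS expr0 mulr1; lra.
have l2 := @ln2_gt0 R.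
have l0 : ln eta < 0 by rewrite ln_lt0 // (eta_gt0 eq) (eta_lt1 eq).
have D0 : 0 < ln 2 - ln eta by lra.
have a0 : 0 < alpha by apply: lt_le_trans halpha; rewrite divr_gt0.
have b0 : 0 < beta by lra.
have a1 : alpha <= 1 by lra.
move: halpha; rewrite ler_pdivrMr // => ha.
(* The density of fast levels that produces the exponent [g]. It decreases in [g], so [beta]
   supplies the lower target and [alpha] the upper one; the hypothesis on [alpha] is exactly
   [frac alpha <= 1]. *)
pose frac g := (g^-1 - 1) * ln 2 / - ln eta.
have fracE g : 0 < g -> g * (ln 2 - frac g * ln eta) = ln 2.
  move=> g0; rewrite /frac; field; apply/andP; split; lra.
have A01 : 0 <= alpha <= 1 by rewrite a1 ltW.
have B01 : 0 <= beta <= 1 by rewrite hbeta ltW.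
have Q0 : 0 <= frac beta.
  apply: divr_ge0; last by lra.
  by apply: mulr_ge0; [rewrite subr_ge0 invf_ge1 | exact: ltW].
have QP : frac beta <= frac alpha.
  rewrite /frac ler_pM2r ?invr_gt0 ?oppr_gt0 // ler_pM2r // lerD2r lef_pV2 ?posrE //.
have P1 : frac alpha <= 1.
  rewrite /frac ler_pdivrMr ?oppr_gt0 // mul1r -(ler_pM2l a0) mulrA mulrBr mulfV ?gt_eqF //.
  by lra.
have [slow [S1 S2 S3]] := mode_exists Q0 QP P1.
exists (omega slow) => S genS; apply: (exponents eq) => //.
- move=> d d0; have dl : 0 < d * ln 2 by rewrite mulr_gt0.
  have [K KP] := @blk_small R 0 (- (6 * ln eta)) _ dl.
  exists (maxn 1 K) => k; rewrite geq_max => /andP[k1 /KP]; rewrite add0r => sm.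
  have /andP[h1 h2] := S1 k; apply/andP; split.
    by exact: (scale_ratio_ge eq A01 (fracE _ a0) d0 k1 sm).
  by exact: (scale_ratio_le eq B01 (fracE _ b0) d0 k1 sm).
- move=> d K d0; have dl : 0 < d * ln 2 by rewrite mulr_gt0.
  have [K' KP] := @blk_small R 0 (- (6 * ln eta)) _ dl.
  have [k] := S2 (maxn K (maxn 1 K')); rewrite !geq_max => /and3P[kK k1 /KP]; rewrite add0r => sm h.
  exists k => //.
  by exact: (scale_ratio_le eq A01 (fracE _ a0) d0 k1 sm).
- move=> d K d0; have dl : 0 < d * ln 2 by rewrite mulr_gt0.
  have [K' KP] := @blk_small R 0 (- (6 * ln eta)) _ dl.
  have [k] := S3 (maxn K (maxn 1 K')); rewrite !geq_max => /and3P[kK k1 /KP]; rewrite add0r => sm h.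
  exists k => //.
  by exact: (scale_ratio_ge eq B01 (fracE _ b0) d0 k1 sm).
Qed.
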